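(* Suppose that Assumptions 1, 2 and 3 (stated in the context) hold, and let $\{x_k\}$ be the sequence generated by the Anderson(1)-SEG algorithm (described in the context) with sample rate $$S_k:=\mathcal{N}\left\lceil (k+\lambda)^2(\ln(k+\lambda))^{2+2b}\right\rceil,\qquad \mathcal{N}=\mathcal{O}(n^2),\ b>0,\ \lambda>2 .$$ Given $\varsigma>0$, the algorithm achieves the tolerance $$\min_{0\le k\le N}\mathbb{E}\left[r_\gamma(x_k)^2\right]\le\varsigma$$ after $N=\mathcal{O}(b^{-1}\varsigma^{-1})$ iterations, and, with probability $1$, the oracle complexity $\sum_{k=0}^{N}(1+m_k)S_k$ is bounded above by $$b^{-3}\,\max_{0\le k\le N}\log_{\frac1\rho}\left(\frac{\gamma\tilde L_k}{\min\{\rho\mu,\gamma\}}\right)\left(\ln(b^{-1}\varsigma^{-1})\right)^{2+2b}\,\mathcal{O}(n^2\varsigma^{-3}),$$ where $m_k$ is the number of oracle calls used in the line search at iteration $k$ (so that $t_k=\gamma\rho^{m_k}$) and $\tilde L_k:=\frac1{S_k}\sum_{j=1}^{S_k}L(\xi^k_j)$.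
   Context: Setting. $X\subseteq\mathbb{R}^n$ is a closed convex set, $(\Xi,\mathcal{G})$ is a measurable space, $T:\Xi\times\mathbb{R}^n\to\mathbb{R}^n$ is measurable, and $\xi:\Omega\to\Xi$ is a random variable on a probability space $(\Omega,\mathcal{F},\mathbb{P})$. Put $H(x):=\mathbb{E}[T(\xi,x)]$. ${\rm SVI}(X,H)$ is the problem of finding $x^*\in X$ with $\langle H(x^* ),x-x^*\rangle\ge 0$ for all $x\in X$; its solution set is ${\rm SOL}(X,H)$, assumed nonempty. $P_X$ is the Euclidean projection onto $X$, $\|\cdot\|$ is the Euclidean norm, and $r_t(x):=\|P_X(x-tH(x))-x\|$ for $t>0$. $\lceil a\rceil$ is the smallest integer not smaller than $a$. $\mathcal{N}$ is a positive integer. The notation $b_k=\mathcal{O}(d_k)$ means $|b_k|\le c|d_k|$ for a constant $c>0$; in the two asymptotic bounds of the claim the tolerance $\varsigma$ is the asymptotic parameter ($\varsigma\to0$) and the hidden constants do not depend on $\varsigma$. Assumption 1. $H$ is pseudomonotone on $X$: for all $x,y\in X$, $\langle H(x),y-x\rangle\ge 0$ implies $\langle H(y),y-x\rangle\ge 0$. Assumption 2. (i) There is a measurable $L:\Xi\to\mathbb{R}$ with $L(\xi)\ge 1$ with probability $1$, with $\|T(\xi,x)-T(\xi,y)\|\le L(\xi)\|x-y\|$ for any $x,y\in\mathbb{R}^n$, and with $\mathbb{E}[L(\xi)^{2p}]<\infty$ for $p\ge 2$ (every $p\ge2$). (ii) There exist $\check{x}\in\mathbb{R}^n$ and a number $\bar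 q\ge 2$ such that $\mathbb{E}[\|T(\xi,\check{x})\|^{2\bar q}]<\infty$. Assumption 3. In the algorithm below, $\{\xi^k_j\}_{j=1}^{S_k}$ and $\{\eta^k_j\}_{j=1}^{S_k}$ are two mutually independent sets of i.i.d. samples drawn from $\xi$, and $\sum_{k=0}^\infty \frac{1}{\sqrt{S_k}}<\infty$. Samples of iteration $k$ are also independent of those of earlier iterations: writing $\xi^k=\{\xi^k_j\}_{j=1}^{S_k}$, $\eta^k=\{\eta^k_j\}_{j=1}^{S_k}$, $\mathcal{F}_k=\sigma(x_0,\xi^0,\dots,\xi^{k-1},\eta^0,\dots,\eta^{k-1})$ and $\hat{\mathcal{F}}_k=\sigma(x_0,\xi^0,\dots,\xi^{k},\eta^0,\dots,\eta^{k-1})$, $\xi^k$ is independent of $\mathcal{F}_k$ and $\eta^k$ is independent of $\hat{\mathcal{F}}_k$. Anderson(1)-SEG algorithm. Initialization: choose $x_0\in X$, $\nu\ge 0$, $\gamma\in(0,1]$, $\rho\in(0,1)$, $\mu\in(0,\frac{\sqrt3}{3})$, $\tau>\frac12$, $\theta_0=1$, a sequence of positive integers $\{S_k\}$ (sample rate), and a (sufficiently large) $M>0$. Write $H_{\xi^k}(x)=\frac1{S_k}\sum_{j=1}^{S_k}T(\xi^k_j,x)$ and $H_{\eta^k}(x)=\frac1{S_k}\sum_{j=1}^{S_k}T(\eta^k_j,x)$. For $k=0,1,2,\dots$: Step 1: generate samples $\{\xi^k_j\}_{j=1}^{S_k}$, $\{\eta^k_j\}_{j=1}^{S_k}$ of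 $\xi$. Let $t_k=\gamma$ and compute $F_{\gamma,\xi^k}=P_X(x_k-\gamma H_{\xi^k}(x_k))-x_k$. If $F_{\gamma,\xi^k}=\mathbf 0$, set $x_{k+1}=x_k$, $\theta_{k+1}=\theta_k$ (and pass to the next $k$; here $m_k=0$). Otherwise go to Step 2. Step 2 (line search): compute $y_{k+0.5}=P_X(x_k-t_kH_{\xi^k}(x_k))$. If $t_k\|H_{\xi^k}(x_k)-H_{\xi^k}(y_{k+0.5})\|\le\mu\|x_k-y_{k+0.5}\|$, go to Step 3. Otherwise set $t_k=\rho t_k$ and repeat Step 2. (Below and in the claim, $t_k$ is the final accepted value, $t_k=\gamma\rho^{m_k}$.) Step 3: compute $F_{t_k,\xi^k}=y_{k+0.5}-x_k$, $y_{k+1}=P_X(x_k-t_kH_{\eta^k}(y_{k+0.5}))$ and $\tilde F_{t_k,\eta^k}=y_{k+1}-x_k$. If $\|\tilde F_{t_k,\eta^k}\|<\min\{\|F_{t_k,\xi^k}\|,\nu\theta_k^{-\tau}\}$, set $\alpha_k=\frac{\langle\tilde F_{t_k,\eta^k},\tilde F_{t_k,\eta^k}-F_{t_k,\xi^k}\rangle}{\|\tilde F_{t_k,\eta^k}-F_{t_k,\xi^k}\|^2}$. Otherwise set $\alpha_k=M+1$. Step 4: if $|\alpha_k|\le M$, set $x_{k+1}=\alpha_kx_k+(1-\alpha_k)y_{k+1}$ and $\theta_{k+1}=\theta_k+1$. Otherwise set $x_{k+1}=y_{k+1}$ and $\theta_{k+1}=\theta_k$.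
   Formalization: The maximum of logarithms is replaced by its maximum with an arbitrary fixed l0>0 (the hidden constant may depend on l0), since it can vanish, e.g. X={0}, T=0, L=1, γ≤ρμ, making the stated oracle bound 0 while S_0>0. *)

(* Defs.v *)
From HB Require Import structures.
From mathcomp Require Import all_boot all_order all_algebra.
From mathcomp Require Import all_classical all_reals all_analysis.

Set Implicit Arguments.
Unset Strict Implicit.
Unset Printing Implicit Defensive.

Import Order.TTheory GRing.Theory Num.Theory.
Import numFieldNormedType.Exports.

Local Open Scope classical_set_scope.
Local Open Scope ring_scope.

Section Euclidean.
Context {R : realType} {n : nat}.
Implicit Types (x y z : 'rV[R]_n) (X : set 'rV[R]_n) (H : 'rV[R]_n -> 'rV[R]_n).

Definition dotv x y : R := \sum_(i < n) x 0 i * y 0 i.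

(* The library norm on 'rV[R]_n is the sup norm, hence this one. *)
Definition enorm x : R := Num.sqrt (dotv x x).

(* A nearest point of X; it exists and is unique for X nonempty, closed and
   convex. *)
Definition proj X z : 'rV[R]_n :=
  xget 0 [set p | X p /\ forall q, X q -> enorm (z - p) <= enorm (z - q)].

Definition SOL X H : set 'rV[R]_n :=
  [set x | X x /\ forall y, X y -> 0 <= dotv (H x) (y - x)].

Definition pseudomonotone X H : Prop :=
  forall x y, X x -> X y -> 0 <= dotv (H x) (y - x) -> 0 <= dotv (H y) (y - x).

Definition residual X H (t : R) x : R := enorm (proj X (x - t *: H x) - x).

End Euclidean.

(* 'rV[R]_n carries no measurable structure in the library. *)
Definition borel_rV (R : realType) (n : nat) :=
  g_sigma_algebraType (@open 'rV[R]_n).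

Definition log_base {R : realType} (a x : R) : R := ln x / ln a.

(* Samples are drawn in batches, the k-th one of size S k. *)
Definition sample_array (S : nat -> nat) (A : Type) := forall k, 'I_(S k) -> A.

Section Sampling.
Local Open Scope ereal_scope.
Context {d d' : measure_display} {R : realType}.
Context {Omega : measurableType d} {Xi : measurableType d'}.
Variable P : probability Omega R.

Definition independent_systems (F G : set_system Omega) : Prop :=
  forall A B, F A -> G B -> P (A `&` B) = P A * P B.

(* The product rule over the full index set suffices: taking some B j to be
   setT yields it for every subfamily. *)
Definition iid_as (xi : {mfun Omega >-> Xi}) (N : nat)
    (Y : 'I_N -> {mfun Omega >-> Xi}) : Prop :=
  (forall j B, measurable B -> distribution P (Y j) B = distribution P xi B) /\
  (forall B : 'I_N -> set Xi, (forall j, measurable (B j)) ->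
     P (\bigcap_(j in [set: 'I_N]) (Y j @^-1` B j)) =
     \prod_(j < N) P (Y j @^-1` B j)).

Definition batch_events (N : nat) (Y : 'I_N -> {mfun Omega >-> Xi}) :
    set_system Omega :=
  \bigcup_(j in [set: 'I_N]) g_sigma_algebra_preimage (Y j).

Definition batch_sigma (N : nat) (Y : 'I_N -> {mfun Omega >-> Xi}) :
    set_system Omega :=
  <<s batch_events Y >>.

(* sigma(xs^0, ..., xs^(p-1), es^0, ..., es^(q-1)); a deterministic starting
   point would not enlarge it. *)
Definition history (S : nat -> nat)
    (xs es : sample_array S {mfun Omega >-> Xi}) (p q : nat) :
    set_system Omega :=
  <<s \bigcup_(k in `I_p) batch_events (xs k) `|`
      \bigcup_(k in `I_q) batch_events (es k) >>.

Definition sampling_scheme (xi : {mfun Omega >-> Xi}) (S : nat -> nat)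
    (xs es : sample_array S {mfun Omega >-> Xi}) : Prop :=
  forall k,
    [/\ iid_as xi (xs k), iid_as xi (es k),
        independent_systems (batch_sigma (xs k)) (batch_sigma (es k)),
        independent_systems (batch_sigma (xs k)) (history xs es k k) &
        independent_systems (batch_sigma (es k)) (history xs es k.+1 k)].

End Sampling.

(* Index of the first success of p, and 0 if there is none. *)
Definition first_index (p : pred nat) : nat :=
  if pselect (exists m, p m) is left ex_p then ex_minn ex_p else 0%N.

Record aseg_params (R : realType) := AsegParams {
  as_nu : R; as_gamma : R; as_rho : R; as_mu : R; as_tau : R; as_M : R }.

Section AndersonSEG.
Context {R : realType} {n : nat} {Xi : Type}.
Variables (X : set 'rV[R]_n) (T : Xi -> 'rV[R]_n -> 'rV[R]_n).
Variable par : aseg_params R.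

Local Notation nu := (as_nu par).
Local Notation gamma := (as_gamma par).
Local Notation rho := (as_rho par).
Local Notation mu := (as_mu par).
Local Notation tau := (as_tau par).
Local Notation M := (as_M par).

(* In the definitions of this block, Gxi and Geta are the averaged operators
   H_{xi^k} and H_{eta^k}, and x is the current iterate. *)

Definition aseg_half (Gxi : 'rV[R]_n -> 'rV[R]_n) (x : 'rV[R]_n) (t : R) :
    'rV[R]_n :=
  proj X (x - t *: Gxi x).

Definition aseg_accept (Gxi : 'rV[R]_n -> 'rV[R]_n) (x : 'rV[R]_n) : pred nat :=
  fun m =>
    let t := gamma * rho ^+ m in
    let yh := aseg_half Gxi x t in
    t * enorm (Gxi x - Gxi yh) <= mu * enorm (x - yh).

(* The line search is entered only if F_{gamma,xi^k} <> 0; it stops whenever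
   Gxi is Lipschitz, so the default value of first_index plays no role then. *)
Definition aseg_backtracks (Gxi : 'rV[R]_n -> 'rV[R]_n) (x : 'rV[R]_n) : nat :=
  if aseg_half Gxi x gamma - x == 0 then 0%N
  else first_index (aseg_accept Gxi x).

Definition aseg_step (Gxi Geta : 'rV[R]_n -> 'rV[R]_n)
    (s : 'rV[R]_n * nat) : 'rV[R]_n * nat :=
  let: (x, theta) := s in
  if aseg_half Gxi x gamma - x == 0 then (x, theta) else
  let t := gamma * rho ^+ aseg_backtracks Gxi x in
  let yh := aseg_half Gxi x t in
  let F := yh - x in
  let y := proj X (x - t *: Geta yh) in
  let F' := y - x in
  let alpha :=
    if enorm F' < Num.min (enorm F) (nu * theta%:R `^ (- tau))
    then dotv F' (F' - F) / enorm (F' - F) ^+ 2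
    else M + 1 in
  if `|alpha| <= M then (alpha *: x + (1 - alpha) *: y, theta.+1)
  else (y, theta).

Definition sampled_map (N : nat) (Y : 'I_N -> Xi) (x : 'rV[R]_n) : 'rV[R]_n :=
  N%:R^-1 *: \sum_(j < N) T (Y j) x.

Fixpoint aseg_state (S : nat -> nat) (xs es : sample_array S Xi)
    (x0 : 'rV[R]_n) (k : nat) : 'rV[R]_n * nat :=
  if k is k'.+1 then
    aseg_step (sampled_map (xs k')) (sampled_map (es k')) (aseg_state xs es x0 k')
  else (x0, 1%N).

Definition aseg_iterate (S : nat -> nat) (xs es : sample_array S Xi)
    (x0 : 'rV[R]_n) (k : nat) : 'rV[R]_n :=
  (aseg_state xs es x0 k).1.

Definition aseg_calls (S : nat -> nat) (xs es : sample_array S Xi)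
    (x0 : 'rV[R]_n) (k : nat) : nat :=
  aseg_backtracks (sampled_map (xs k)) (aseg_iterate xs es x0 k).

End AndersonSEG.

Definition sample_rate {R : realType} (NN : nat) (lambda b : R) (k : nat) : nat :=
  (NN * `|Num.ceil ((k%:R + lambda) ^+ 2 *
                    ln (k%:R + lambda) `^ (2 + 2 * b))|)%N.

(* Main.v *)
Require Import Defs.
From HB Require Import structures.
From mathcomp Require Import all_boot all_order all_algebra.
From mathcomp Require Import all_classical all_reals all_analysis.
From mathcomp Require Import measurable_realfun.
From mathcomp Require Import ring lra.

(** The algorithm is an extragradient method with two independent batches, and
    the whole statement rests on one fact: the series of the expected squared
    residuals converges ([residual_summable]). If its sum is at most [C], then
    the minimum over [k <= N] is at most [C / (N + 1)], so [N] of order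
    [1 / vs] iterations suffice; and since the line search makes at most
    about [log Lk] calls at iteration [k] ([line_search_log_bound]), the number of
    oracle calls is a sum of the explicit sample sizes ([sum_sample_rate])
    times a maximum of logarithms.

    Let [xsol] be a solution. On a fixed sample path, the usual extragradient
    argument with pseudomonotonicity shows that one step decreases the squared
    distance to [xsol] by a multiple of the squared half step, up to sampling
    errors ([extragradient_noise]). An averaging step gives the old
    iterate a weight between [- M] and [1 / 2] and so keeps half of this
    decrease; its own cost is summable, because the full step is then shorter
    than [nu * theta ^ - tau] with [2 * tau > 1] and the counter [theta] grows
    at each such step. A Lyapunov function
    absorbs this cost ([aseg_step_descent]). The line search keeps the step
    size above a multiple of [1 / Lk], where [Lk] is the batch mean of the
    Lipschitz constants, so the half step controls the residual up to the
    factor [1 / Lk] and one more sampling error ([aseg_step_residual]).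

    Since [eps k = 1 / sqrt (S k)] is summable, every sampling error may be
    estimated in absolute value: it is enough that its expectation is of order
    [eps k * (1 + E |x k - xsol| ^ 2)]. The second batch is independent
    of the half step, so its error is a variance
    ([expectation_sampling_error]). The half step itself depends on the first
    batch, through the direction and through the step size. The direction is
    replaced by its mean with the help of the Lipschitz bound, which leaves a
    product of [Lk] and of the error at [x k], bounded by moments
    ([expectation_weighted_error]). The step size ranges over the powers
    [gamma * rho ^ m], and since the error carries the factor
    [(gamma * rho ^ m) ^ 2] one may sum over all [m]
    ([half_step_error], [expectation_error_half]).

    Finally the random factor [1 / Lk ^ 2] in front of the residual is bounded
    below by an affine function of [Lk] ([inv_sqr_tangent]), and [Lk] is
    independent of [x k]. Taking expectations gives
    [a (k + 1) + c * E (r k ^ 2) <= a k + C * eps k * (1 + a k)] for the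
    expected Lyapunov function [a] ([lyapunov_recursion]), from which the
    summability follows ([summable_perturbation]). *)

Set Implicit Arguments.
Unset Strict Implicit.
Unset Printing Implicit Defensive.

Import Order.TTheory GRing.Theory Num.Theory.
Import numFieldNormedType.Exports.

Local Open Scope classical_set_scope.
Local Open Scope ring_scope.

(* The Euclidean projection, not a coordinate projection of a product. *)
Local Notation proj := Defs.proj.

(** * Euclidean geometry and projections *)

Section EuclideanGeometry.
Context {R : realType} {n : nat}.
Implicit Types (x y z p q : 'rV[R]_n) (a t : R).

Lemma dotvC x y : dotv x y = dotv y x.
Proof. by apply: eq_bigr => i _; rewrite mulrC. Qed.

Lemma dotvDl x y z : dotv (x + y) z = dotv x z + dotv y z.
Proof. by rewrite -big_split; apply: eq_bigr => i _; rewrite mxE mulrDl. Qed.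

Lemma dotvZl a x y : dotv (a *: x) y = a * dotv x y.
Proof. by rewrite mulr_sumr; apply: eq_bigr => i _; rewrite mxE mulrA. Qed.

Lemma dotvNl x y : dotv (- x) y = - dotv x y.
Proof. by rewrite -scaleN1r dotvZl mulN1r. Qed.

Lemma dotvDr x y z : dotv z (x + y) = dotv z x + dotv z y.
Proof. by rewrite dotvC dotvDl !(dotvC z). Qed.

Lemma dotvZr a x y : dotv y (a *: x) = a * dotv y x.
Proof. by rewrite dotvC dotvZl dotvC. Qed.

Lemma dotvNr x y : dotv y (- x) = - dotv y x.
Proof. by rewrite dotvC dotvNl dotvC. Qed.

Definition dotvE := (dotvDl, dotvDr, dotvNl, dotvNr, dotvZl, dotvZr).

Lemma dotvv_ge0 x : 0 <= dotv x x.
Proof. by apply: sumr_ge0 => i _; rewrite -expr2 sqr_ge0. Qed.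

Lemma dotvv_eq0 x : dotv x x = 0 -> x = 0.
Proof.
move=> /eqP; rewrite psumr_eq0; last by move=> i _; rewrite -expr2 sqr_ge0.
move=> /allP x0; apply/rowP => i; rewrite mxE.
by have := x0 i (mem_index_enum i); rewrite mulf_eq0 orbb => /eqP.
Qed.

Lemma enorm_ge0 x : 0 <= enorm x. Proof. exact: sqrtr_ge0. Qed.

Lemma enorm_sqr x : enorm x ^+ 2 = dotv x x.
Proof. exact/sqr_sqrtr/dotvv_ge0. Qed.

Lemma dotv0l y : dotv 0 y = 0.
Proof. by rewrite -(scale0r 0) dotvZl mul0r. Qed.

Lemma enorm0 : enorm (0 : 'rV[R]_n) = 0.
Proof. by rewrite /enorm dotv0l sqrtr0. Qed.

Lemma enorm_eq0 x : enorm x = 0 -> x = 0.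
Proof. by move=> x0; apply: dotvv_eq0; rewrite -enorm_sqr x0 expr0n. Qed.

Lemma enormN x : enorm (- x) = enorm x.
Proof. by rewrite /enorm dotvNl dotvNr opprK. Qed.

Lemma enormB x y : enorm (x - y) = enorm (y - x).
Proof. by rewrite -enormN opprB. Qed.

Lemma enormZ a x : enorm (a *: x) = `|a| * enorm x.
Proof.
by rewrite /enorm dotvZl dotvZr mulrA -expr2 sqrtrM ?sqr_ge0// sqrtr_sqr.
Qed.

Lemma ler_dotv x y : dotv x y <= enorm x * enorm y.
Proof.
have [yy0|yyN0] := eqVneq (dotv y y) 0.
  by rewrite (dotvv_eq0 yy0) dotvC dotv0l enorm0 mulr0.
have yy_gt0 : 0 < dotv y y by rewrite lt_neqAle eq_sym yyN0 dotvv_ge0.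
have := dotvv_ge0 (dotv y y *: x - dotv x y *: y).
rewrite !dotvE (dotvC y x) => h.
have {}h : 0 <= dotv y y * (dotv x x * dotv y y - dotv x y ^+ 2) by lra.
rewrite pmulr_rge0// subr_ge0 in h.
rewrite /enorm -sqrtrM ?dotvv_ge0// (le_trans (ler_norm _))//.
by rewrite -sqrtr_sqr ler_wsqrtr.
Qed.

Lemma ler_enormD x y : enorm (x + y) <= enorm x + enorm y.
Proof.
rewrite -(@ler_pXn2r _ 2)// ?nnegrE ?addr_ge0 ?enorm_ge0//.
rewrite sqrrD !enorm_sqr !dotvE (dotvC y x).
have := ler_dotv x y; lra.
Qed.

Lemma ler_enormB x y : enorm (x - y) <= enorm x + enorm y.
Proof. by rewrite -(enormN y) ler_enormD. Qed.

Lemma ler_enorm_dist y x z : enorm (x - z) <= enorm (x - y) + enorm (y - z).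
Proof. by have := ler_enormD (x - y) (y - z); rewrite addrA subrK. Qed.

Lemma ler_coord_enorm x (i : 'I_n) : `|x 0 i| <= enorm x.
Proof.
rewrite -sqrtr_sqr ler_wsqrtr// /dotv (bigD1 i)//= expr2 lerDl.
by apply: sumr_ge0 => j _; rewrite -expr2 sqr_ge0.
Qed.

Lemma ler_enorm_sum x : enorm x <= \sum_(i < n) `|x 0 i|.
Proof.
rewrite -(@ler_pXn2r _ 2)// ?nnegrE ?enorm_ge0 ?sumr_ge0//.
rewrite enorm_sqr expr2 /dotv mulr_suml; apply: ler_sum => i _.
rewrite (le_trans (ler_norm _))// normrM ler_wpM2l//.
by rewrite (bigD1 i)//= lerDl sumr_ge0.
Qed.

Lemma ler_norm_enorm x : `|x| <= enorm x.
Proof.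
rewrite [leLHS]/Num.norm /= mx_normrE; apply/bigmax_leP; split=> [|[i j] _] /=.
  exact: enorm_ge0.
by rewrite ord1 ler_coord_enorm.
Qed.

Lemma continuous_coord (i : 'I_n) : continuous (fun x : 'rV[R]_n => x 0 i).
Proof. exact: coord_continuous. Qed.

Lemma continuous_enorm : continuous (enorm : 'rV[R]_n -> R).
Proof.
move=> x; apply: continuous_comp; last exact: sqrt_continuous.
rewrite /continuous_at /dotv.
have := @cvg_big R _ +%R 0 xpredT (@add_continuous R) _ (nbhs x)
  (index_enum 'I_n) (fun i (y : 'rV[R]_n) => y 0 i * y 0 i) _ (nbhs_filter x).
apply=> i _.
by apply: cvgM; exact: coord_continuous.
Qed.

Lemma continuous_enorm_sub x : continuous (fun y : 'rV[R]_n => enorm (x - y)).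
Proof.
move=> y; apply: (@continuous_comp _ _ _ (fun y => x - y) enorm).
  apply: continuousB; [exact: cst_continuous|by move=> ?].
exact: continuous_enorm.
Qed.

Lemma lipschitz_continuous (f : 'rV[R]_n -> 'rV[R]_n) (K : R) : 0 <= K ->
  (forall x y, enorm (f x - f y) <= K * enorm (x - y)) -> continuous f.
Proof.
move=> K0 f_lip x.
apply/(@cvgrPdist_lt _ _ _ (nbhs x) (nbhs_filter x)) => e e0.
have := @continuous_enorm_sub x x.
rewrite /continuous_at subrr enorm0.
move=> /(@cvgrPdist_lt _ _ _ (nbhs x) (nbhs_filter x)).
move=> /(_ (e / (K + 1)) (divr_gt0 e0 (ltr_wpDl K0 ltr01))).
apply: (@filterS _ (nbhs x) (nbhs_filter x)) => y.
rewrite sub0r normrN ger0_norm ?enorm_ge0// => xy.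
apply: (le_lt_trans (ler_norm_enorm _)); apply: (le_lt_trans (f_lip _ _)).
have [-> |K_neq0] := eqVneq K 0; first by rewrite mul0r.
have K_gt0 : 0 < K by rewrite lt_neqAle eq_sym K_neq0.
apply: (@lt_le_trans _ _ (K * (e / (K + 1)))); first by rewrite ltr_pM2l.
by rewrite mulrA ler_pdivrMr ?ltr_wpDl//; nra.
Qed.

End EuclideanGeometry.

Section Projection.
Context {R : realType} {n : nat} (X : set 'rV[R]_n).
Hypotheses (X_closed : closed X) (X_convex : convex_set X) (X_ne : X !=set0).
Implicit Types x y z p q : 'rV[R]_n.

Lemma proj_nearest z :
  X (proj X z) /\ forall q, X q -> enorm (z - proj X z) <= enorm (z - q).
Proof.
suff [p hp] : exists p, X p /\ forall q, X q -> enorm (z - p) <= enorm (z - q).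
  by have := @xgetI _ 0 [set p | X p /\ forall q, X q -> enorm (z - p) <= enorm (z - q)]
    p hp.
have [q0 Xq0] := X_ne.
have cont_dist := @continuous_enorm_sub R n z.
pose K := X `&` (fun p => enorm (z - p)) @^-1` [set r | r <= enorm (z - q0)].
have K_closed : closed K.
  apply: closedI => //; apply: preimage_closed; first by move=> p _.
  exact: closed_le.
have K_bounded : bounded_set K.
  exists (enorm z + enorm (z - q0)); split; first exact: num_real.
  move=> M ltM p [_ /= zp]; apply: (le_trans (ler_norm_enorm _)).
  apply: (le_trans _ (ltW ltM)).
  have -> : p = z - (z - p) by rewrite opprB addrC subrK.
  by rewrite (le_trans (ler_enormB _ _))// lerD2l.
have K_ne : K !=set0 by exists q0; split => //=.
have [p pK p_min] := EVT_min_rV K_ne (bounded_closed_compact K_bounded K_closed)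
  (continuous_subspaceT cont_dist).
rewrite inE in pK; have [Xp /= zp] := pK.
exists p; split => // q Xq.
have [le_q|/ltW lt_q] := leP (enorm (z - q)) (enorm (z - q0)).
  by apply: p_min; rewrite inE.
exact: le_trans zp lt_q.
Qed.

Lemma proj_in z : X (proj X z). Proof. by have [] := proj_nearest z. Qed.

Lemma convex_segment p q (s : R) : X p -> X q -> 0 <= s <= 1 ->
  X (s *: q + (1 - s) *: p).
Proof.
move=> Xp Xq /andP[s0 s1].
have := X_convex (x := q) (y := p) (Itv01 s0 s1) (mem_set Xq) (mem_set Xp).
by rewrite inE.
Qed.

(** The first-order condition for the minimization that defines [proj]: along
    the segment from the projection towards [q] the squared distance to [z]
    cannot start by decreasing. *)
Lemma proj_variational z q : X q -> dotv (z - proj X z) (q - proj X z) <= 0.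
Proof.
move=> Xq; have [Xp p_min] := proj_nearest z.
set p := proj X z in Xp p_min *; set a := dotv _ _; set c := dotv (q - p) (q - p).
have c0 : 0 <= c by exact: dotvv_ge0.
have quad s : 0 <= s <= 1 -> 0 <= - (2 * s * a) + s ^+ 2 * c.
  move=> s01; have := p_min _ (convex_segment Xp Xq s01).
  rewrite -(@ler_pXn2r _ 2)// ?nnegrE ?enorm_ge0// !enorm_sqr -subr_ge0.
  have -> : z - (s *: q + (1 - s) *: p) = (z - p) - s *: (q - p).
    by rewrite scalerBr scalerBl scale1r; apply/rowP => i; rewrite !mxE; ring.
  rewrite /a /c; move: (z - p) (q - p) => u v.
  by rewrite !dotvE (dotvC v u); lra.
rewrite leNgt; apply/negP => a0.
have ac0 : 0 < a + c by rewrite ltr_pwDl.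
have s01 : 0 <= a / (a + c) <= 1.
  by rewrite (divr_ge0 (ltW a0) (ltW ac0)) ler_pdivrMr// mul1r lerDl.
have := quad _ s01.
have -> : - (2 * (a / (a + c)) * a) + (a / (a + c)) ^+ 2 * c =
          (a / (a + c)) ^+ 2 * (- (2 * (a + c)) + c) by field; rewrite gt_eqF.
rewrite pmulr_rge0; first by lra.
by rewrite exprn_gt0// divr_gt0.
Qed.

Lemma proj_id z : X z -> proj X z = z.
Proof.
move=> Xz; have := (proj_nearest z).2 _ Xz.
rewrite subrr enorm0 => h; apply/eqP; rewrite eq_sym -subr_eq0; apply/eqP.
by apply: enorm_eq0; apply/eqP; rewrite eq_le h enorm_ge0.
Qed.

Lemma proj_nonexpansive y z : enorm (proj X y - proj X z) <= enorm (y - z).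
Proof.
have := proj_variational y (proj_in z); have := proj_variational z (proj_in y).
move: (proj X y) (proj X z) => p q h1 h2.
have h : enorm (p - q) ^+ 2 <= dotv (y - z) (p - q).
  rewrite enorm_sqr; move: h1 h2.
  by rewrite !dotvE (dotvC q p); lra.
have := le_trans h (ler_dotv _ _); rewrite expr2.
have [->|pq0] := eqVneq (enorm (p - q)) 0; first by rewrite enorm_ge0.
by rewrite ler_pM2r// lt_neqAle eq_sym pq0 enorm_ge0.
Qed.

Lemma continuous_proj : continuous (proj X).
Proof.
by apply: (lipschitz_continuous (K := 1)) => // y z; rewrite mul1r proj_nonexpansive.
Qed.

(** The variational inequalities of the two projections, tested against each
    other and added with the weights [t] and [s], give a quadratic inequality
    between the lengths of the two steps. *)
Lemma proj_step_homogeneous x g (t s : R) : 0 < t -> t <= s ->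
  t * enorm (proj X (x - s *: g) - x) <= s * enorm (proj X (x - t *: g) - x).
Proof.
move=> t0 ts.
have := proj_variational (x - t *: g) (proj_in (x - s *: g)).
have := proj_variational (x - s *: g) (proj_in (x - t *: g)).
move: (proj X (x - s *: g)) (proj X (x - t *: g)) => p q.
have -> : x - s *: g - p = - (p - x) - s *: g by apply/rowP => i; rewrite !mxE; ring.
have -> : x - t *: g - q = - (q - x) - t *: g by apply/rowP => i; rewrite !mxE; ring.
have -> : p - q = (p - x) - (q - x) by rewrite opprB addrA subrK.
have -> : q - p = (q - x) - (p - x) by rewrite opprB addrA subrK.
move: (p - x) (q - x) => u v.
have s0 : 0 < s by exact: lt_le_trans ts.
move=> /(ler_wpM2l (ltW t0)) h1 /(ler_wpM2l (ltW s0)) h2.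
have h : t * enorm u ^+ 2 + s * enorm v ^+ 2 <= (s + t) * (enorm u * enorm v).
  have := ler_wpM2l (addr_ge0 (ltW s0) (ltW t0)) (ler_dotv u v).
  by move: h1 h2; rewrite !enorm_sqr !dotvE (dotvC v u); lra.
have := enorm_ge0 u; have := enorm_ge0 v.
move: (enorm u) (enorm v) h => a b h b0 a0.
have {}h : (t * a - s * b) * (a - b) <= 0 by lra.
rewrite leNgt; apply/negP => lt_st.
have tb_sb : t * b <= s * b by rewrite ler_wpM2r.
have ab : b < a by rewrite -(ltr_pM2l t0) (le_lt_trans tb_sb).
have : 0 < (t * a - s * b) * (a - b) by rewrite mulr_gt0 ?subr_gt0.
by rewrite ltNge h.
Qed.

End Projection.
(** * One step of the algorithm on a fixed sample path *)

Section ExtragradientStep.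
Context {R : realType} {n : nat} (X : set 'rV[R]_n).
Hypotheses (X_closed : closed X) (X_convex : convex_set X) (X_ne : X !=set0).
Implicit Types x y z : 'rV[R]_n.

(** The two projections are tested against [xs] and against each other; the
    cross term is absorbed by the inequality
    [2 * t * <gx - gz, y - z> <= t ^ 2 * |gx - gz| ^ 2 + |y - z| ^ 2]. *)
Lemma extragradient_descent x xs gx gz (t : R) z y : X xs ->
  z = proj X (x - t *: gx) -> y = proj X (x - t *: gz) ->
  enorm (y - xs) ^+ 2 <= enorm (x - xs) ^+ 2 - enorm (x - z) ^+ 2
    + t ^+ 2 * enorm (gx - gz) ^+ 2 - 2 * t * dotv gz (z - xs).
Proof.
move=> Xxs zE yE.
have Xy : X y by rewrite yE; exact: proj_in.
have := proj_variational X_closed X_convex X_ne (x - t *: gz) Xxs.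
have := proj_variational X_closed X_convex X_ne (x - t *: gx) Xy.
rewrite -zE -yE {Xy zE yE}.
have -> : y - z = (y - xs) - (z - xs) by rewrite opprB addrA subrK.
have -> : x - t *: gx - z = (x - xs) - t *: gx - (z - xs).
  by apply/rowP => i; rewrite !mxE; ring.
have -> : x - t *: gz - y = (x - xs) - t *: gz - (y - xs).
  by apply/rowP => i; rewrite !mxE; ring.
have -> : x - z = (x - xs) - (z - xs) by rewrite opprB addrA subrK.
rewrite -(opprB y xs).
move: (x - xs) (y - xs) (z - xs) => u v w.
have := dotvv_ge0 (t *: (gx - gz) - (v - w)).
rewrite !enorm_sqr !dotvE ?(dotvC v u) ?(dotvC w u) ?(dotvC w v) ?(dotvC gz gx).
by rewrite ?(dotvC v gx) ?(dotvC v gz) ?(dotvC w gx) ?(dotvC w gz); lra.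
Qed.

Lemma enorm_sqrD3 x y z :
  enorm (x + y + z) ^+ 2 <= 3 * enorm x ^+ 2 + 3 * enorm y ^+ 2 + 3 * enorm z ^+ 2.
Proof.
have := dotvv_ge0 (x - y); have := dotvv_ge0 (y - z); have := dotvv_ge0 (x - z).
rewrite !enorm_sqr !dotvE ?(dotvC y x) ?(dotvC z x) ?(dotvC z y); lra.
Qed.

(** The threshold [mu ^ 2 < 1 / 3] comes from splitting the difference of the
    two sampled operators into the line-search term and two sampling errors. *)
Lemma extragradient_noise x xs gx gz hz g (t mu : R) z y : X xs ->
  z = proj X (x - t *: gx) -> y = proj X (x - t *: g) ->
  0 <= t -> t * enorm (gx - gz) <= mu * enorm (x - z) ->
  0 <= dotv hz (z - xs) ->
  enorm (y - xs) ^+ 2 <= enorm (x - xs) ^+ 2 - (1 - 3 * mu ^+ 2) * enorm (x - z) ^+ 2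
    + (3 * (t * enorm (gz - hz)) ^+ 2 + 3 * (t * enorm (g - hz)) ^+ 2
       + 2 * t * enorm (g - hz) * enorm (z - xs)).
Proof.
move=> Xxs zE yE t0 search mono.
apply: (le_trans (extragradient_descent Xxs zE yE)); clear zE yE.
have split3 : enorm (gx - g) ^+ 2 <= 3 * enorm (gx - gz) ^+ 2 +
    3 * enorm (gz - hz) ^+ 2 + 3 * enorm (g - hz) ^+ 2.
  rewrite (enormB g hz); have -> : gx - g = (gx - gz) + (gz - hz) + (hz - g).
    by rewrite !addrA !subrK.
  exact: enorm_sqrD3.
have {}split3 := ler_wpM2l (sqr_ge0 t) split3.
have {}search : (t * enorm (gx - gz)) ^+ 2 <= (mu * enorm (x - z)) ^+ 2.
  have lhs0 : 0 <= t * enorm (gx - gz) by rewrite mulr_ge0// enorm_ge0.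
  by rewrite ler_pXn2r// nnegrE// (le_trans lhs0).
have inner : - dotv g (z - xs) <= enorm (g - hz) * enorm (z - xs).
  apply: (@le_trans _ _ (dotv (- (g - hz)) (z - xs))).
    by rewrite dotvNl dotvDl dotvNl; lra.
  by rewrite (le_trans (ler_dotv _ _))// enormN.
have {}inner := ler_wpM2l t0 inner.
move: split3 search inner; rewrite !exprMn; lra.
Qed.

(** When the second correction is shorter than the first, the minimizer of
    [|a F + (1 - a) F'|] puts less than half of its weight on [F], so that an
    averaging step keeps more than half of the extragradient descent. *)
Lemma anderson_weight_lt (F F' : 'rV[R]_n) : enorm F' < enorm F ->
  dotv F' (F' - F) / enorm (F' - F) ^+ 2 < 2^-1.
Proof.
move=> lt_FF.
have lt2 : enorm F' ^+ 2 < enorm F ^+ 2.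
  by rewrite ltr_pXn2r// nnegrE enorm_ge0.
have pos : 0 < enorm (F' - F) ^+ 2.
  rewrite lt_neqAle sqr_ge0 andbT eq_sym sqrf_eq0; apply/negP => /eqP/enorm_eq0/eqP.
  by rewrite subr_eq0 => /eqP FF; move: lt_FF; rewrite FF ltxx.
rewrite ltr_pdivrMr//; move: lt2; rewrite !enorm_sqr !dotvE ?(dotvC F F').
lra.
Qed.

(** The squared distance of an affine combination splits exactly; for a negative
    weight [a] the last term has the wrong sign and is charged to the short
    step [y - x]. *)
Lemma averaging_step x y xs (a M kF W : R) :
  `|a| <= M -> a <= 2^-1 -> 0 <= kF -> 0 <= W ->
  enorm (y - xs) ^+ 2 <= enorm (x - xs) ^+ 2 - kF + W ->
  enorm (a *: x + (1 - a) *: y - xs) ^+ 2 <= enorm (x - xs) ^+ 2 - kF / 2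
    + (1 + M) * W + M * (1 + M) * enorm (y - x) ^+ 2.
Proof.
move=> aM a_half kF0 W0 hy.
have [a_geN a_le] : - M <= a /\ a <= M by move: aM; rewrite ler_norml => /andP.
have -> : a *: x + (1 - a) *: y - xs = a *: (x - xs) + (1 - a) *: (y - xs).
  by apply/rowP => i; rewrite !mxE; ring.
have -> : y - x = (y - xs) - (x - xs) by rewrite opprB addrA subrK.
have a1 : 0 <= 1 - a by lra.
have M0 : 0 <= M by exact: le_trans aM.
have hM : - (a * (1 - a)) <= M * (1 + M) by nra.
have := ler_wpM2l a1 hy; have := ler_wpM2r (dotvv_ge0 (y - xs - (x - xs))) hM.
have kF_half : kF / 2 <= (1 - a) * kF by rewrite mulrC ler_wpM2r//; lra.
have W_le : (1 - a) * W <= (1 + M) * W by rewrite ler_wpM2r//; lra.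
move: kF_half W_le; rewrite !enorm_sqr !dotvE; move: (y - xs) (x - xs) => v u.
by rewrite ?(dotvC v u); lra.
Qed.

End ExtragradientStep.

Lemma first_indexP (p : pred nat) : (exists m, p m) ->
  p (first_index p) /\ forall j, (j < first_index p)%N -> ~~ p j.
Proof.
move=> ex; rewrite /first_index; case: pselect => // ex_p.
case: ex_minnP => m pm min; split => // j jm; apply/negP => /min.
by rewrite leqNgt jm.
Qed.

Section LineSearch.
Context {R : realType} {n : nat} (X : set 'rV[R]_n) (par : aseg_params R).
Hypotheses (X_closed : closed X) (X_convex : convex_set X) (X_ne : X !=set0).
Local Notation gamma := (as_gamma par).
Local Notation rho := (as_rho par).
Local Notation mu := (as_mu par).
Hypotheses (gamma_range : 0 < gamma <= 1) (rho_range : 0 < rho < 1) (mu_gt0 : 0 < mu).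
Variables (G : 'rV[R]_n -> 'rV[R]_n) (Lk : R).
Hypotheses (Lk_ge1 : 1 <= Lk)
  (G_lip : forall u v, enorm (G u - G v) <= Lk * enorm (u - v)).
Variable x : 'rV[R]_n.

Let m := aseg_backtracks X par G x.
Let t := gamma * rho ^+ m.

Let gamma_gt0 : 0 < gamma. Proof. by case/andP: gamma_range. Qed.
Let rho_gt0 : 0 < rho. Proof. by case/andP: rho_range. Qed.

Lemma line_search_gt0 (k : nat) : 0 < gamma * rho ^+ k.
Proof. by rewrite mulr_gt0// exprn_gt0. Qed.

Lemma line_search_le1 (k : nat) : gamma * rho ^+ k <= 1.
Proof.
have /andP[_ g1] := gamma_range; have /andP[_ /ltW r1] := rho_range.
by rewrite mulr_ile1//; [exact: ltW|rewrite exprn_ge0// ltW|rewrite exprn_ile1// ltW].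
Qed.

Lemma line_search_le_gamma (k : nat) : gamma * rho ^+ k <= gamma.
Proof.
have /andP[_ /ltW r1] := rho_range.
by rewrite ler_piMr//; [exact: ltW|rewrite exprn_ile1// ltW].
Qed.

Lemma line_search_stops : exists k, aseg_accept X par G x k.
Proof.
have /andP[_ rho1] := rho_range.
have Lk_gt0 : 0 < Lk by exact: lt_le_trans Lk_ge1.
have /cvgrPdist_lt/(_ (mu / (gamma * Lk))) : rho ^+ k @[k --> \oo] --> (0 : R).
  by apply: cvg_expr; rewrite ger0_norm// ltW.
move=> /(_ (divr_gt0 mu_gt0 (mulr_gt0 gamma_gt0 Lk_gt0)))[k _ /(_ k (leqnn k))].
rewrite sub0r normrN ger0_norm ?exprn_ge0// ?ltW// ltr_pdivlMr ?mulr_gt0// => hk.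
exists k; rewrite /aseg_accept; set z := aseg_half _ _ _ _.
apply: (@le_trans _ _ (gamma * rho ^+ k * (Lk * enorm (x - z)))).
  by rewrite ler_wpM2l// ltW// line_search_gt0.
rewrite mulrA ler_wpM2r ?enorm_ge0//; apply: ltW; move: hk.
by congr (_ < _); ring.
Qed.

Lemma line_search_accepts : aseg_half X G x gamma != x -> aseg_accept X par G x m.
Proof.
move=> hx; rewrite /m /aseg_backtracks subr_eq0 (negbTE hx).
by have [] := first_indexP line_search_stops.
Qed.

(** A rejected trial step is longer than [mu / Lk], hence the accepted one is
    longer than [rho * mu / Lk]. *)
Lemma line_search_lower : Num.min (rho * mu) gamma / Lk <= t.
Proof.
have Lk_gt0 : 0 < Lk by exact: lt_le_trans Lk_ge1.
rewrite ler_pdivrMr//.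
have m0_case : m = 0%N -> Num.min (rho * mu) gamma <= t * Lk.
  move=> m0; rewrite ge_min; apply/orP; right.
  by rewrite /t m0 expr0 mulr1 ler_peMr// ltW.
move: m0_case; rewrite /t /m /aseg_backtracks; case: ifPn => [_|_]; first exact.
have [_ ] := first_indexP line_search_stops.
case: (first_index _) => [_ //|k /(_ k (ltnSn k)) + _]; first exact.
rewrite /aseg_accept -ltNge; set z := aseg_half _ _ _ _ => rej.
rewrite ge_min; apply/orP; left.
have {}rej : mu * enorm (x - z) < gamma * rho ^+ k * Lk * enorm (x - z).
  apply: (lt_le_trans rej); rewrite -(mulrA _ Lk) ler_wpM2l//.
  exact/ltW/line_search_gt0.
have xz : 0 < enorm (x - z).
  rewrite lt_neqAle enorm_ge0 andbT; apply/negP => /eqP xz.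
  by move: rej; rewrite -xz !mulr0 ltxx.
rewrite ltr_pM2r// in rej.
rewrite exprS (_ : _ * Lk = rho * (gamma * rho ^+ k * Lk)); last by ring.
by rewrite ler_wpM2l// ltW.
Qed.

(** The accepted half step depends on the sample drawn for [G] through its
    length as well. Comparing it with the same step for the mean operator [H]
    leaves, besides the error at [x], the error at a point that depends on the
    sample only through the integer [m]. *)
Lemma half_step_error (H : 'rV[R]_n -> 'rV[R]_n) (l : R) : 0 <= l ->
  (forall u v, enorm (H u - H v) <= l * enorm (u - v)) ->
  forall (k : nat) s z h, s = gamma * rho ^+ k ->
  z = aseg_half X G x s -> h = proj X (x - s *: H x) ->
  s * enorm (G z - H z) <=
    (Lk + l) * enorm (G x - H x) + s * enorm (G h - H h).
Proof.
move=> l0 H_lip k s z h sE zE hE.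
have s0 : 0 <= s by rewrite sE; exact/ltW/line_search_gt0.
have s1 : s <= 1 by rewrite sE; exact: line_search_le1.
have zh : enorm (z - h) <= enorm (G x - H x).
  rewrite zE hE.
  apply: (le_trans (proj_nonexpansive X_closed X_convex X_ne _ _)).
  have -> : x - s *: G x - (x - s *: H x) = - (s *: (G x - H x)).
    by apply/rowP => i; rewrite !mxE; ring.
  by rewrite enormN enormZ ger0_norm// ler_piMl ?enorm_ge0.
have Gz_le : enorm (G z - H z) <= (Lk + l) * enorm (z - h) + enorm (G h - H h).
  apply: (le_trans (ler_enorm_dist (G h) _ _)).
  apply: (le_trans (lerD (G_lip _ _) (ler_enorm_dist (H h) _ _))).
  by have := H_lip h z; rewrite (enormB h z); lra.
have Lkl : 0 <= Lk + l by rewrite addr_ge0// (le_trans _ Lk_ge1).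
have := ler_wpM2l s0 Gz_le; have := ler_wpM2l Lkl zh.
have := mulr_ge0 Lkl (enorm_ge0 (z - h)) => a0 a1 a2.
have := ler_piMl a0 s1; lra.
Qed.

End LineSearch.
(** * Descent of a Lyapunov function along one step *)

Section StepDescent.
Context {R : realType} {n : nat} (X : set 'rV[R]_n) (par : aseg_params R).
Hypotheses (X_closed : closed X) (X_convex : convex_set X).
Local Notation nu := (as_nu par).
Local Notation gamma := (as_gamma par).
Local Notation rho := (as_rho par).
Local Notation mu := (as_mu par).
Local Notation tau := (as_tau par).
Local Notation M := (as_M par).
Hypotheses (nu_ge0 : 0 <= nu) (gamma_range : 0 < gamma <= 1)
  (rho_range : 0 < rho < 1) (mu_range : 0 < mu < Num.sqrt 3 / 3) (M_gt0 : 0 < M).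
Variables (H : 'rV[R]_n -> 'rV[R]_n) (l : R) (xs : 'rV[R]_n).
Hypotheses (l_ge1 : 1 <= l)
  (H_lip : forall u v, enorm (H u - H v) <= l * enorm (u - v))
  (xs_sol : SOL X H xs) (H_pm : pseudomonotone X H).
(** [B th] bounds the sum over [j >= th] of [(j ^ - tau) ^ 2], which pays for
    all the averaging steps still to come. *)
Variable B : nat -> R.
Hypothesis B_step : forall th, (0 < th)%N ->
  B th.+1 + (th%:R `^ (- tau)) ^+ 2 <= B th.

Let X_ne : X !=set0. Proof. by case: xs_sol => Xxs _; exists xs. Qed.
Let Xxs : X xs. Proof. by case: xs_sol. Qed.
Let mu_gt0 : 0 < mu. Proof. by case/andP: mu_range. Qed.
Let gamma_gt0 : 0 < gamma. Proof. by case/andP: gamma_range. Qed.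
Let l_gt0 : 0 < l. Proof. exact: lt_le_trans l_ge1. Qed.

Definition averaging_cost : R := M * (1 + M) * nu ^+ 2.
Definition lyapunov (s : 'rV[R]_n * nat) : R :=
  enorm (s.1 - xs) ^+ 2 + averaging_cost * B s.2.
Definition descent_rate : R :=
  (1 - 3 * mu ^+ 2) / 2 * (Num.min (rho * mu) gamma / gamma) ^+ 2.

Lemma descent_factor_gt0 : 0 < 1 - 3 * mu ^+ 2.
Proof.
have /andP[mu0 mu3] := mu_range.
have : mu ^+ 2 < (Num.sqrt 3 / 3) ^+ 2 by rewrite ltr_pXn2r// nnegrE ltW.
by rewrite exprMn sqr_sqrtr// => h; lra.
Qed.

Lemma min_step_gt0 : 0 < Num.min (rho * mu) gamma.
Proof. by rewrite lt_min gamma_gt0 andbT mulr_gt0//; case/andP: rho_range. Qed.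

Lemma descent_rate_gt0 : 0 < descent_rate.
Proof.
rewrite mulr_gt0 ?divr_gt0 ?descent_factor_gt0// exprn_gt0// divr_gt0//.
exact: min_step_gt0.
Qed.

Section OneStep.
Variables (Gxi Geta : 'rV[R]_n -> 'rV[R]_n) (Lk : R).
Hypotheses (Lk_ge1 : 1 <= Lk)
  (G_lip : forall u v, enorm (Gxi u - Gxi v) <= Lk * enorm (u - v)).
Variables (x : 'rV[R]_n) (th : nat).
Hypothesis th_gt0 : (0 < th)%N.

Variables (t : R) (z : 'rV[R]_n).
Hypotheses (tE : t = gamma * rho ^+ aseg_backtracks X par Gxi x)
  (zE : z = aseg_half X Gxi x t).
Local Notation s' := (aseg_step X par Gxi Geta (x, th)).

Let Lk_gt0 : 0 < Lk. Proof. exact: lt_le_trans Lk_ge1. Qed.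
Let t_gt0 : 0 < t. Proof. by rewrite tE; exact: line_search_gt0. Qed.
Let t_le1 : t <= 1. Proof. by rewrite tE; exact: line_search_le1. Qed.

Lemma aseg_step_counter_gt0 : (0 < s'.2)%N.
Proof.
rewrite /aseg_step; case: ifP => // _.
by case: ifP.
Qed.

(** An averaging step multiplies the extragradient inequality by a factor between
    [1 / 2] and [1 + M], which is harmless because all error terms are
    nonnegative; its own cost is at most the drop of [B]. *)
Lemma aseg_step_descent : lyapunov s' + (1 - 3 * mu ^+ 2) / 2 * enorm (z - x) ^+ 2
  <= lyapunov (x, th) + (1 + M) * (3 * (t * enorm (Gxi z - H z)) ^+ 2
     + 3 * (t * enorm (Geta z - H z)) ^+ 2
     + 2 * t * enorm (Geta z - H z) * enorm (z - xs)).
Proof.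
set W := (X in (1 + M) * X).
have W0 : 0 <= W.
  by rewrite /W !addr_ge0 ?mulr_ge0 ?sqr_ge0 ?enorm_ge0 ?(ltW t_gt0).
have MW : W <= (1 + M) * W by rewrite ler_peMl// lerDl ltW.
rewrite /aseg_step; case: ifPn => [stop|go].
  have -> : z - x = 0.
    by rewrite zE tE /aseg_backtracks stop expr0 mulr1; apply/eqP.
  by rewrite enorm0 expr0n/= mulr0 addr0 lerDl (le_trans W0).
rewrite -tE -zE; set y := proj X _; set alpha := (X in `|X| <= M).
have base : enorm (y - xs) ^+ 2 <= enorm (x - xs) ^+ 2
    - (1 - 3 * mu ^+ 2) * enorm (z - x) ^+ 2 + W.
  rewrite (enormB z x); apply: (extragradient_noise X_closed X_convex X_ne Xxs zE) => //.
  - exact: ltW.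
  - rewrite subr_eq0 in go.
    have := line_search_accepts gamma_range rho_range mu_gt0 Lk_ge1 G_lip go.
    by rewrite /aseg_accept -tE -zE.
  - have Xz : X z by rewrite zE; exact: proj_in.
    by apply: H_pm => //; case: xs_sol => _; apply.
have kF0 : 0 <= (1 - 3 * mu ^+ 2) * enorm (z - x) ^+ 2.
  by rewrite mulr_ge0 ?sqr_ge0// ltW// descent_factor_gt0.
have plain : enorm (y - xs) ^+ 2 + averaging_cost * B th
    + (1 - 3 * mu ^+ 2) / 2 * enorm (z - x) ^+ 2
    <= lyapunov (x, th) + (1 + M) * W.
  by rewrite /lyapunov /=; move: base kF0 MW; lra.
case: ifPn => [alphaM|_]; last exact: plain.
move: (alphaM); rewrite {1}/alpha; case: ifPn => [short _|_]; last first.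
  by rewrite ger0_norm ?(addr_ge0 (ltW M_gt0))// => M1; exfalso; lra.
have alphaE : alpha = dotv (y - x) (y - x - (z - x)) / enorm (y - x - (z - x)) ^+ 2.
  by rewrite /alpha short.
move: short; rewrite lt_min => /andP[shortF short_nu].
have alpha_half : alpha <= 2^-1 by rewrite alphaE ltW// anderson_weight_lt.
have := averaging_step alphaM alpha_half kF0 W0 base.
have nuB : enorm (y - x) ^+ 2 <= nu ^+ 2 * (B th - B th.+1).
  apply: (@le_trans _ _ ((nu * th%:R `^ (- tau)) ^+ 2)).
    by rewrite ler_pXn2r ?nnegrE ?enorm_ge0 ?mulr_ge0 ?powR_ge0// ltW.
  rewrite exprMn ler_wpM2l ?sqr_ge0// lerBrDr addrC; exact: B_step.
have MM : 0 <= M * (1 + M) by rewrite mulr_ge0 ?addr_ge0// ltW.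
have {MM nuB} := ler_wpM2l MM nuB.
by rewrite /lyapunov /averaging_cost /= -alphaE; lra.
Qed.

Lemma half_step_dist : enorm (z - xs) ^+ 2 <=
  3 * ((1 + l) ^+ 2 * enorm (x - xs) ^+ 2 + enorm (H xs) ^+ 2
       + enorm (Gxi x - H x) ^+ 2).
Proof.
have zxs : enorm (z - xs) <= (1 + l) * enorm (x - xs) + enorm (H xs) + enorm (Gxi x - H x).
  rewrite zE -[in leLHS](proj_id X_closed X_ne Xxs).
  apply: (le_trans (proj_nonexpansive X_closed X_convex X_ne _ _)).
  have -> : x - t *: Gxi x - xs = (x - xs) - t *: Gxi x by rewrite addrAC.
  apply: (le_trans (ler_enormB _ _)); rewrite enormZ (ger0_norm (ltW t_gt0)).
  have G1 : enorm (Gxi x) <= enorm (Gxi x - H x) + (l * enorm (x - xs) + enorm (H xs)).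
    have := ler_enorm_dist (H x) (Gxi x) 0; rewrite !subr0 => /le_trans; apply.
    rewrite lerD2l; have := ler_enorm_dist (H xs) (H x) 0; rewrite !subr0 => /le_trans.
    by apply; rewrite lerD2r.
  have := ler_piMl (enorm_ge0 (Gxi x)) t_le1; lra.
apply: (@le_trans _ _ (((1 + l) * enorm (x - xs) + enorm (H xs) + enorm (Gxi x - H x)) ^+ 2)).
  by rewrite ler_pXn2r ?nnegrE ?enorm_ge0// (le_trans (enorm_ge0 _) zxs).
move: (enorm (H xs)) (enorm (Gxi x - H x)) => p q; rewrite -exprMn.
move: ((1 + l) * enorm (x - xs)) => o.
have := sqr_ge0 (o - p); have := sqr_ge0 (p - q); have := sqr_ge0 (o - q); lra.
Qed.

(** By [proj_step_homogeneous] the accepted step is comparable to the step of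
    length [gamma] up to the factor [gamma / t], hence up to [Lk]. *)
Lemma residual_le_step : residual X H gamma x ^+ 2 / Lk ^+ 2 <=
  2 * (enorm (z - x) ^+ 2 / (Num.min (rho * mu) gamma / gamma) ^+ 2)
  + 2 * enorm (Gxi x - H x) ^+ 2.
Proof.
set a := Num.min _ _ / gamma; set D := enorm (Gxi x - H x).
have a0 : 0 < a by rewrite divr_gt0// min_step_gt0.
have r_le : residual X H gamma x <= enorm (proj X (x - gamma *: Gxi x) - x) + D.
  apply: (le_trans (ler_enorm_dist (proj X (x - gamma *: Gxi x)) _ _)).
  rewrite addrC lerD2l; apply: (le_trans (proj_nonexpansive X_closed X_convex X_ne _ _)).
  have -> : x - gamma *: H x - (x - gamma *: Gxi x) = gamma *: (Gxi x - H x).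
    by apply/rowP => i; rewrite !mxE; ring.
  rewrite enormZ (ger0_norm (ltW gamma_gt0)) ler_piMl ?enorm_ge0//.
  by case/andP: gamma_range.
have step_le : a / Lk * enorm (proj X (x - gamma *: Gxi x) - x) <= enorm (z - x).
  have t_gamma : t <= gamma by rewrite tE; exact: line_search_le_gamma.
  have := proj_step_homogeneous X_closed X_convex X_ne x (Gxi x) t_gt0 t_gamma.
  rewrite -[proj X (x - t *: Gxi x)]zE => h.
  rewrite -(ler_pM2l gamma_gt0); apply: le_trans h.
  rewrite mulrA ler_wpM2r ?enorm_ge0// /a.
  have -> : gamma * (Num.min (rho * mu) gamma / gamma / Lk) = Num.min (rho * mu) gamma / Lk.
    by field; rewrite !gt_eqF.
  by rewrite tE; exact: line_search_lower.
have Lr : residual X H gamma x / Lk <= enorm (z - x) / a + D.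
  apply: (@le_trans _ _ (enorm (proj X (x - gamma *: Gxi x) - x) / Lk + D)).
    apply: (@le_trans _ _ ((enorm (proj X (x - gamma *: Gxi x) - x) + D) / Lk)).
      by rewrite ler_pM2r// invr_gt0.
    by rewrite mulrDl lerD2l ler_pdivrMr// ler_peMr// enorm_ge0.
  rewrite lerD2r -(ler_pM2l a0).
  have -> : a * (enorm (z - x) / a) = enorm (z - x) by field; rewrite gt_eqF.
  by apply: le_trans step_le; rewrite le_eqVlt; apply/orP; left; apply/eqP; ring.
rewrite -!exprVn -!exprMn.
have r0 : 0 <= residual X H gamma x / Lk by rewrite divr_ge0 ?enorm_ge0// ltW.
have Lr2 : (residual X H gamma x / Lk) ^+ 2 <= (enorm (z - x) / a + D) ^+ 2.
  by rewrite ler_pXn2r ?nnegrE// (le_trans r0 Lr).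
apply: (le_trans Lr2); move: (enorm (z - x) / a) => b.
have := sqr_ge0 (b - D); lra.
Qed.

(** The left-hand side is the tangent at [l] of the convex function [u ^ -2]; it
    is affine in [Lk], so that its expectation only involves the mean of [Lk]. *)
Lemma inv_sqr_tangent : 3 / l ^+ 2 - 2 / l ^+ 2 * (Lk / l) <= (Lk ^+ 2)^-1.
Proof.
set u := Lk / l.
have u0 : 0 < u by rewrite divr_gt0.
have -> : (Lk ^+ 2)^-1 = (u ^+ 2)^-1 / l ^+ 2.
  by rewrite /u; field; rewrite !gt_eqF.
have -> : 3 / l ^+ 2 - 2 / l ^+ 2 * u = (3 - 2 * u) / l ^+ 2 by ring.
rewrite ler_pM2r ?invr_gt0 ?exprn_gt0// -[leRHS]mul1r ler_pdivlMr ?exprn_gt0//.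
have : 0 <= (1 - u) ^+ 2 * (1 + 2 * u) by rewrite mulr_ge0 ?sqr_ge0// addr_ge0// mulr_ge0// ltW.
lra.
Qed.

Definition residual_rate : R := descent_rate / (2 * l ^+ 2).
Definition noise_cost : R := 6 * (1 + M) + descent_rate.

Lemma residual_rate_gt0 : 0 < residual_rate.
Proof. by rewrite divr_gt0 ?descent_rate_gt0// mulr_gt0// exprn_gt0. Qed.

Lemma noise_cost_gt0 : 0 < noise_cost.
Proof. by rewrite addr_gt0 ?descent_rate_gt0// mulr_gt0// addr_gt0. Qed.

(** The weight [eps] balances the error of the second batch, of mean square
    [eps ^ 2], against the distance of [z] to the solution. The residual
    reappears on the right with the coefficient [2 / 3] of the left when [Lk]
    has mean [l], and is absorbed after taking expectations. *)
Lemma aseg_step_residual (eps : R) : 0 < eps <= 1 ->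
  forall h, h = proj X (x - t *: H x) ->
  lyapunov s' + 3 * residual_rate * residual X H gamma x ^+ 2 <=
  lyapunov (x, th)
  + noise_cost * (((Lk + l) * enorm (Gxi x - H x)) ^+ 2
      + (t * enorm (Gxi h - H h)) ^+ 2
      + enorm (Geta z - H z) ^+ 2 / eps + eps * enorm (z - xs) ^+ 2)
  + 2 * residual_rate * (Lk / l * residual X H gamma x ^+ 2).
Proof.
move=> /andP[eps0 eps1] h hE.
set D := (Lk + l) * _; set dh := t * _; set de := enorm (Geta z - H z).
set r2 := residual _ _ _ _ ^+ 2; set zx := enorm (z - xs).
have dz_le : t * enorm (Gxi z - H z) <= D + dh.
  exact: (half_step_error X_closed X_convex X_ne gamma_range rho_range Lk_ge1 G_lip (ltW l_gt0) H_lip tE zE hE).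
have dz2 : (t * enorm (Gxi z - H z)) ^+ 2 <= 2 * D ^+ 2 + 2 * dh ^+ 2.
  apply: (@le_trans _ _ ((D + dh) ^+ 2)).
    have dz0 : 0 <= t * enorm (Gxi z - H z) by rewrite mulr_ge0 ?enorm_ge0// ltW.
    by rewrite ler_pXn2r ?nnegrE// (le_trans dz0 dz_le).
  have := sqr_ge0 (D - dh); lra.
have de0 : 0 <= de by exact: enorm_ge0.
have te2 : (t * de) ^+ 2 <= de ^+ 2 / eps.
  apply: (@le_trans _ _ (de ^+ 2)); last by rewrite ler_pdivlMr// ler_piMr ?sqr_ge0.
  by rewrite exprMn ler_piMl ?sqr_ge0// exprn_ile1// ltW.
have cross : 2 * t * de * zx <= de ^+ 2 / eps + eps * zx ^+ 2.
  have zx0 : 0 <= zx by exact: enorm_ge0.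
  have dzx : 0 <= de * zx by rewrite mulr_ge0.
  have h1 : 2 * t * de * zx <= 2 * (de * zx).
    by have := ler_piMl dzx t_le1; lra.
  apply: (le_trans h1); rewrite -(ler_pM2l eps0).
  have -> : eps * (de ^+ 2 / eps + eps * zx ^+ 2) = de ^+ 2 + (eps * zx) ^+ 2.
    by field; rewrite gt_eqF.
  have := sqr_ge0 (de - eps * zx); lra.
have Delta2 : enorm (Gxi x - H x) ^+ 2 <= D ^+ 2.
  have LL : 1 <= Lk + l by rewrite (le_trans Lk_ge1)// lerDl ltW.
  by rewrite /D exprMn ler_peMl ?sqr_ge0// exprn_ege1.
have desc := aseg_step_descent.
have res := residual_le_step; rewrite -/r2 in res.
set a := Num.min (rho * mu) gamma / gamma in res.
have a0 : 0 < a by rewrite divr_gt0// min_step_gt0.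
have r20 : 0 <= r2 by exact: sqr_ge0.
have tang : (3 / l ^+ 2 - 2 / l ^+ 2 * (Lk / l)) * r2 <= r2 / Lk ^+ 2.
  by rewrite [leRHS]mulrC ler_wpM2r// inv_sqr_tangent.
have {res}tang := le_trans tang res.
have dr0 : 0 <= descent_rate / 2 by rewrite divr_ge0// ltW// descent_rate_gt0.
have {tang} := ler_wpM2l dr0 tang.
have -> : descent_rate / 2 * (2 * (enorm (z - x) ^+ 2 / a ^+ 2) + 2 * enorm (Gxi x - H x) ^+ 2)
   = (1 - 3 * mu ^+ 2) / 2 * enorm (z - x) ^+ 2 + descent_rate * enorm (Gxi x - H x) ^+ 2.
  rewrite /descent_rate -/a; field; by rewrite gt_eqF.
have -> : descent_rate / 2 * ((3 / l ^+ 2 - 2 / l ^+ 2 * (Lk / l)) * r2) =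
   3 * residual_rate * r2 - 2 * residual_rate * (Lk / l * r2).
  by rewrite /residual_rate; field; rewrite gt_eqF.
move=> tang.
have Delta2' := ler_wpM2l (ltW descent_rate_gt0) Delta2.
have M10 : 0 <= 1 + M by rewrite addr_ge0// ltW.
have dh2 : 0 <= descent_rate * dh ^+ 2 by rewrite mulr_ge0 ?sqr_ge0// ltW// descent_rate_gt0.
have q0 : 0 <= de ^+ 2 / eps by rewrite divr_ge0 ?sqr_ge0// ltW.
have q1 : 0 <= eps * zx ^+ 2 by rewrite mulr_ge0 ?sqr_ge0// ltW.
have {}q0 : 0 <= descent_rate * (de ^+ 2 / eps) by rewrite mulr_ge0// ltW// descent_rate_gt0.
have q1' : 0 <= descent_rate * (eps * zx ^+ 2) by rewrite mulr_ge0// ltW// descent_rate_gt0.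
have := ler_wpM2l M10 dz2; have := ler_wpM2l M10 te2; have := ler_wpM2l M10 cross.
have := mulr_ge0 M10 q1.
have q0' : 0 <= de ^+ 2 / eps by rewrite divr_ge0 ?sqr_ge0// ltW.
have := mulr_ge0 M10 q0'.
move: desc; rewrite -/de -/zx /noise_cost.
by move: tang Delta2' dh2 q0 q1'; lra.
Qed.

End OneStep.

Lemma residual_sqr_le x : residual X H gamma x ^+ 2 <=
  2 * ((2 + l) ^+ 2 * enorm (x - xs) ^+ 2 + enorm (H xs) ^+ 2).
Proof.
have r_le : residual X H gamma x <= (2 + l) * enorm (x - xs) + enorm (H xs).
  apply: (le_trans (ler_enorm_dist xs _ _)).
  rewrite -[in X in X + _ <= _](proj_id X_closed X_ne Xxs).
  have := proj_nonexpansive X_closed X_convex X_ne (x - gamma *: H x) xs.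
  have -> : x - gamma *: H x - xs = (x - xs) - gamma *: H x by rewrite addrAC.
  have := ler_enormB (x - xs) (gamma *: H x); rewrite enormZ (ger0_norm (ltW gamma_gt0)).
  have /andP[_ g1] := gamma_range; have := ler_piMl (enorm_ge0 (H x)) g1.
  have := ler_enorm_dist (H xs) (H x) 0; rewrite !subr0.
  have := H_lip x xs; rewrite (enormB xs x); lra.
apply: (@le_trans _ _ (((2 + l) * enorm (x - xs) + enorm (H xs)) ^+ 2)).
  have r0 : 0 <= residual X H gamma x by exact: enorm_ge0.
  by rewrite ler_pXn2r ?nnegrE// (le_trans r0 r_le).
rewrite -exprMn; move: (_ * enorm _) (enorm (H xs)) => p q.
have := sqr_ge0 (p - q); lra.
Qed.

Lemma mean_half_step_dist (k : nat) x : enorm (proj X (x - (gamma * rho ^+ k) *: H x) - xs) ^+ 2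
  <= 2 * ((1 + l) ^+ 2 * enorm (x - xs) ^+ 2 + enorm (H xs) ^+ 2).
Proof.
set t := gamma * rho ^+ k.
have h_le : enorm (proj X (x - t *: H x) - xs) <= (1 + l) * enorm (x - xs) + enorm (H xs).
  rewrite -[in leLHS](proj_id X_closed X_ne Xxs).
  apply: (le_trans (proj_nonexpansive X_closed X_convex X_ne _ _)).
  have -> : x - t *: H x - xs = (x - xs) - t *: H x by rewrite addrAC.
  have t0 : 0 < t by exact: line_search_gt0.
  have := ler_enormB (x - xs) (t *: H x); rewrite enormZ (ger0_norm (ltW t0)).
  have := ler_piMl (enorm_ge0 (H x)) (line_search_le1 gamma_range rho_range k).
  have := ler_enorm_dist (H xs) (H x) 0; rewrite !subr0.
  by rewrite -/t; have := H_lip x xs; lra.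
apply: (@le_trans _ _ (((1 + l) * enorm (x - xs) + enorm (H xs)) ^+ 2)).
  by rewrite ler_pXn2r ?nnegrE ?enorm_ge0// (le_trans (enorm_ge0 _) h_le).
rewrite -exprMn; move: (_ * enorm _) (enorm (H xs)) => p q.
have := sqr_ge0 (p - q); lra.
Qed.

End StepDescent.
(** * Real sequences: tails of powers, almost supermartingales, sample sizes *)

Section PowerTail.
Context {R : realType}.

(** With [s = 2 * tau - 1], the power [th ^ - s] drops from [th] to [th + 1] by
    at least a fixed multiple of [th ^ - (s + 1)], as for the antiderivative of
    that function. *)
Lemma power_tail_bound (tau : R) : 2^-1 < tau ->
  exists B : nat -> R, (forall th, 0 <= B th) /\
    forall th, (0 < th)%N -> B th.+1 + (th%:R `^ (- tau)) ^+ 2 <= B th.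
Proof.
move=> tau_gt; pose s := 2 * tau - 1.
have s0 : 0 < s by rewrite /s; lra.
pose K := (2 + s) / s.
have K0 : 0 < K by rewrite divr_gt0// addr_gt0.
exists (fun th => K * th%:R `^ (- s)); split.
  by move=> th; rewrite mulr_ge0 ?powR_ge0// ltW.
case=> // th _; set u : R := th.+1%:R.
have u1 : 1 <= u by rewrite ler1n.
have u0 : 0 < u by exact: lt_le_trans u1.
have -> : th.+2%:R = u * (1 + u^-1) :> R.
  by rewrite mulrDr mulr1 divff ?gt_eqF// /u -natr1.
clearbody u; set p := u `^ (- s).
have p0 : 0 <= p by exact: powR_ge0.
have sqE : (u `^ (- tau)) ^+ 2 = p / u.
  rewrite -powR_mulrn ?powR_ge0// -powRrM /p -(powR_inv1 (ltW u0)) -powRD.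
    by congr (_ `^ _); rewrite /s; lra.
  by apply/implyP => _; rewrite gt_eqF.
clearbody s; rewrite sqE powRM ?(ltW u0)//; last by rewrite addr_ge0// invr_ge0 ltW.
rewrite -/p; set q := _ `^ (- s).
have q_le : q <= (1 + s / (u + 1))^-1.
  have d0 : 0 < 1 + u^-1 by rewrite addr_gt0// invr_gt0.
  rewrite /q /powR gt_eqF//.
  have ln_ge : (u + 1)^-1 <= ln (1 + u^-1).
    have -> : 1 + u^-1 = (1 - (u + 1)^-1)^-1.
      have uN0 : u != 0 by rewrite gt_eqF.
      have u1N0 : u + 1 != 0 by rewrite gt_eqF// addr_gt0.
      by field; rewrite u1N0 addrK uN0.
    have inv_lt1 : (u + 1)^-1 < 1 by rewrite invf_lt1 ?addr_gt0// ltrDr.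
    rewrite lnV ?posrE ?subr_gt0// lerNr; apply: le_ln1Dx.
    by rewrite ltrNl opprK.
  have v0 : 0 < 1 + s / (u + 1) by rewrite addr_gt0// divr_gt0// addr_gt0.
  rewrite mulNr expRN lef_pV2 ?posrE ?expR_gt0//.
  apply: (le_trans _ (expR_ge1Dx _)); rewrite lerD2l ler_wpM2l//.
  exact: ltW.
have q_gap : K^-1 / u <= 1 - q.
  have : K^-1 / u <= 1 - (1 + s / (u + 1))^-1.
    have -> : 1 - (1 + s / (u + 1))^-1 = s / (u + 1 + s).
      have u1N0 : u + 1 != 0 by rewrite gt_eqF// addr_gt0.
      have usN0 : u + 1 + s != 0 by rewrite gt_eqF// !addr_gt0.
      by field; rewrite u1N0 usN0.
    rewrite /K invf_div -mulrA ler_wpM2l//; first exact: ltW.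
    rewrite -invfM lef_pV2 ?posrE ?addr_gt0 ?mulr_gt0 ?addr_gt0//.
    have := ler_peMr (ltW s0) u1; lra.
  by lra.
have Kq : u^-1 <= K * (1 - q) by rewrite -ler_pdivrMl// mulrC mulrC.
by have := ler_wpM2l p0 Kq; lra.
Qed.

End PowerTail.

Section AlmostSupermartingale.
Context {R : realType}.

(** Deterministic counterpart of the Robbins-Siegmund lemma: the factors
    [1 + C * e k] have a bounded product because [e] is summable. *)
Lemma summable_perturbation (a r e : nat -> R) (C E : R) :
  (forall k, 0 <= a k) -> (forall k, 0 <= r k) -> (forall k, 0 <= e k) -> 0 <= C ->
  (forall n, \sum_(k < n) e k <= E) ->
  (forall k, a k.+1 + r k <= a k + C * e k * (1 + a k)) ->
  exists2 K : R, 0 < K & forall n, \sum_(k < n) r k <= K.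
Proof.
move=> a0 r0 e0 C0 eE step.
have E0 : 0 <= E by have := eE 0%N; rewrite big_ord0.
have bound k : 1 + a k <= expR (C * \sum_(i < k) e i) * (1 + a 0%N).
  elim: k => [|k IH]; first by rewrite big_ord0 mulr0 expR0 mul1r.
  rewrite big_ord_recr/= (mulrDr C) expRD.
  have h : 1 + a k.+1 <= (1 + C * e k) * (1 + a k).
    by have := step k; have := r0 k; lra.
  apply: (le_trans h).
  rewrite (mulrC (expR _)) -mulrA; apply: ler_pM => //.
  - by rewrite addr_ge0// mulr_ge0.
  - by rewrite addr_ge0.
  - by rewrite expR_ge1Dx.
pose A := expR (C * E) * (1 + a 0%N).
have aA k : 1 + a k <= A.
  apply: (le_trans (bound k)); rewrite ler_wpM2r ?addr_ge0// ler_expR ler_wpM2l//.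
have A0 : 0 < A by rewrite mulr_gt0 ?expR_gt0// ltr_pwDl.
exists (a 0%N + C * E * A + 1) => [|n].
  by rewrite ltr_wpDl// addr_ge0// mulr_ge0 ?(ltW A0)// mulr_ge0.
have : a n + \sum_(k < n) r k <= a 0%N + C * A * \sum_(k < n) e k.
  elim: n => [|n IH]; first by rewrite !big_ord0 mulr0.
  rewrite !big_ord_recr/=.
  have := step n; have := ler_wpM2l (mulr_ge0 C0 (e0 n)) (aA n); lra.
have := ler_wpM2l (mulr_ge0 C0 (ltW A0)) (eE n); have := a0 n; lra.
Qed.

Lemma cvg_series_bounded (e : nat -> R) : (forall k, 0 <= e k) -> cvgn (series e) ->
  exists E : R, forall n, \sum_(k < n) e k <= E.
Proof.
move=> e0 e_cvg; exists (limn (series e)) => n.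
rewrite -(big_mkord xpredT e); apply: (nondecreasing_cvgn_le _ e_cvg).
by apply/nondecreasing_series => // k _; exact: e0.
Qed.

End AlmostSupermartingale.

Section SampleRate.
Context {R : realType} (NN : nat) (lambda b : R).
Hypotheses (b_gt0 : 0 < b) (lambda_gt2 : 2 < lambda).

Lemma sample_rate_gt0 k : (0 < NN)%N -> (0 < sample_rate NN lambda b k)%N.
Proof.
move=> NN0; rewrite /sample_rate muln_gt0 NN0/= absz_gt0 ceil_neq0; apply/orP; right.
have kl1 : 1 < k%:R + lambda.
  by rewrite (lt_le_trans _ (_ : lambda <= _)) ?lerDr// (lt_trans _ lambda_gt2)// ltr1n.
by rewrite mulr_gt0 ?exprn_gt0 ?powR_gt0 ?ln_gt0// (lt_trans _ kl1).
Qed.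

(** For [k <= c * u] and large [u] one has [ln (k + lambda) <= 2 * ln u], so each
    of the at most [(c + 1) * u] batches has size of order
    [u ^ 2 * ln u ^ (2 + 2 * b)]. *)
Lemma sum_sample_rate (c : R) : 0 < c -> exists2 C : R, 0 < C &
  exists u0 : R, 1 < u0 /\ forall u, u0 <= u -> forall N : nat, N%:R <= c * u ->
    \sum_(0 <= k < N.+1) (sample_rate NN lambda b k)%:R
      <= NN%:R * C * u ^+ 3 * ln u `^ (2 + 2 * b).
Proof.
move=> c0; set be := 2 + 2 * b.
have be0 : 0 < be by rewrite addr_gt0// mulr_gt0.
pose D := (c + 1) ^+ 2 * 2 `^ be + 1.
have D0 : 0 < D by rewrite addr_gt0// mulr_gt0 ?exprn_gt0 ?powR_gt0 ?addr_gt0.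
have c10 : 0 < c + 1 by rewrite addr_gt0.
exists ((c + 1) * D); first by rewrite mulr_gt0.
(* Large enough for k + lambda <= u ^ 2 and 1 <= ln u. *)
exists (lambda + expR 1 + c + 1); split.
  by rewrite ltr_pwDl// !addr_gt0 ?expR_gt0// (lt_trans _ lambda_gt2).
move=> u u0u N Nu.
have ex0 := expR_gt0 (1 : R).
have [ul ue uc u1] : [/\ lambda <= u, expR 1 <= u, c + 1 <= u & 1 <= u].
  by move: (expR 1) ex0 u0u => e1 ? ?; split; move: lambda_gt2; lra.
have ugt0 : 0 < u by exact: lt_le_trans u1.
have lnu1 : 1 <= ln u by rewrite -(expRK 1) ler_ln ?posrE.
have lnu0 : 0 <= ln u by exact: le_trans lnu1.
have lnu_be : 1 <= ln u `^ be.
  have := @ge0_ler_powR R be (ltW be0) 1 (ln u).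
  by rewrite !nnegrE powR1; apply.
have term k : (k < N.+1)%N -> (sample_rate NN lambda b k)%:R
    <= NN%:R * (D * (u ^+ 2 * ln u `^ be)) :> R.
  rewrite ltnS => kN.
  have kl2 : 2 < k%:R + lambda by rewrite (lt_le_trans lambda_gt2)// lerDr.
  have kl0 : 0 < k%:R + lambda by rewrite (lt_trans _ kl2).
  have kl_le : k%:R + lambda <= (c + 1) * u.
    by rewrite mulrDl mul1r lerD// (le_trans _ Nu)// ler_nat.
  have ln_le : ln (k%:R + lambda) <= 2 * ln u.
    rewrite mulr_natl mulr2n -lnM ?posrE// ler_ln ?posrE ?mulr_gt0//.
    by apply: (le_trans kl_le); rewrite ler_pM2r.
  have ln0 : 0 <= ln (k%:R + lambda) by rewrite ln_ge0// ltW// (lt_trans _ kl2)// ltr1n.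
  set v := (k%:R + lambda) ^+ 2 * ln (k%:R + lambda) `^ be.
  have v0 : 0 <= v by rewrite mulr_ge0 ?sqr_ge0 ?powR_ge0.
  rewrite /sample_rate natrM -/be -/v ler_wpM2l//.
  have -> : (`|Num.ceil v|)%:R = (Num.ceil v)%:~R :> R.
    by rewrite natr_absz ger0_norm// ceil_ge0 (lt_le_trans _ v0)// ltrN10.
  have ceil_le : (Num.ceil v)%:~R <= v + 1.
    by have /andP[+ _] := ceil_itv v; rewrite intrB ltrBlDr => /ltW.
  apply: (le_trans ceil_le).
  rewrite /D mulrDl mul1r lerD//; last first.
    by rewrite -[leLHS]mulr1 ler_pM// exprn_ege1.
  rewrite mulrACA; apply: ler_pM; rewrite ?sqr_ge0 ?powR_ge0//.
    by rewrite -exprMn ler_pXn2r// nnegrE ltW// mulr_gt0.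
  rewrite -powRM ?(le_trans _ lnu1)//.
  by apply: ge0_ler_powR; rewrite ?nnegrE ?(ltW be0)// mulr_ge0// (le_trans _ lnu1).
rewrite big_mkord.
apply: (@le_trans _ _ (\sum_(k < N.+1) NN%:R * (D * (u ^+ 2 * ln u `^ be)))).
  by apply: ler_sum => k _; exact: term.
rewrite sumr_const card_ord -[leLHS]mulr_natl.
have N1 : N.+1%:R <= (c + 1) * u by rewrite -natr1 mulrDl mul1r lerD.
have X0 : 0 <= NN%:R * (D * (u ^+ 2 * ln u `^ be)).
  by rewrite !mulr_ge0 ?sqr_ge0 ?powR_ge0// ltW.
apply: (le_trans (ler_wpM2r X0 N1)).
by rewrite le_eqVlt; apply/orP; left; apply/eqP; ring.
Qed.

End SampleRate.
(** * Measurability of the algorithm *)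

Section MeasurableVectors.
Context {R : realType} {n : nat}.

(** Coordinatewise, so that the calculus of real measurable functions applies;
    [measurable_rVP] relates this to the Borel sets. *)
Definition measurable_rV d (D : measurableType d) (f : D -> 'rV[R]_n) : Prop :=
  forall i, measurable_fun [set: D] (fun w => f w 0 i).

Lemma continuous_borel_rV (g : 'rV[R]_n -> R) : continuous g ->
  measurable_fun [set: borel_rV R n] (g : borel_rV R n -> R).
Proof.
move=> g_cont; apply: (measurability _ (RGenOInfty.measurableE R)).
move=> _ [_ [x ->] <-]; apply: sub_sigma_algebra; rewrite setTI.
by move/continuousP : g_cont; apply; exact: interval_open.
Qed.

Lemma continuous_borel_rV_rV (g : 'rV[R]_n -> 'rV[R]_n) : continuous g ->
  measurable_fun [set: borel_rV R n] (g : borel_rV R n -> borel_rV R n).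
Proof.
move=> g_cont; apply: (measurability (@open 'rV[R]_n : set (set (borel_rV R n))) erefl).
move=> _ [A oA <-]; apply: sub_sigma_algebra; rewrite setTI.
by move/continuousP : g_cont; exact.
Qed.

(** Every open set is a countable union of rational boxes. *)
Lemma measurable_rVP d (D : measurableType d) (f : D -> 'rV[R]_n) :
  measurable_rV f <-> measurable_fun [set: D] (f : D -> borel_rV R n).
Proof.
split=> [mf|mf i]; last first.
  by apply: (measurableT_comp (continuous_borel_rV (@continuous_coord R n i)) mf).
apply: (measurability (@open 'rV[R]_n : set (set (borel_rV R n))) erefl).
move=> _ [A oA <-]; rewrite setTI.
pose box (u : 'rV[rat]_n * nat) : set 'rV[R]_n :=
  [set y | forall i, `|ratr (u.1 0 i) - y 0 i| < u.2.+1%:R^-1].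
have -> : f @^-1` A = \bigcup_(u in [set u | box u `<=` A]) (f @^-1` box u).
  apply/seteqP; split=> [w /= Afw|w [u uA /= bw]]; last exact: uA.
  have /(@nbhs_ballP R _ (f w)) [e /= e0 eA] : nbhs (f w) A by exact: open_nbhs_nbhs.
  have [m] := ltr_add_invr (divr_gt0 e0 (ltr0n R 2)); rewrite add0r => me.
  have /choice [q hq] : forall i, exists q : rat, `|ratr q - f w 0 i| < m.+1%:R^-1.
    move=> i.
    have [|q] := @rat_in_itvoo R (f w 0 i - m.+1%:R^-1) (f w 0 i + m.+1%:R^-1).
      by rewrite ltrBlDr -addrA ltrDl addr_gt0// invr_gt0.
    by rewrite in_itv/= => qi; exists q; rewrite ltr_distl.
  exists (\row_i q i, m) => /=; last by move=> i; rewrite mxE.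
  move=> y yq; apply: eA; split => // i j; rewrite ord1 /ball /=.
  rewrite (le_lt_trans (ler_distD (ratr (q j)) _ _))// (distrC (f w 0 j)).
  have := yq j; have := hq j; rewrite mxE /=.
  move: me; rewrite -(ltr_pM2r (ltr0n R 2)) divfK// => me h1 h2.
  by rewrite (lt_trans (ltrD h1 h2))// -mulr2n -[ltLHS]mulr_natr.
rewrite bigcup_mkcond; apply: countable_bigcupT_measurable => [|u].
  exact: countableP.
case: ifPn => _ //.
have -> : f @^-1` box u = \bigcap_(i in [set: 'I_n])
    (fun w => `|ratr (u.1 0 i) - f w 0 i|) @^-1` [set r | r < u.2.+1%:R^-1].
  by apply/seteqP; split=> w /= h i => [_|]; exact: h.
apply: fin_bigcap_measurable => // i _.
rewrite -[X in measurable X]setTI.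
have -> : (fun w => `|ratr (u.1 0 i) - f w 0 i|) @^-1` [set r | r < u.2.+1%:R^-1]
   = (fun w => `|ratr (u.1 0 i) - f w 0 i|) @^-1` `]-oo, u.2.+1%:R^-1[%classic.
  by apply/seteqP; split=> w /=; rewrite in_itv.
have mabs : measurable_fun [set: D] (fun w => `|ratr (u.1 0 i) - f w 0 i|).
  apply: (measurableT_comp (@normr_measurable R setT)).
  by apply: measurable_funB => //; exact: mf.
exact: mabs.
Qed.

Section Closure.
Context d (D : measurableType d).
Implicit Types f g : D -> 'rV[R]_n.

Lemma measurable_rV_cst v : measurable_rV (fun _ : D => v).
Proof. by move=> i; exact: measurable_cst. Qed.

Lemma measurable_rVD f g : measurable_rV f -> measurable_rV g ->
  measurable_rV (fun w => f w + g w).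
Proof.
move=> mf mg i; under eq_fun do rewrite mxE.
by apply: measurable_funD; [exact: mf|exact: mg].
Qed.

Lemma measurable_rVZ (a : D -> R) f : measurable_fun setT a -> measurable_rV f ->
  measurable_rV (fun w => a w *: f w).
Proof.
move=> ma mf i; under eq_fun do rewrite mxE.
by apply: measurable_funM => //; exact: mf.
Qed.

Lemma measurable_rVB f g : measurable_rV f -> measurable_rV g ->
  measurable_rV (fun w => f w - g w).
Proof.
move=> mf mg i; under eq_fun do rewrite !mxE.
by apply: measurable_funB; [exact: mf|exact: mg].
Qed.

Lemma measurable_rV_sum (I : Type) (s : seq I) (f : I -> D -> 'rV[R]_n) :
  (forall j, measurable_rV (f j)) -> measurable_rV (fun w => \sum_(j <- s) f j w).
Proof.
move=> mf i; under eq_fun do rewrite summxE.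
by apply: measurable_sum => j; exact: mf.
Qed.

Lemma measurable_dotv f g : measurable_rV f -> measurable_rV g ->
  measurable_fun setT (fun w => dotv (f w) (g w)).
Proof.
move=> mf mg; apply: measurable_sum => i.
by apply: measurable_funM; [exact: mf|exact: mg].
Qed.

Lemma measurable_enorm f : measurable_rV f -> measurable_fun setT (fun w => enorm (f w)).
Proof.
move=> mf; have msqrt : measurable_fun setT (Num.sqrt : R -> R).
  by apply: continuous_measurable_fun; exact: sqrt_continuous.
exact: (measurableT_comp msqrt (measurable_dotv mf mf)).
Qed.

Lemma measurable_rV_comp (g : 'rV[R]_n -> 'rV[R]_n) f : continuous g ->
  measurable_rV f -> measurable_rV (fun w => g (f w)).
Proof.
move=> g_cont /measurable_rVP mf; apply/measurable_rVP.
exact: (measurableT_comp (continuous_borel_rV_rV g_cont) mf).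
Qed.

Lemma measurable_rV_if (c : D -> bool) f g : measurable_fun setT c ->
  measurable_rV f -> measurable_rV g -> measurable_rV (fun w => if c w then f w else g w).
Proof.
move=> mc /measurable_rVP mf /measurable_rVP mg; apply/measurable_rVP.
exact: measurable_fun_ifT.
Qed.

Lemma measurable_fun_nat_index d' (V : measurableType d') (k : D -> nat)
    (f : nat -> D -> V) : measurable_fun setT k ->
  (forall j, measurable_fun setT (f j)) -> measurable_fun setT (fun w => f (k w) w).
Proof.
move=> mk mf _ Y mY; rewrite setTI.
have -> : (fun w => f (k w) w) @^-1` Y =
    \bigcup_j (k @^-1` [set j] `&` f j @^-1` Y).
  apply/seteqP; split=> [w Yw|w [j _ [/= kj Yw]]]; first by exists (k w).
  by rewrite /= kj.
apply: bigcupT_measurable => j; apply: measurableI; rewrite -[X in measurable X]setTI.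
  exact: mk.
exact: mf.
Qed.

Lemma measurable_fun_natP (k : D -> nat) :
  (forall j, measurable (k @^-1` [set j])) -> measurable_fun setT k.
Proof.
move=> mk _ Y _; rewrite setTI.
have -> : k @^-1` Y = \bigcup_(j in Y) (k @^-1` [set j]).
  by apply/seteqP; split=> [w Yw|w [j Yj /= ->]//]; exists (k w).
by apply: bigcup_measurable => j _; exact: mk.
Qed.

Lemma measurable_bool_set (c : D -> bool) : measurable_fun setT c ->
  measurable [set w | c w].
Proof.
move=> mc; have := mc measurableT [set true] I; rewrite setTI.
by congr measurable; apply/seteqP; split=> w /= ->.
Qed.

Lemma measurable_first_index (p : D -> pred nat) :
  (forall j, measurable_fun setT (fun w => p w j)) ->
  measurable_fun setT (fun w => first_index (p w)).
Proof.
move=> mp.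
have mpos j : measurable ((fun w => first_index (p w)) @^-1` [set j.+1]).
  have -> : (fun w => first_index (p w)) @^-1` [set j.+1] =
      [set w | p w j.+1] `&` \bigcap_(i in [set i | (i <= j)%N]) [set w | ~~ p w i].
    apply/seteqP; split=> w /=.
      rewrite /first_index; case: pselect => // ex_p.
      case: ex_minnP => k pk k_min kE; rewrite kE in pk k_min; split=> // i /= ij.
      by apply/negP => /k_min; rewrite ltnNge ij.
    move=> [pj below]; have [pf min_f] := first_indexP (ex_intro _ j.+1 pj).
    apply/eqP; rewrite eqn_leq; apply/andP; split.
      by rewrite leqNgt; apply/negP => /min_f; rewrite pj.
    by rewrite ltnNge; apply/negP => /below /=; rewrite pf.
  apply: measurableI; first exact: measurable_bool_set.
  apply: bigcap_measurableType => i _; apply: measurable_bool_set.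
  exact: measurable_neg.
apply: measurable_fun_natP => -[|j]; last exact: mpos.
have -> : (fun w => first_index (p w)) @^-1` [set 0%N] =
    ~` \bigcup_j ((fun w => first_index (p w)) @^-1` [set j.+1]).
  apply/seteqP; split=> w /=.
    by move=> f0 [j _ /= fj]; rewrite f0 in fj.
  case fE: (first_index (p w)) => [//|j] no_pos.
  by exfalso; apply: no_pos; exists j.
by apply: measurableC; apply: bigcupT_measurable => j; exact: mpos.
Qed.

End Closure.

Lemma measurable_rV_id : measurable_rV (fun z : borel_rV R n => z).
Proof. by apply/measurable_rVP; exact: measurable_id. Qed.

End MeasurableVectors.

Section MeasurableIterates.
Context {R : realType} {n : nat} {dX : measure_display} {Xi : measurableType dX}.
Variables (X : set 'rV[R]_n) (par : aseg_params R).
Hypotheses (X_closed : closed X) (X_convex : convex_set X) (X_ne : X !=set0).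
Variable T : Xi -> 'rV[R]_n -> 'rV[R]_n.
Hypothesis T_meas : measurable_fun [set: Xi * borel_rV R n]
  (fun z : Xi * borel_rV R n => T z.1 z.2 : borel_rV R n).

Section OneDomain.
Context {d : measure_display} {D : measurableType d}.

Lemma measurable_T (Y : D -> Xi) (z : D -> 'rV[R]_n) : measurable_fun setT Y ->
  measurable_rV z -> measurable_rV (fun w => T (Y w) (z w)).
Proof.
move=> mY /measurable_rVP mz; apply/measurable_rVP.
by have := measurableT_comp T_meas (measurable_fun_pair mY mz).
Qed.

Lemma measurable_sampled_map N (Y : 'I_N -> D -> Xi) (z : D -> 'rV[R]_n) :
  (forall j, measurable_fun setT (Y j)) -> measurable_rV z ->
  measurable_rV (fun w => sampled_map T (Y ^~ w) (z w)).
Proof.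
move=> mY mz; apply: measurable_rVZ => //.
by apply: measurable_rV_sum => j; exact: measurable_T.
Qed.

Lemma measurable_proj (z : D -> 'rV[R]_n) : measurable_rV z ->
  measurable_rV (fun w => proj X (z w)).
Proof. by move=> mz; apply: measurable_rV_comp => //; exact: continuous_proj. Qed.

Lemma measurable_aseg_half N (Y : 'I_N -> D -> Xi) (z : D -> 'rV[R]_n) (t : D -> R) :
  (forall j, measurable_fun setT (Y j)) -> measurable_rV z -> measurable_fun setT t ->
  measurable_rV (fun w => aseg_half X (sampled_map T (Y ^~ w)) (z w) (t w)).
Proof.
move=> mY mz mt; apply: measurable_proj; apply: measurable_rVB => //.
by apply: measurable_rVZ => //; exact: measurable_sampled_map.
Qed.

Lemma measurable_stop N (Y : 'I_N -> D -> Xi) (z : D -> 'rV[R]_n) :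
  (forall j, measurable_fun setT (Y j)) -> measurable_rV z ->
  measurable_fun setT
    (fun w => aseg_half X (sampled_map T (Y ^~ w)) (z w) (as_gamma par) - z w == 0).
Proof.
move=> mY mz.
have m1 : measurable_rV (fun w =>
    aseg_half X (sampled_map T (Y ^~ w)) (z w) (as_gamma par) - z w).
  by apply: measurable_rVB => //; exact: measurable_aseg_half.
have := measurable_fun_ler (measurable_enorm m1) (measurable_cst (0 : R)).
congr (measurable_fun _ _); apply/funext => w /=.
apply/idP/eqP => [h|->]; last by rewrite enorm0.
by apply: enorm_eq0; apply/eqP; rewrite eq_le h enorm_ge0.
Qed.

Lemma measurable_aseg_backtracks N (Y : 'I_N -> D -> Xi) (z : D -> 'rV[R]_n) :
  (forall j, measurable_fun setT (Y j)) -> measurable_rV z ->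
  measurable_fun setT (fun w => aseg_backtracks X par (sampled_map T (Y ^~ w)) (z w)).
Proof.
move=> mY mz; apply: measurable_fun_ifT; first exact: measurable_stop.
  exact: measurable_cst.
apply: measurable_first_index => j; rewrite /aseg_accept.
have mhalf := measurable_aseg_half mY mz
  (measurable_cst (as_gamma par * as_rho par ^+ j : R)).
apply: measurable_fun_ler; apply: measurable_funM => //.
  apply: measurable_enorm; apply: measurable_rVB; first exact: measurable_sampled_map.
  exact: measurable_sampled_map.
by apply: measurable_enorm; exact: measurable_rVB.
Qed.

Lemma measurable_step_size N (Y : 'I_N -> D -> Xi) (z : D -> 'rV[R]_n) :
  (forall j, measurable_fun setT (Y j)) -> measurable_rV z ->
  measurable_fun setT (fun w => as_gamma par *
    as_rho par ^+ aseg_backtracks X par (sampled_map T (Y ^~ w)) (z w)).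
Proof.
move=> mY mz.
exact: (measurable_fun_nat_index (f := fun j _ => as_gamma par * as_rho par ^+ j)
  (measurable_aseg_backtracks mY mz)).
Qed.

Lemma measurable_aseg_step N1 N2 (Y1 : 'I_N1 -> D -> Xi) (Y2 : 'I_N2 -> D -> Xi)
    (z : D -> 'rV[R]_n) (th : D -> nat) :
  (forall j, measurable_fun setT (Y1 j)) -> (forall j, measurable_fun setT (Y2 j)) ->
  measurable_rV z -> measurable_fun setT th ->
  let s w := aseg_step X par (sampled_map T (Y1 ^~ w)) (sampled_map T (Y2 ^~ w))
               (z w, th w) in
  measurable_rV (fun w => (s w).1) /\ measurable_fun setT (fun w => (s w).2).
Proof.
move=> mY1 mY2 mz mth s.
pose t w := as_gamma par *
  as_rho par ^+ aseg_backtracks X par (sampled_map T (Y1 ^~ w)) (z w).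
pose yh w := aseg_half X (sampled_map T (Y1 ^~ w)) (z w) (t w).
pose y w := proj X (z w - t w *: sampled_map T (Y2 ^~ w) (yh w)).
pose F w := yh w - z w.
pose F' w := y w - z w.
pose c w := enorm (F' w) < Num.min (enorm (F w)) (as_nu par * (th w)%:R `^ (- as_tau par)).
pose al w := if c w then dotv (F' w) (F' w - F w) / enorm (F' w - F w) ^+ 2
  else as_M par + 1.
have mt : measurable_fun setT t by exact: measurable_step_size.
have myh : measurable_rV yh by exact: measurable_aseg_half.
have my : measurable_rV y.
  apply: measurable_proj; apply: measurable_rVB => //; apply: measurable_rVZ => //.
  exact: measurable_sampled_map.
have mF : measurable_rV F by exact: measurable_rVB.
have mF' : measurable_rV F' by exact: measurable_rVB.
have mc : measurable_fun setT c.
  apply: measurable_fun_ltr; first exact: measurable_enorm.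
  apply: measurable_minr; first exact: measurable_enorm.
  exact: (measurable_fun_nat_index (f := fun j _ => as_nu par * j%:R `^ (- as_tau par)) mth).
have mal : measurable_fun setT al.
  apply: measurable_fun_ifT => //; apply: measurable_funM.
    by apply: measurable_dotv => //; exact: measurable_rVB.
  under eq_fun do rewrite -powR_inv1 ?sqr_ge0//.
  apply: (measurableT_comp (measurable_powR (-1))).
  apply: measurable_funX; apply: measurable_enorm; exact: measurable_rVB.
have mav : measurable_fun setT (fun w => `|al w| <= as_M par).
  by apply: measurable_fun_ler => //; exact: measurableT_comp.
have mstop := measurable_stop mY1 mz.
have sE w : s w = if aseg_half X (sampled_map T (Y1 ^~ w)) (z w) (as_gamma par) - z w == 0
    then (z w, th w)
    else if `|al w| <= as_M par then (al w *: z w + (1 - al w) *: y w, (th w).+1)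
    else (y w, th w) by [].
have s1E : (fun w => (s w).1) = fun w =>
    if aseg_half X (sampled_map T (Y1 ^~ w)) (z w) (as_gamma par) - z w == 0 then z w
    else if `|al w| <= as_M par then al w *: z w + (1 - al w) *: y w else y w.
  by apply/funext => w; rewrite sE; case: ifP => // _; case: ifP.
have s2E : (fun w => (s w).2) = fun w =>
    if aseg_half X (sampled_map T (Y1 ^~ w)) (z w) (as_gamma par) - z w == 0 then th w
    else if `|al w| <= as_M par then (th w).+1 else th w.
  by apply/funext => w; rewrite sE; case: ifP => // _; case: ifP.
rewrite s1E s2E; split.
  apply: measurable_rV_if => //; apply: measurable_rV_if => //.
  apply: measurable_rVD; apply: measurable_rVZ => //.
  exact: measurable_funB.
apply: measurable_fun_ifT => //; apply: measurable_fun_ifT => //.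
exact: (measurable_fun_nat_index (f := fun j _ => j.+1) mth).
Qed.

(** Only the samples drawn before iteration [k] matter, which is what makes the
    iterate independent of the batches of iteration [k]. *)
Lemma measurable_aseg_state (S : nat -> nat) (Y1 Y2 : forall k, 'I_(S k) -> D -> Xi)
    (x0 : 'rV[R]_n) (k : nat) :
  (forall i j, (i < k)%N -> measurable_fun setT (Y1 i j)) ->
  (forall i j, (i < k)%N -> measurable_fun setT (Y2 i j)) ->
  let s w := aseg_state X T par (fun i j => Y1 i j w) (fun i j => Y2 i j w) x0 k in
  measurable_rV (fun w => (s w).1) /\ measurable_fun setT (fun w => (s w).2).
Proof.
elim: k => [|k IH] mY1 mY2 /=.
  by split; [exact: measurable_rV_cst|exact: measurable_cst].
have [|//|m1 m2] := IH.
- by move=> i j ik; apply: mY1; rewrite ltnS ltnW.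
- by move=> i j ik; apply: mY2; rewrite ltnS ltnW.
have [||m1' m2'] := measurable_aseg_step _ _ m1 m2 (Y1 := Y1 k) (Y2 := Y2 k).
- by move=> j; exact: mY1.
- by move=> j; exact: mY2.
split; [move: m1'; congr measurable_rV|move: m2'; congr measurable_fun];
  by apply/funext => w; rewrite -surjective_pairing.
Qed.

End OneDomain.

End MeasurableIterates.
(** * Independence: integration over independent pairs, variance of a batch mean *)

Section Expectations.
Context {d : measure_display} {Omega : measurableType d} {R : realType}.
Variable P : probability Omega R.
Local Open Scope ereal_scope.
Implicit Types f g : Omega -> R.

Lemma ae_expectation_le f g : measurable_fun setT f -> measurable_fun setT g ->
  (forall w, 0 <= f w)%R -> (forall w, 0 <= g w)%R ->
  {ae P, forall w, (f w <= g w)%R} -> 'E_P[f] <= 'E_P[g].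
Proof.
move=> mf mg f0 g0 fg; rewrite unlock; apply: ae_ge0_le_integral => //.
- by move=> w _; rewrite lee_fin.
- exact/measurable_EFinP.
- by move=> w _; rewrite lee_fin.
- exact/measurable_EFinP.
- by apply: filterS fg => w fgw _; rewrite lee_fin.
Qed.

Lemma expectation_le_all f g : measurable_fun setT f -> measurable_fun setT g ->
  (forall w, 0 <= f w)%R -> (forall w, f w <= g w)%R -> 'E_P[f] <= 'E_P[g].
Proof.
move=> mf mg f0 fg; apply: ae_expectation_le => //.
  by move=> w; exact: le_trans (fg w).
exact: aeW.
Qed.

Lemma ge0_expectationD f g : measurable_fun setT f -> measurable_fun setT g ->
  (forall w, 0 <= f w)%R -> (forall w, 0 <= g w)%R ->
  'E_P[fun w => f w + g w]%R = 'E_P[f] + 'E_P[g].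
Proof.
move=> mf mg f0 g0; rewrite unlock.
under eq_integral do rewrite EFinD.
rewrite ge0_integralD//; first by move=> w _; rewrite lee_fin.
- exact/measurable_EFinP.
- by move=> w _; rewrite lee_fin.
- exact/measurable_EFinP.
Qed.

Lemma ge0_expectationZ (c : R) f : measurable_fun setT f ->
  (forall w, 0 <= f w)%R -> (0 <= c)%R -> 'E_P[fun w => c * f w]%R = c%:E * 'E_P[f].
Proof.
move=> mf f0 c0; rewrite unlock; under eq_integral do rewrite EFinM.
rewrite ge0_integralZl_EFin//; first by move=> w _; rewrite lee_fin.
exact/measurable_EFinP.
Qed.

Lemma ge0_expectation_sum (I : Type) (s : seq I) (f : I -> Omega -> R) :
  (forall i, measurable_fun setT (f i)) -> (forall i w, 0 <= f i w)%R ->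
  'E_P[fun w => \sum_(i <- s) f i w]%R = \sum_(i <- s) 'E_P[f i].
Proof.
move=> mf f0; rewrite unlock; under eq_integral do rewrite -sumEFin.
rewrite ge0_integral_sum// => i.
  exact/measurable_EFinP.
by move=> w _; rewrite lee_fin.
Qed.

Lemma expectation_const (c : R) : 'E_P[fun _ : Omega => c] = c%:E.
Proof. exact: expectation_cst. Qed.

End Expectations.

Section IndependentPair.
Context {d d1 d2 : measure_display} {Omega : measurableType d}
  {U : measurableType d1} {V : measurableType d2} {R : realType}.
Variables (P : probability Omega R) (f : {mfun Omega >-> U}) (g : {mfun Omega >-> V}).
Hypothesis indep : forall A B, measurable A -> measurable B ->
  P (f @^-1` A `&` g @^-1` B) = (P (f @^-1` A) * P (g @^-1` B))%E.
Local Open Scope ereal_scope.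

Let fg w := (f w, g w).
Let mfg : measurable_fun setT fg.
Proof. by apply: measurable_fun_pair; exact: measurable_funPT. Qed.

HB.instance Definition _ := isMeasurableFun.Build _ _ _ _ fg mfg.

Lemma distribution_indep_pair A : measurable A ->
  distribution P fg A = (distribution P f \x distribution P g) A.
Proof.
move=> mA; apply/esym; apply: product_measure_unique mA => B C mB mC.
exact: indep.
Qed.

Lemma integral_distribution_pair (h : U * V -> \bar R) : measurable_fun setT h ->
  (forall z, 0 <= h z) ->
  \int[P]_w h (f w, g w) = \int[distribution P f \x distribution P g]_z h z.
Proof.
move=> mh h0.
rewrite -(@eq_measure_integral _ _ _ _ _ (distribution P fg)); last first.
  by move=> A mA _; exact: distribution_indep_pair.
by rewrite ge0_integral_pushforward.
Qed.

Lemma ge0_integral_indep_pair (h : U * V -> \bar R) : measurable_fun setT h ->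
  (forall z, 0 <= h z) ->
  \int[P]_w h (f w, g w) = \int[P]_w1 \int[P]_w2 h (f w1, g w2).
Proof.
move=> mh h0; rewrite integral_distribution_pair// fubini_tonelli1//.
rewrite ge0_integral_pushforward//; last 2 first.
- exact: measurable_fun_fubini_tonelli_F.
- by move=> u _; exact: integral_ge0.
apply: eq_integral => w1 _ /=; rewrite /fubini_F ge0_integral_pushforward//.
exact: measurableT_comp.
Qed.

(** Square integrability makes the product integrable for the product law, where
    Fubini factors its mean. *)
Lemma expectation_indep_mul (phi : U -> R) (psi : V -> R) :
  measurable_fun setT phi -> measurable_fun setT psi ->
  'E_P[fun w => (phi (f w) ^+ 2)%R] < +oo -> 'E_P[fun w => (psi (g w) ^+ 2)%R] < +oo ->
  'E_P[fun w => psi (g w)] = 0 ->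
  P.-integrable setT (fun w => (phi (f w) * psi (g w))%:E) /\
  'E_P[fun w => (phi (f w) * psi (g w))%R] = 0.
Proof.
move=> mphi mpsi phi2 psi2 psi0.
have mphif : measurable_fun setT (fun w => phi (f w)) by exact: measurableT_comp.
have mpsig : measurable_fun setT (fun w => psi (g w)) by exact: measurableT_comp.
have int_fg : P.-integrable setT (fun w => (phi (f w) * psi (g w))%:E).
  apply/integrableP; split; first by apply/measurable_EFinP; exact: measurable_funM.
  have : 'E_P[fun w => (phi (f w) ^+ 2 + psi (g w) ^+ 2)%R] < +oo.
    rewrite ge0_expectationD ?lte_add_pinfty//; try exact: measurable_funX.
    - by move=> w; exact: sqr_ge0.
    - by move=> w; exact: sqr_ge0.
  apply: le_lt_trans; rewrite unlock; apply: ge0_le_integral => //.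
  - by apply/measurable_EFinP; apply: measurableT_comp => //; exact: measurable_funM.
  - by apply/measurable_EFinP; apply: measurable_funD; exact: measurable_funX.
  move=> w _; rewrite abse_EFin lee_fin normrM.
  have := sqr_ge0 (`|phi (f w)| - `|psi (g w)|)%R.
  rewrite sqrrB !real_normK ?num_real// => h.
  have : (0 <= `|phi (f w)| * `|psi (g w)|)%R by rewrite mulr_ge0.
  lra.
split => //.
pose h (z : U * V) := (phi z.1 * psi z.2)%:E.
have mh : measurable_fun setT h.
  apply/measurable_EFinP; apply: measurable_funM.
    by apply: (measurableT_comp mphi); exact: measurable_fst.
  by apply: (measurableT_comp mpsi); exact: measurable_snd.
have int_h : (distribution P f \x distribution P g).-integrable setT h.
  have : (distribution P fg).-integrable setT h by apply: integrable_pushforward.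
  move=> /integrableP[_ hoo]; apply/integrableP; split => //.
  rewrite -(@eq_measure_integral _ _ _ _ _ (distribution P fg))//.
  by move=> A mA _; exact: distribution_indep_pair.
rewrite unlock.
have -> : \int[P]_w (phi (f w) * psi (g w))%:E = \int[distribution P fg]_z h z.
  by rewrite integral_pushforward.
rewrite (@eq_measure_integral _ _ _ _ (distribution P f \x distribution P g)); last first.
  by move=> A mA _; exact: distribution_indep_pair.
rewrite -integral12_prod_meas1//.
rewrite (eq_integral (fun _ => 0)) ?integral0// => u _; rewrite /fubini_F /h /=.
have psi1 : P.-integrable setT ((EFin \o psi) \o g).
  apply/integrableP; split.
    have mE : measurable_fun setT (fun w => (psi (g w))%:E) by exact/measurable_EFinP.
    exact: mE.
  have : 'E_P[fun w => (1 + psi (g w) ^+ 2)%R] < +oo.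
    rewrite ge0_expectationD ?expectation_const ?lte_add_pinfty ?ltry//.
    - exact: measurable_funX.
    - by move=> w; exact: sqr_ge0.
  apply: le_lt_trans; rewrite unlock; apply: ge0_le_integral => //.
  - by apply/measurable_EFinP; exact: measurableT_comp.
  - by apply/measurable_EFinP; apply: measurable_funD => //; exact: measurable_funX.
  move=> w _; rewrite abse_EFin lee_fin.
  have := sqr_ge0 (`|psi (g w)| - 1)%R.
  have := sqr_ge0 (psi (g w)).
  by rewrite sqrrB1 real_normK ?num_real//; lra.
under eq_integral do rewrite EFinM.
rewrite integralZl//; last first.
  by apply: integrable_pushforward => //; exact/measurable_EFinP.
suff -> : \int[distribution P g]_y (psi y)%:E = 0 by rewrite mule0.
rewrite integral_pushforward//; first by move: psi0; rewrite unlock.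
exact/measurable_EFinP.
Qed.

End IndependentPair.
(** * Averages over a batch of independent samples *)

Section BatchMean.
Context {R : realType} {N : nat}.
Hypothesis N_gt0 : (0 < N)%N.

Definition batch_mean (a : 'I_N -> R) : R := N%:R^-1 * \sum_j a j.

Let NR_gt0 : 0 < N%:R :> R. Proof. by rewrite ltr0n. Qed.

Lemma batch_mean_ge0 (a : 'I_N -> R) : (forall j, 0 <= a j) -> 0 <= batch_mean a.
Proof. by move=> a0; rewrite mulr_ge0 ?invr_ge0// sumr_ge0. Qed.

Lemma batch_mean_le (a b : 'I_N -> R) : (forall j, a j <= b j) ->
  batch_mean a <= batch_mean b.
Proof. by move=> ab; rewrite ler_wpM2l ?invr_ge0// ler_sum. Qed.

Lemma batch_mean_cst (c : R) : batch_mean (fun _ => c) = c.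
Proof.
by rewrite /batch_mean sumr_const card_ord -(mulr_natl c) mulrA mulVf ?mul1r// gt_eqF.
Qed.

Lemma batch_meanD (a b : 'I_N -> R) :
  batch_mean (fun j => a j + b j) = batch_mean a + batch_mean b.
Proof. by rewrite /batch_mean big_split mulrDr. Qed.

Lemma batch_meanZ (c : R) (a : 'I_N -> R) :
  batch_mean (fun j => a j * c) = batch_mean a * c.
Proof. by rewrite /batch_mean -mulr_suml mulrA. Qed.

Lemma batch_mean_sqr (a : 'I_N -> R) :
  batch_mean a ^+ 2 <= batch_mean (fun j => a j ^+ 2).
Proof.
set m := batch_mean a.
have : 0 <= batch_mean (fun j => (a j - m) ^+ 2).
  by apply: batch_mean_ge0 => j; exact: sqr_ge0.
have -> : (fun j => (a j - m) ^+ 2) = fun j => (a j ^+ 2 + m ^+ 2) + a j * (- (2 * m)).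
  by apply/funext => j; ring.
by rewrite batch_meanD batch_meanD batch_meanZ batch_mean_cst -/m; lra.
Qed.

(** Jensen for the powers [2 ^ k], by iterating the square. *)
Lemma batch_mean_expn2 (k : nat) (a : 'I_N -> R) : (forall j, 0 <= a j) ->
  batch_mean a ^+ (2 ^ k) <= batch_mean (fun j => a j ^+ (2 ^ k)).
Proof.
elim: k a => [|k IH] a a0.
  by rewrite expn0 expr1 (_ : (fun j => a j ^+ 1) = a)//; apply/funext => j; rewrite expr1.
rewrite expnS exprM.
have -> : (fun j => a j ^+ (2 * 2 ^ k)) = fun j => (a j ^+ 2) ^+ (2 ^ k).
  by apply/funext => j; rewrite exprM.
apply: le_trans (IH (fun j => a j ^+ 2) _); last by move=> j; exact: sqr_ge0.
rewrite lerXn2r ?nnegrE ?sqr_ge0 ?batch_mean_sqr//.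
by apply: batch_mean_ge0 => j; exact: sqr_ge0.
Qed.

End BatchMean.

Section SameLaw.
Context {d d' : measure_display} {Omega : measurableType d} {U : measurableType d'}
  {R : realType}.
Variables (P : probability Omega R) (f g : {mfun Omega >-> U}).
Hypothesis same : forall B, measurable B -> distribution P f B = distribution P g B.
Local Open Scope ereal_scope.

Lemma ge0_integral_same_law (h : U -> \bar R) : measurable_fun setT h ->
  (forall u, 0 <= h u) -> \int[P]_w h (f w) = \int[P]_w h (g w).
Proof.
move=> mh h0.
transitivity (\int[distribution P f]_u h u); first by rewrite ge0_integral_pushforward.
transitivity (\int[distribution P g]_u h u); last by rewrite ge0_integral_pushforward.
by apply: eq_measure_integral => A mA _; exact: same.
Qed.

Lemma expectation_same_law (phi : U -> R) : measurable_fun setT phi ->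
  'E_P[fun w => phi (f w)] = 'E_P[fun w => phi (g w)].
Proof.
move=> mphi; rewrite unlock integralE [RHS]integralE.
have mE : measurable_fun setT (EFin \o phi) by exact/measurable_EFinP.
congr (_ - _).
  have := @ge0_integral_same_law (EFin \o phi)^\+ (measurable_funepos mE) (funepos_ge0 _).
  by move=> h; congr (_ = _): h; apply: eq_integral => w _; rewrite !funeposE.
have := @ge0_integral_same_law (EFin \o phi)^\- (measurable_funeneg mE) (funeneg_ge0 _).
by move=> h; congr (_ = _): h; apply: eq_integral => w _; rewrite !funenegE.
Qed.

Lemma ae_same_law (p : U -> Prop) : {ae distribution P g, forall u, p u} ->
  {ae P, forall w, p (f w)}.
Proof.
move=> [A [mA A0 pA]]; exists (f @^-1` A); split.
- by rewrite -[X in measurable X]setTI; exact: measurable_funPT.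
- by have := same mA; rewrite A0.
- by move=> w /= npw; exact: pA.
Qed.

End SameLaw.

Section IidBatch.
Context {d d' : measure_display} {Omega : measurableType d} {Xi : measurableType d'}
  {R : realType}.
Variables (P : probability Omega R) (xi : {mfun Omega >-> Xi}) (N : nat)
  (Y : 'I_N -> {mfun Omega >-> Xi}).
Hypotheses (N_gt0 : (0 < N)%N) (Y_iid : iid_as P xi Y).
Local Open Scope ereal_scope.

Lemma iid_law j B : measurable B -> distribution P (Y j) B = distribution P xi B.
Proof. by move=> mB; have [+ _] := Y_iid; exact. Qed.

Lemma iid_indep (j k : 'I_N) : j != k -> forall A B, measurable A -> measurable B ->
  P (Y j @^-1` A `&` Y k @^-1` B) = P (Y j @^-1` A) * P (Y k @^-1` B).
Proof.
move=> jk A B mA mB; have [_ prodP] := Y_iid.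
pose C i := if i == j then A else if i == k then B else setT.
have mC i : measurable (C i) by rewrite /C; case: ifP => // _; case: ifP.
have kj : k != j by rewrite eq_sym.
have Cj : C j = A by rewrite /C eqxx.
have Ck : C k = B by rewrite /C (negbTE kj) eqxx.
have := prodP C mC.
have -> : \bigcap_(i in [set: 'I_N]) (Y i @^-1` C i) = Y j @^-1` A `&` Y k @^-1` B.
  apply/seteqP; split=> [w h|w [/= Aw Bw] i _].
    by split; [have := h j I; rewrite /= Cj|have := h k I; rewrite /= Ck].
  by rewrite /= /C; case: eqP => [->//|_]; case: eqP => [->|].
move=> ->; rewrite (bigD1 j)//= Cj (bigD1 k)//= Ck big1 ?mule1// => i /andP[ij ik].
by rewrite /C (negbTE ij) (negbTE ik) preimage_setT probability_setT.
Qed.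

Lemma expectation_batch_mean (phi : Xi -> R) : measurable_fun setT phi ->
  (forall v, 0 <= phi v)%R ->
  'E_P[fun w => batch_mean (fun j => phi (Y j w))] = 'E_P[fun w => phi (xi w)].
Proof.
move=> mphi phi0.
have mY j : measurable_fun setT (fun w => phi (Y j w)) by exact: measurableT_comp.
rewrite ge0_expectationZ ?invr_ge0//; last 2 first.
- by apply: measurable_sum.
- by move=> w; apply: sumr_ge0.
rewrite ge0_expectation_sum// (eq_bigr (fun _ => 'E_P[fun w => phi (xi w)])); last first.
  by move=> j _; apply: expectation_same_law => // B mB; exact: iid_law.
have : 0 <= 'E_P[fun w => phi (xi w)] by apply: expectation_ge0.
case: ('E_P[_]) => [r| |]// r0.
  rewrite sumEFin sumr_const card_ord -EFinM -(mulr_natl r) mulrA mulVf ?mul1r//.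
  by rewrite pnatr_eq0 -lt0n.
case: N N_gt0 => // N' _; rewrite big_ord_recl addye; last first.
  by rewrite gt_eqF// (lt_le_trans ltNy0)// sume_ge0.
by rewrite gt0_muley// lte_fin invr_gt0.
Qed.

Lemma variance_batch_sum (phi : Xi -> R) : measurable_fun setT phi ->
  'E_P[fun w => (phi (xi w) ^+ 2)%R] < +oo -> 'E_P[fun w => phi (xi w)] = 0 ->
  'E_P[fun w => ((\sum_j phi (Y j w)) ^+ 2)%R] =
    N%:R%:E * 'E_P[fun w => (phi (xi w) ^+ 2)%R].
Proof.
move=> mphi phi2 phi0.
have mphi2 : measurable_fun setT (fun v => phi v ^+ 2)%R by exact: measurable_funX.
have mY j : measurable_fun setT (fun w => phi (Y j w)) by exact: measurableT_comp.
have Y2 j : 'E_P[fun w => (phi (Y j w) ^+ 2)%R] = 'E_P[fun w => (phi (xi w) ^+ 2)%R].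
  by apply: (expectation_same_law (iid_law j) mphi2).
have Y0 j : 'E_P[fun w => phi (Y j w)] = 0.
  by rewrite (expectation_same_law (iid_law j) mphi).
have cross j k : P.-integrable setT (fun w => (phi (Y j w) * phi (Y k w))%:E) /\
    'E_P[fun w => (phi (Y j w) * phi (Y k w))%R] =
      if j == k then 'E_P[fun w => (phi (xi w) ^+ 2)%R] else 0.
  case: eqVneq => [<-|jk].
    split; last by rewrite -(Y2 j); under [in RHS]eq_fun do rewrite expr2.
    apply/integrableP; split; first by apply/measurable_EFinP; exact: measurable_funM.
    have : 'E_P[fun w => (phi (Y j w) ^+ 2)%R] < +oo by rewrite Y2.
    rewrite unlock; congr (_ < _); apply: eq_integral => w _.
    by rewrite abse_EFin -expr2 ger0_norm// sqr_ge0.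
  by apply: (expectation_indep_mul (iid_indep jk)); rewrite ?Y2 ?Y0.
transitivity (\sum_(j < N) \sum_(k < N) 'E_P[fun w => (phi (Y j w) * phi (Y k w))%R]).
  rewrite unlock; under eq_integral.
    move=> w _; rewrite expr2 mulr_suml -sumEFin.
    under eq_bigr do rewrite mulr_sumr -sumEFin.
    over.
  rewrite integral_sum//; last first.
    by move=> j; apply: integrable_sum => // k _; have [] := cross j k.
  by apply: eq_bigr => j _; rewrite integral_sum// => k; have [] := cross j k.
under eq_bigr => j _.
  rewrite (bigD1 j)//= (cross j j).2 eqxx big1 ?adde0; last first.
    by move=> k kj; rewrite (cross j k).2 eq_sym (negbTE kj).
  over.
have : 0 <= 'E_P[fun w => (phi (xi w) ^+ 2)%R] by apply: expectation_ge0 => w; exact: sqr_ge0.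
move: phi2; case: ('E_P[_]) => [r| |]// _ _.
by rewrite sumEFin sumr_const card_ord -EFinM -(mulr_natl r).
Qed.

Lemma ae_batch (p : Xi -> Prop) : {ae distribution P xi, forall v, p v} ->
  {ae P, forall w, forall j, p (Y j w)}.
Proof.
move=> p_ae.
have : \forall w \ae P, forall j, j \in [set: 'I_N] -> p (Y j w).
  apply: filter_forall => j; apply: filterS (ae_same_law (iid_law j) p_ae) => w pw _.
  exact: pw.
by apply: filterS => w h j; apply: h; rewrite inE.
Qed.

End IidBatch.

Section Freezing.
Context {d d' : measure_display} {Omega : measurableType d} {Xi : measurableType d'}
  {R : realType} {n : nat}.
Variables (P : probability Omega R) (N : nat) (Y : 'I_N -> {mfun Omega >-> Xi}).

(** The sample space with only the events of the batch. *)
Definition batch_space := g_sigma_algebraType (batch_events Y).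

Lemma batch_sigma_measurable B : batch_sigma Y B -> measurable B.
Proof.
apply: smallest_sub; first exact: sigma_algebra_measurable.
by move=> C [j _ [D mD <-]]; exact: measurable_funPT.
Qed.

Lemma measurable_to_batch_space : measurable_fun setT (id : Omega -> batch_space).
Proof. by move=> _ B mB; rewrite setTI; exact: batch_sigma_measurable. Qed.

Lemma measurable_batch_sample j : measurable_fun setT (Y j : batch_space -> Xi).
Proof.
move=> _ B mB; apply: sub_sigma_algebra; exists j => //.
by exists B.
Qed.

Variable Z : Omega -> 'rV[R]_n.
Hypothesis Z_meas : measurable_rV Z.
Hypothesis Z_indep : forall (A : set (borel_rV R n)) B, measurable A -> batch_sigma Y B ->
  P (Z @^-1` A `&` B) = (P (Z @^-1` A) * P B)%E.
Local Open Scope ereal_scope.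

(** Freezing: an estimate that holds for the batch at every fixed point [z]
    may be integrated over an independent random point [Z]. *)
Lemma expectation_freeze (phi : 'rV[R]_n -> Omega -> R) (b : 'rV[R]_n -> R) :
  measurable_fun setT (fun u : borel_rV R n * batch_space => phi u.1 u.2) ->
  (forall z w, 0 <= phi z w)%R -> (forall z, 0 <= b z)%R ->
  measurable_fun setT (fun w => b (Z w)) ->
  (forall z, 'E_P[phi z] <= (b z)%:E) ->
  'E_P[fun w => phi (Z w) w] <= 'E_P[fun w => b (Z w)].
Proof.
move=> mphi phi0 b0 mb phi_b.
have mZ : measurable_fun setT (Z : Omega -> borel_rV R n) by exact/measurable_rVP.
pose Zm : {mfun Omega >-> borel_rV R n} :=
  MeasurableFun.Pack (MeasurableFun.Class (isMeasurableFun.Build _ _ _ _ _ mZ)).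
pose Im : {mfun Omega >-> batch_space} := MeasurableFun.Pack
  (MeasurableFun.Class (isMeasurableFun.Build _ _ _ _ _ measurable_to_batch_space)).
have ZI : forall A B, measurable A -> measurable B ->
    P (Zm @^-1` A `&` Im @^-1` B) = P (Zm @^-1` A) * P (Im @^-1` B).
  by move=> A B mA mB; exact: Z_indep.
pose h (u : borel_rV R n * batch_space) := (phi u.1 u.2)%:E.
have mh : measurable_fun setT h by exact/measurable_EFinP.
have h0 u : 0 <= h u by rewrite lee_fin.
have := ge0_integral_indep_pair ZI mh h0; rewrite {1}/h /= => E1.
rewrite unlock E1; apply: ge0_le_integral => //.
- by move=> w _; apply: integral_ge0.
- have -> : (fun w1 => \int[P]_w2 h (Z w1, w2)) =
      (fubini_F (distribution P Im) h) \o Zm.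
    apply/funext => w1 /=; rewrite /fubini_F ge0_integral_pushforward//.
    exact: measurableT_comp.
  apply: measurableT_comp => //; exact: measurable_fun_fubini_tonelli_F.
- exact/measurable_EFinP.
- by move=> w _; have := phi_b (Z w); rewrite unlock.
Qed.

End Freezing.
(** * Moments of the sampling error *)

Section SampledField.
Context {d d' : measure_display} {Omega : measurableType d} {Xi : measurableType d'}
  {R : realType} {n : nat}.
Variables (P : probability Omega R) (xi : {mfun Omega >-> Xi}).
Variables (T : Xi -> 'rV[R]_n -> 'rV[R]_n) (H : 'rV[R]_n -> 'rV[R]_n) (xs : 'rV[R]_n).
Hypothesis T_meas : measurable_fun [set: Xi * borel_rV R n]
  (fun z : Xi * borel_rV R n => T z.1 z.2 : borel_rV R n).
Hypothesis H_cont : continuous H.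
Hypothesis T_mean : forall x i, ('E_P[fun w => ((T (xi w) x - H x) 0 i)%R] = 0)%E.
(** Linear growth of the sampling error: [U] collects the Lipschitz constants,
    [V] the error at the reference point [xs]. *)
Variables (U V : Xi -> R) (K : R).
Hypotheses (U_meas : measurable_fun setT U) (V_meas : measurable_fun setT V)
  (U_ge1 : forall v, 1 <= U v) (V_ge0 : forall v, 0 <= V v) (K_ge1 : 1 <= K)
  (U_moment : ('E_P[fun w => (U (xi w) ^+ 8)%R] <= K%:E)%E)
  (V_moment : ('E_P[fun w => (V (xi w) ^+ 4)%R] <= K%:E)%E)
  (growth : {ae distribution P xi, forall v, forall x,
     enorm (T v x - H x) <= U v * enorm (x - xs) + V v}).

Let U_ge0 v : 0 <= U v. Proof. exact: le_trans (U_ge1 v). Qed.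
Let K_ge0 : 0 <= K. Proof. exact: le_trans K_ge1. Qed.

Lemma expectation_affine_le (f g : Omega -> R) (a b c F G : R) :
  measurable_fun setT f -> measurable_fun setT g ->
  (forall w, 0 <= f w) -> (forall w, 0 <= g w) -> 0 <= a -> 0 <= b -> 0 <= c ->
  ('E_P[f] <= F%:E)%E -> ('E_P[g] <= G%:E)%E ->
  ('E_P[fun w => (a * f w + b * g w + c)%R] <= (a * F + b * G + c)%:E)%E.
Proof.
move=> mf mg f0 g0 a0 b0 c0 fF gG.
have mcf : measurable_fun setT (fun w => a * f w) by exact: measurable_funM.
have mcg : measurable_fun setT (fun w => b * g w) by exact: measurable_funM.
have cf0 w : 0 <= a * f w by exact: mulr_ge0.
have cg0 w : 0 <= b * g w by exact: mulr_ge0.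
rewrite ge0_expectationD//; first last.
- by move=> w; rewrite addr_ge0.
- exact: measurable_funD.
rewrite ge0_expectationD// ge0_expectationZ// ge0_expectationZ// expectation_const.
by rewrite !EFinD !EFinM !leeD// lee_wpmul2l.
Qed.

Let measurable_error d'' (W : measurableType d'') (Yj : W -> Xi) (z : W -> 'rV[R]_n) :
  measurable_fun setT Yj -> measurable_rV z ->
  measurable_rV (fun w => T (Yj w) (z w) - H (z w)).
Proof.
by move=> mY mz; apply: measurable_rVB; [exact: measurable_T|exact: measurable_rV_comp].
Qed.

Lemma field_second_moment x :
  ('E_P[fun w => (enorm (T (xi w) x - H x) ^+ 2)%R]
     <= (4 * K * (1 + enorm (x - xs) ^+ 2))%:E)%E.
Proof.
set rho := enorm (x - xs); have rho0 : 0 <= rho by exact: enorm_ge0.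
have mU : measurable_fun setT (fun w => U (xi w) ^+ 8).
  by apply: measurable_funX; exact: measurableT_comp.
have mV : measurable_fun setT (fun w => V (xi w) ^+ 4).
  by apply: measurable_funX; exact: measurableT_comp.
have U8 w : 0 <= U (xi w) ^+ 8 by rewrite exprn_ge0.
have V4 w : 0 <= V (xi w) ^+ 4 by rewrite exprn_ge0.
have rho2 : 0 <= rho ^+ 2 by exact: sqr_ge0.
apply: (@le_trans _ _ (2 * rho ^+ 2 * K + 2 * K + 2)%:E); last first.
  rewrite lee_fin; move: (rho ^+ 2) rho2 => r r0; have := mulr_ge0 K_ge0 r0; by have := K_ge1; lra.
apply: le_trans (expectation_affine_le mU mV U8 V4 _ _ _ U_moment V_moment) => //;
  last by rewrite mulr_ge0.
apply: ae_expectation_le.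
- apply: measurable_funX; apply: measurable_enorm.
  apply: measurable_error => //; exact: measurable_rV_cst.
- by apply: measurable_funD => //; apply: measurable_funD; exact: measurable_funM.
- by move=> w; exact: sqr_ge0.
- by move=> w; rewrite !addr_ge0// mulr_ge0// mulr_ge0.
apply: filterS (ae_same_law (fun B _ => erefl) growth) => w /(_ x) gw.
apply: (@le_trans _ _ ((U (xi w) * rho + V (xi w)) ^+ 2)).
  by rewrite ler_pXn2r ?nnegrE ?enorm_ge0// (le_trans (enorm_ge0 _) gw).
have U28 : U (xi w) ^+ 2 <= U (xi w) ^+ 8 by rewrite ler_weXn2l.
have V24 : V (xi w) ^+ 2 <= 1 + V (xi w) ^+ 4.
  have -> : V (xi w) ^+ 4 = (V (xi w) ^+ 2) ^+ 2 by rewrite -exprM.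
  have := sqr_ge0 (V (xi w)); have := sqr_ge0 (V (xi w) ^+ 2 - 1).
  by move: (V (xi w) ^+ 2) => q; lra.
have := sqr_ge0 (U (xi w) * rho - V (xi w)).
have := ler_wpM2r rho2 U28; move: V24.
by move: (U (xi w) ^+ 8) (V (xi w) ^+ 4) => u8 v4; lra.
Qed.

Section Batch.
Variables (N : nat) (Y : 'I_N -> {mfun Omega >-> Xi}).
Hypotheses (N_gt0 : (0 < N)%N) (Y_iid : iid_as P xi Y).

Local Notation G w := (sampled_map T (fun j => Y j w)).
Local Notation eps := (Num.sqrt (N%:R : R))^-1.

Let NR_gt0 : 0 < N%:R :> R. Proof. by rewrite ltr0n. Qed.

Lemma sampled_map_error w x :
  G w x - H x = N%:R^-1 *: \sum_(j < N) (T (Y j w) x - H x).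
Proof.
rewrite /sampled_map sumrB sumr_const card_ord scalerBr; congr (_ - _).
by rewrite -(scaler_nat N (H x)) scalerA mulVf ?scale1r// gt_eqF.
Qed.

Lemma eps_sqr : eps ^+ 2 = N%:R^-1 :> R.
Proof. by rewrite exprVn sqr_sqrtr// ltW. Qed.

Lemma eps_gt0 : 0 < eps :> R.
Proof. by rewrite invr_gt0 sqrtr_gt0. Qed.

Let mT (x : 'rV[R]_n) i : measurable_fun setT (fun v => (T v x - H x) 0 i).
Proof. by apply: measurable_error => //; exact: measurable_rV_cst. Qed.

Let mY j : measurable_fun setT (Y j : Omega -> Xi). Proof. exact: measurable_funPT. Qed.

Let measurable_G_error (x : 'rV[R]_n) : measurable_rV (fun w => G w x - H x).
Proof.
apply: measurable_rVB; last exact: measurable_rV_cst.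
apply: (measurable_sampled_map T_meas (Y := fun j => Y j : Omega -> Xi)) => //.
Qed.

Lemma batch_second_moment x :
  ('E_P[fun w => (enorm (G w x - H x) ^+ 2)%R]
     <= (eps ^+ 2 * (4 * K * (1 + enorm (x - xs) ^+ 2)))%:E)%E.
Proof.
pose phi i v := (T v x - H x) 0 i.
have mphi i : measurable_fun setT (phi i) by exact: mT.
have sqE w : enorm (G w x - H x) ^+ 2 =
    \sum_(i < n) N%:R^-1 ^+ 2 * (\sum_(j < N) phi i (Y j w)) ^+ 2.
  rewrite enorm_sqr /dotv; apply: eq_bigr => i _.
  by rewrite -expr2 sampled_map_error mxE summxE exprMn.
have sum_phi2 v : \sum_(i < n) phi i v ^+ 2 = enorm (T v x - H x) ^+ 2.
  by rewrite enorm_sqr /dotv; apply: eq_bigr => i _; rewrite expr2.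
have msum i : measurable_fun setT (fun w => \sum_(j < N) phi i (Y j w)).
  by apply: measurable_sum => j; exact: measurableT_comp.
have sumE : (\sum_(i < n) 'E_P[fun w => (phi i (xi w) ^+ 2)%R] =
    'E_P[fun w => (enorm (T (xi w) x - H x) ^+ 2)%R])%E.
  rewrite -ge0_expectation_sum; first by under eq_fun do rewrite sum_phi2.
    by move=> i; apply: measurable_funX; exact: measurableT_comp.
  by move=> i w; exact: sqr_ge0.
have phi2 i : ('E_P[fun w => (phi i (xi w) ^+ 2)%R] < +oo)%E.
  apply: (@le_lt_trans _ _ ('E_P[fun w => (enorm (T (xi w) x - H x) ^+ 2)%R])%E).
    rewrite -sumE (bigD1 i)//= leeDl// sume_ge0// => k _.
    by apply: expectation_ge0 => w; exact: sqr_ge0.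
  by rewrite (le_lt_trans (field_second_moment x))// ltry.
under eq_fun do rewrite sqE.
rewrite ge0_expectation_sum; first last.
- by move=> i w; rewrite mulr_ge0 ?sqr_ge0.
- by move=> i; apply: measurable_funM => //; exact: measurable_funX.
under eq_bigr => i _.
  rewrite ge0_expectationZ ?sqr_ge0//; last 2 first.
  - exact: measurable_funX.
  - by move=> w; exact: sqr_ge0.
  rewrite (variance_batch_sum Y_iid (mphi i) (phi2 i) (T_mean x i)) muleA -EFinM.
  over.
rewrite -ge0_sume_distrr; last first.
  by move=> i _; apply: expectation_ge0 => w; exact: sqr_ge0.
have -> : N%:R^-1 ^+ 2 * N%:R = N%:R^-1 :> R.
  by rewrite expr2 -mulrA mulVf ?mulr1// gt_eqF.
rewrite sumE eps_sqr EFinM.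
by rewrite lee_wpmul2l ?lee_fin ?invr_ge0 ?(ltW NR_gt0)// field_second_moment.
Qed.

(** The weight and the error are correlated. The inequality of arithmetic and
    geometric means splits off the variance, of order [eps ^ 2], from a high
    moment that is merely bounded; this costs half of the rate. *)
Lemma batch_weighted_moment x :
  ('E_P[fun w => ((batch_mean (fun j => U (Y j w)) * enorm (G w x - H x)) ^+ 2)%R]
     <= (eps * (3 * K * (1 + enorm (x - xs) ^+ 2)))%:E)%E.
Proof.
set rho := enorm (x - xs); have rho0 : 0 <= rho by exact: enorm_ge0.
have rho2 : 0 <= rho ^+ 2 by exact: sqr_ge0.
have e0 := eps_gt0.
set e := eps in e0 *.
pose M8 w := batch_mean (fun j => U (Y j w) ^+ 8).
pose M4 w := batch_mean (fun j => V (Y j w) ^+ 4).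
pose D2 w := enorm (G w x - H x) ^+ 2.
have mU8 : measurable_fun setT (fun v => U v ^+ 8) by exact: measurable_funX.
have mV4 : measurable_fun setT (fun v => V v ^+ 4) by exact: measurable_funX.
have mM8 : measurable_fun setT M8.
  apply: measurable_funM => //; apply: measurable_sum => j.
  exact: (measurableT_comp mU8 (mY j)).
have mM4 : measurable_fun setT M4.
  apply: measurable_funM => //; apply: measurable_sum => j.
  exact: (measurableT_comp mV4 (mY j)).
have mD2 : measurable_fun setT D2 by apply: measurable_funX; exact: measurable_enorm.
have M80 w : 0 <= M8 w by apply: batch_mean_ge0 => // j; rewrite exprn_ge0.
have M40 w : 0 <= M4 w by apply: batch_mean_ge0 => // j; rewrite exprn_ge0.
have D20 w : 0 <= D2 w by exact: sqr_ge0.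
have EM8 : ('E_P[M8] <= K%:E)%E.
  by rewrite /M8 (expectation_batch_mean N_gt0 Y_iid mU8)// => v; rewrite exprn_ge0.
have EM4 : ('E_P[M4] <= K%:E)%E.
  by rewrite /M4 (expectation_batch_mean N_gt0 Y_iid mV4)// => v; rewrite exprn_ge0.
pose Q w := e * (2 * rho ^+ 2 + 1) / 2 * M8 w + e / 2 * M4 w + 0.
have mQ : measurable_fun setT Q.
  by apply: measurable_funD => //; apply: measurable_funD; exact: measurable_funM.
have c80 : 0 <= e * (2 * rho ^+ 2 + 1) / 2.
  by rewrite divr_ge0// mulr_ge0 ?(ltW e0)// addr_ge0// mulr_ge0.
have c40 : 0 <= e / 2 by rewrite divr_ge0// ltW.
have Q0 w : 0 <= Q w by rewrite /Q addr0 addr_ge0// mulr_ge0.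
have EQ := expectation_affine_le mM8 mM4 M80 M40 c80 c40 (lexx 0) EM8 EM4.
apply: (@le_trans _ _ ('E_P[fun w => ((2 * e)^-1 * D2 w + 1 * Q w + 0)%R])%E).
  apply: ae_expectation_le.
  - apply: measurable_funX; apply: measurable_funM; last exact: measurable_enorm.
    apply: measurable_funM => //; apply: measurable_sum => j.
    exact: (measurableT_comp U_meas (mY j)).
  - by apply: measurable_funD => //; apply: measurable_funD; exact: measurable_funM.
  - by move=> w; exact: sqr_ge0.
  - by move=> w; rewrite addr0 addr_ge0 ?mul1r// mulr_ge0// invr_ge0 mulr_ge0// ltW.
  apply: filterS (ae_batch Y_iid growth) => w gw.
  set u := batch_mean _; set D := enorm _.
  have u1 : 1 <= u.
    by rewrite -[leLHS](batch_mean_cst N_gt0 1) batch_mean_le.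
  have u0 : 0 <= u by exact: le_trans u1.
  pose v := batch_mean (fun j => V (Y j w)).
  have v0 : 0 <= v by exact: batch_mean_ge0.
  have D_le : D <= u * rho + v.
    rewrite /D sampled_map_error enormZ ger0_norm ?invr_ge0 ?(ltW NR_gt0)//.
    have -> : u * rho + v = batch_mean (fun j => U (Y j w) * rho + V (Y j w)).
      by rewrite batch_meanD batch_meanZ.
    rewrite ler_wpM2l ?invr_ge0 ?(ltW NR_gt0)//.
    apply: (le_trans (_ : _ <= \sum_(j < N) enorm (T (Y j w) x - H x))).
      elim/big_rec2 : _ => [|j p q _ IH]; first by rewrite enorm0.
      by rewrite (le_trans (ler_enormD _ _))// lerD2l.
    by apply: ler_sum => j _; exact: gw.
  have u8 : u ^+ 8 <= M8 w by exact: (batch_mean_expn2 N_gt0 3).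
  have v4 : v ^+ 4 <= M4 w by exact: (batch_mean_expn2 N_gt0 2).
  have D0 : 0 <= D by exact: enorm_ge0.
  have D2_le : D ^+ 2 <= 2 * (u ^+ 2 * rho ^+ 2) + 2 * v ^+ 2.
    apply: (@le_trans _ _ ((u * rho + v) ^+ 2)).
      by rewrite ler_pXn2r ?nnegrE ?D0 ?(addr_ge0 (mulr_ge0 u0 rho0) v0).
    by have := sqr_ge0 (u * rho - v); lra.
  have u48 : u ^+ 6 <= u ^+ 8 by rewrite ler_weXn2l.
  have u4D : u ^+ 4 * D ^+ 2 <= 2 * rho ^+ 2 * M8 w + M8 w + M4 w.
    have h1 := ler_wpM2l (exprn_ge0 4 u0) D2_le.
    have h2 := ler_wpM2r rho2 (le_trans u48 u8).
    have h3 := sqr_ge0 (u ^+ 4 - v ^+ 2).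
    have e1 : u ^+ 4 * (2 * (u ^+ 2 * rho ^+ 2) + 2 * v ^+ 2) =
        2 * (u ^+ 6 * rho ^+ 2) + 2 * (u ^+ 4 * v ^+ 2) by ring.
    have e2 : (u ^+ 4 - v ^+ 2) ^+ 2 = u ^+ 8 + v ^+ 4 - 2 * (u ^+ 4 * v ^+ 2) by ring.
    by move: h1 h2 h3 u8 v4; rewrite e1 e2; lra.
  have amgm : (u * D) ^+ 2 <= (2 * e)^-1 * D ^+ 2 + e / 2 * (u ^+ 4 * D ^+ 2).
    rewrite -subr_ge0.
    have -> : (2 * e)^-1 * D ^+ 2 + e / 2 * (u ^+ 4 * D ^+ 2) - (u * D) ^+ 2 =
       (2 * e)^-1 * (D - e * u ^+ 2 * D) ^+ 2 by field; rewrite gt_eqF.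
    by rewrite mulr_ge0 ?sqr_ge0// invr_ge0 mulr_ge0// ltW.
  apply: (le_trans amgm); rewrite /D2 -/D mul1r !addr0 lerD2l /Q addr0.
  apply: (le_trans (ler_wpM2l c40 u4D)).
  by rewrite le_eqVlt; apply/orP; left; apply/eqP; field.
have h1 : 0 <= (2 * e)^-1 by rewrite invr_ge0 mulr_ge0// ltW.
apply: le_trans (expectation_affine_le mD2 mQ D20 Q0 h1 ler01 (lexx 0)
  (batch_second_moment x) EQ) _.
rewrite lee_fin -/e -/rho.
have -> : (2 * e)^-1 * (e ^+ 2 * (4 * K * (1 + rho ^+ 2))) = e * (2 * K * (1 + rho ^+ 2)).
  by field; rewrite gt_eqF.
have := mulr_ge0 (ltW e0) K_ge0; lra.
Qed.

Section RandomPoint.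
Variable Z : Omega -> 'rV[R]_n.
Hypothesis Z_meas : measurable_rV Z.
Hypothesis Z_indep : forall (A : set (borel_rV R n)) B, measurable A -> batch_sigma Y B ->
  P (Z @^-1` A `&` B) = (P (Z @^-1` A) * P B)%E.

Local Notation D := (borel_rV R n * batch_space Y)%type.

Let mfstD : measurable_rV (fun u : D => u.1 : 'rV[R]_n).
Proof. by apply/measurable_rVP; exact: measurable_fst. Qed.

Let mYD j : measurable_fun setT (fun u : D => Y j u.2).
Proof.
apply: (@measurableT_comp _ _ _ _ _ _ (Y j : batch_space Y -> Xi) _
  (snd : D -> batch_space Y)).
  exact: measurable_batch_sample.
exact: measurable_snd.
Qed.

Let merrorD : measurable_rV (fun u : D => G u.2 u.1 - H u.1).
Proof.
apply: measurable_rVB; last exact: measurable_rV_comp.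
exact: (measurable_sampled_map T_meas (Y := fun j (u : D) => Y j u.2)).
Qed.

Let measurable_dist2 : measurable_fun setT (fun w => enorm (Z w - xs) ^+ 2).
Proof.
apply: measurable_funX; apply: measurable_enorm.
by apply: measurable_rVB => //; exact: measurable_rV_cst.
Qed.

Lemma expectation_sampling_error :
  ('E_P[fun w => (enorm (G w (Z w) - H (Z w)) ^+ 2)%R]
     <= 'E_P[fun w => (eps ^+ 2 * (4 * K * (1 + enorm (Z w - xs) ^+ 2)))%R])%E.
Proof.
apply: (expectation_freeze Z_meas Z_indep
  (phi := fun z w => enorm (G w z - H z) ^+ 2)
  (b := fun z => eps ^+ 2 * (4 * K * (1 + enorm (z - xs) ^+ 2)))).
- by apply: measurable_funX; exact: measurable_enorm.
- by move=> z w; exact: sqr_ge0.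
- by move=> z; rewrite !mulr_ge0 ?addr_ge0 ?sqr_ge0.
- do 2 apply: measurable_funM => //.
  exact: measurable_funD.
- exact: batch_second_moment.
Qed.

Lemma expectation_weighted_error :
  ('E_P[fun w => ((batch_mean (fun j => U (Y j w)) * enorm (G w (Z w) - H (Z w))) ^+ 2)%R]
     <= 'E_P[fun w => (eps * (3 * K * (1 + enorm (Z w - xs) ^+ 2)))%R])%E.
Proof.
apply: (expectation_freeze Z_meas Z_indep
  (phi := fun z w => (batch_mean (fun j => U (Y j w)) * enorm (G w z - H z)) ^+ 2)
  (b := fun z => eps * (3 * K * (1 + enorm (z - xs) ^+ 2)))).
- apply: measurable_funX; apply: measurable_funM; last exact: measurable_enorm.
  by apply: measurable_funM => //; apply: measurable_sum => j; exact: measurableT_comp.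
- by move=> z w; exact: sqr_ge0.
- by move=> z; rewrite !mulr_ge0 ?addr_ge0 ?sqr_ge0// ltW// eps_gt0.
- do 2 apply: measurable_funM => //.
  exact: measurable_funD.
- exact: batch_weighted_moment.
Qed.

Lemma expectation_batch_mean_mul (L : Xi -> R) (l : R) (r : 'rV[R]_n -> R) :
  measurable_fun setT L -> (forall v, 0 <= L v) -> ('E_P[fun w => L (xi w)] <= l%:E)%E ->
  0 <= l -> measurable_fun [set: borel_rV R n] (r : borel_rV R n -> R) ->
  (forall z, 0 <= r z) ->
  ('E_P[fun w => (batch_mean (fun j => L (Y j w)) * r (Z w))%R]
     <= 'E_P[fun w => (l * r (Z w))%R])%E.
Proof.
move=> mL L0 Ll l0 mr r0.
have mrZ : measurable_fun setT (fun w => r (Z w)).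
  by apply: (measurableT_comp mr); exact/measurable_rVP.
apply: (expectation_freeze Z_meas Z_indep
  (phi := fun z w => batch_mean (fun j => L (Y j w)) * r z) (b := fun z => l * r z)).
- apply: measurable_funM; last by apply: (measurableT_comp mr); exact: measurable_fst.
  by apply: measurable_funM => //; apply: measurable_sum => j; exact: measurableT_comp.
- by move=> z w; rewrite mulr_ge0// batch_mean_ge0.
- by move=> z; rewrite mulr_ge0.
- exact: measurable_funM.
move=> z; under eq_fun do rewrite mulrC.
rewrite ge0_expectationZ//; last 2 first.
- apply: measurable_funM => //; apply: measurable_sum => j.
  exact: (measurableT_comp mL (mY j)).
- by move=> w; rewrite batch_mean_ge0.
by rewrite (expectation_batch_mean N_gt0 Y_iid mL)// mulrC EFinM lee_wpmul2l// lee_fin.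
Qed.

End RandomPoint.
End Batch.
End SampledField.
(** * The mean operator *)

Section MeanOperator.
Context {d d' : measure_display} {Omega : measurableType d} {Xi : measurableType d'}
  {R : realType} {n : nat}.
Variables (P : probability Omega R) (xi : {mfun Omega >-> Xi}).
Variables (T : Xi -> 'rV[R]_n -> 'rV[R]_n) (H : 'rV[R]_n -> 'rV[R]_n).
Hypothesis T_meas : measurable_fun [set: Xi * borel_rV R n]
  (fun z : Xi * borel_rV R n => T z.1 z.2 : borel_rV R n).
Hypothesis H_def : forall x, H x = \row_(i < n) fine 'E_P[(fun w => T (xi w) x 0%R i)]%E.
Variable L : Xi -> R.
Hypotheses (L_meas : measurable_fun setT L) (L_ge1 : forall v, 1 <= L v)
  (T_lip : {ae distribution P xi, forall v, forall x y,
     enorm (T v x - T v y) <= L v * enorm (x - y)})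
  (L_moment : ('E_P[fun w => (L (xi w) ^+ 8)%R] < +oo)%E)
  (T_moment : exists xc, ('E_P[fun w => (enorm (T (xi w) xc) ^+ 4)%R] < +oo)%E).

Let L_ge0 v : 0 <= L v. Proof. exact: le_trans (L_ge1 v). Qed.
Let mL : measurable_fun setT (fun w => L (xi w)). Proof. exact: measurableT_comp. Qed.
Let mL8 : measurable_fun setT (fun w => L (xi w) ^+ 8).
Proof. exact: measurable_funX. Qed.
Let L8_ge0 w : 0 <= L (xi w) ^+ 8. Proof. exact: exprn_ge0. Qed.

Let mTx x : measurable_rV (fun w => T (xi w) x).
Proof. by apply: (measurable_T T_meas) => //; exact: measurable_rV_cst. Qed.

Let mTx4 x : measurable_fun setT (fun w => enorm (T (xi w) x) ^+ 4).
Proof. by apply: measurable_funX; exact: measurable_enorm. Qed.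

Let T_lip_ae : {ae P, forall w, forall x y,
  enorm (T (xi w) x - T (xi w) y) <= L (xi w) * enorm (x - y)}.
Proof. exact: (ae_same_law (fun B _ => erefl) T_lip). Qed.

Lemma finite_expectation_le (f : Omega -> R) : (forall w, 0 <= f w) ->
  ('E_P[f] < +oo)%E -> exists2 F : R, 0 <= F & ('E_P[f] <= F%:E)%E.
Proof.
move=> f0 foo; have f00 := expectation_ge0 P f0.
exists (fine 'E_P[f]%E); first exact: fine_ge0.
by rewrite fineK// ge0_fin_numE.
Qed.

Lemma expr4D_le (a b : R) : (a + b) ^+ 4 <= 8 * a ^+ 4 + 8 * b ^+ 4.
Proof.
have e4 (c : R) : c ^+ 4 = (c ^+ 2) ^+ 2 by rewrite -exprM.
have h1 : (a + b) ^+ 2 <= 2 * a ^+ 2 + 2 * b ^+ 2 by have := sqr_ge0 (a - b); lra.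
have h2 : ((a + b) ^+ 2) ^+ 2 <= (2 * a ^+ 2 + 2 * b ^+ 2) ^+ 2.
  by rewrite ler_pXn2r ?nnegrE ?sqr_ge0// (le_trans (sqr_ge0 _) h1).
rewrite !e4; apply: (le_trans h2); have := sqr_ge0 (a ^+ 2 - b ^+ 2).
by move: (a ^+ 2) (b ^+ 2) => p q; lra.
Qed.

Lemma ler_1_expr4 (t : R) : t <= 1 + t ^+ 4.
Proof.
have -> : t ^+ 4 = (t ^+ 2) ^+ 2 by rewrite -exprM.
have := sqr_ge0 (t - 1); have := sqr_ge0 (t ^+ 2 - 1); have := sqr_ge0 (t ^+ 2).
by rewrite (sqrrB1 t); move: (t ^+ 2) => q; lra.
Qed.

(** The moment at one point is carried to every other point by the Lipschitz
    bound. *)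
Lemma T_moment4 x : ('E_P[fun w => (enorm (T (xi w) x) ^+ 4)%R] < +oo)%E.
Proof.
have [xc Tc] := T_moment.
have Tc0 w : 0 <= enorm (T (xi w) xc) ^+ 4 by rewrite exprn_ge0// enorm_ge0.
have [F F0 TF] := finite_expectation_le Tc0 Tc.
have [G G0 LG] := finite_expectation_le L8_ge0 L_moment.
have c0 : 0 <= 8 * enorm (x - xc) ^+ 4 by rewrite mulr_ge0// exprn_ge0// enorm_ge0.
apply: (@le_lt_trans _ _ (8 * F + 8 * enorm (x - xc) ^+ 4 * G + 0)%:E); last exact: ltry.
apply: le_trans (expectation_affine_le (mTx4 xc) mL8 Tc0 L8_ge0 _ c0 _ TF LG) => //.
apply: ae_expectation_le.
- exact: mTx4.
- by apply: measurable_funD => //; apply: measurable_funD; exact: measurable_funM.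
- by move=> w; rewrite exprn_ge0// enorm_ge0.
- by move=> w; rewrite addr0 addr_ge0// mulr_ge0.
apply: filterS T_lip_ae => w /(_ x xc) lip; rewrite addr0.
apply: (@le_trans _ _ ((enorm (T (xi w) xc) + L (xi w) * enorm (x - xc)) ^+ 4)).
  rewrite ler_pXn2r ?nnegrE ?enorm_ge0 ?addr_ge0 ?mulr_ge0 ?enorm_ge0//.
  have := ler_enorm_dist (T (xi w) xc) (T (xi w) x) 0; rewrite !subr0.
  by move/le_trans; apply; rewrite addrC lerD2l.
apply: (le_trans (expr4D_le _ _)); rewrite lerD2l exprMn (mulrC (L _ ^+ 4)) mulrA.
by rewrite ler_wpM2l// ler_weXn2l.
Qed.

Lemma integrable_T x i : P.-integrable setT (fun w => (T (xi w) x 0 i)%:E).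
Proof.
apply/integrableP; split; first by apply/measurable_EFinP; exact: mTx.
have : ('E_P[fun w => (1 + enorm (T (xi w) x) ^+ 4)%R] < +oo)%E.
  rewrite ge0_expectationD ?expectation_const ?lte_add_pinfty ?ltry ?T_moment4//.
  by move=> w; rewrite exprn_ge0// enorm_ge0.
apply: le_lt_trans; rewrite unlock; apply: ge0_le_integral => //.
- by apply/measurable_EFinP; apply: measurableT_comp => //; exact: mTx.
- by apply/measurable_EFinP; exact: measurable_funD.
move=> w _; rewrite abse_EFin lee_fin.
exact: le_trans (ler_coord_enorm _ _) (ler_1_expr4 _).
Qed.

Lemma mean_coord x i : (H x 0 i)%:E = (\int[P]_w (T (xi w) x 0 i)%:E)%E.
Proof.
rewrite H_def mxE unlock fineK//; exact: integrable_fin_num (integrable_T x i).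
Qed.

Lemma T_centered x i : ('E_P[fun w => ((T (xi w) x - H x) 0 i)%R] = 0)%E.
Proof.
rewrite unlock; under eq_integral do rewrite !mxE EFinB.
rewrite integralB_EFin//; last 2 first.
- exact: integrable_T.
- exact: finite_measure_integrable_cst.
by have := expectation_const P (H x 0 i); rewrite unlock -mean_coord => ->; rewrite subee.
Qed.

Lemma L_mean_finite : ('E_P[fun w => L (xi w)] < +oo)%E.
Proof.
apply: le_lt_trans L_moment; apply: expectation_le_all => // w.
by rewrite -[leLHS]expr1 ler_weXn2l.
Qed.

(** The mean of the Lipschitz constants bounds each coordinate; summing the
    coordinates costs the dimension, and [n.+1] keeps [l >= 1] when [n = 0]. *)
Lemma mean_operator_lipschitz : exists l : R,
  [/\ 1 <= l, ('E_P[fun w => L (xi w)] <= l%:E)%E &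
      forall x y, enorm (H x - H y) <= l * enorm (x - y)].
Proof.
have [l1 l10 Ll1] := finite_expectation_le (fun w => L_ge0 (xi w)) L_mean_finite.
have l1_ge1 : 1 <= l1.
  rewrite -lee_fin; apply: le_trans Ll1; rewrite -(expectation_const P 1).
  by apply: expectation_le_all.
exists (n.+1%:R * l1); split.
- by rewrite -[leLHS]mulr1 ler_pM// ler1n.
- by apply: (le_trans Ll1); rewrite lee_fin ler_peMl// ler1n.
move=> x y; apply: (le_trans (ler_enorm_sum _)).
apply: (@le_trans _ _ (\sum_(i < n) l1 * enorm (x - y))); last first.
  rewrite sumr_const card_ord -(mulr_natl (_ * _)) mulrA ler_wpM2r ?enorm_ge0//.
  by rewrite ler_wpM2r// ler_nat.
apply: ler_sum => i _; rewrite -lee_fin -abse_EFin !mxE EFinB !mean_coord.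
rewrite -integralB_EFin//; try exact: integrable_T.
have mB : measurable_fun setT (fun w => (T (xi w) x 0 i)%:E - (T (xi w) y 0 i)%:E)%E.
  apply: emeasurable_funB; apply/measurable_EFinP; exact: mTx.
apply: (le_trans (le_abse_integral _ _ _)) => //.
rewrite mulrC EFinM.
apply: (@le_trans _ _ ((enorm (x - y))%:E * 'E_P[fun w => L (xi w)])%E); last first.
  by rewrite lee_wpmul2l// lee_fin enorm_ge0.
rewrite -ge0_expectationZ ?enorm_ge0// unlock.
apply: ae_ge0_le_integral => //.
- exact: measurableT_comp.
- by move=> w _; rewrite lee_fin mulr_ge0 ?enorm_ge0.
- by apply/measurable_EFinP; exact: measurable_funM.
apply: filterS T_lip_ae => w /(_ x y) lip _.
rewrite -EFinB abse_EFin lee_fin mulrC; apply: le_trans lip.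
by have := ler_coord_enorm (T (xi w) x - T (xi w) y) i; rewrite !mxE.
Qed.

Section Growth.
Variables (l : R) (xs : 'rV[R]_n).
Hypotheses (l_ge1 : 1 <= l)
  (H_lip : forall x y, enorm (H x - H y) <= l * enorm (x - y)).

Definition growth_slope v := L v + l.
Definition growth_const v := enorm (T v xs) + enorm (H xs).

Lemma sampling_error_growth : {ae distribution P xi, forall v, forall x,
  enorm (T v x - H x) <= growth_slope v * enorm (x - xs) + growth_const v}.
Proof.
apply: filterS T_lip => v lip x; rewrite /growth_slope /growth_const mulrDl.
have := lip x xs; have := H_lip xs x; rewrite (enormB xs x).
have := ler_enorm_dist (T v xs) (T v x) (H x).
have := ler_enorm_dist (H xs) (T v xs) (H x).
have := ler_enormB (T v xs) (H xs); lra.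
Qed.

Lemma growth_slope_meas : measurable_fun setT growth_slope.
Proof. exact: measurable_funD. Qed.

Lemma growth_const_meas : measurable_fun setT growth_const.
Proof.
apply: measurable_funD => //; apply: measurable_enorm.
by apply: (measurable_T T_meas) => //; exact: measurable_rV_cst.
Qed.

Lemma growth_slope_ge1 v : 1 <= growth_slope v.
Proof. by rewrite /growth_slope (le_trans (L_ge1 v))// lerDl (le_trans _ l_ge1). Qed.

Lemma growth_const_ge0 v : 0 <= growth_const v.
Proof. by rewrite addr_ge0 ?enorm_ge0. Qed.

Lemma growth_moments : exists K : R, [/\ 1 <= K,
  ('E_P[fun w => (growth_slope (xi w) ^+ 8)%R] <= K%:E)%E &
  ('E_P[fun w => (growth_const (xi w) ^+ 4)%R] <= K%:E)%E].
Proof.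
have l0 : 0 <= l by exact: le_trans l_ge1.
have T0 w : 0 <= enorm (T (xi w) xs) ^+ 4 by rewrite exprn_ge0// enorm_ge0.
have [F F0 TF] := finite_expectation_le T0 (T_moment4 xs).
have [G G0 LG] := finite_expectation_le L8_ge0 L_moment.
have mU : measurable_fun setT (fun w => growth_slope (xi w) ^+ 8).
  by apply: measurable_funX; exact: (measurableT_comp growth_slope_meas).
have mV : measurable_fun setT (fun w => growth_const (xi w) ^+ 4).
  by apply: measurable_funX; exact: (measurableT_comp growth_const_meas).
have c1 : 0 <= (2 * l) ^+ 8 by rewrite exprn_ge0// mulr_ge0.
have c2 : 0 <= 8 * enorm (H xs) ^+ 4 by rewrite mulr_ge0// exprn_ge0// enorm_ge0.
pose K1 := (2 * l) ^+ 8 * G; pose K2 := 8 * F + 0 * G + 8 * enorm (H xs) ^+ 4.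
have K10 : 0 <= K1 by exact: mulr_ge0.
have K20 : 0 <= K2 by rewrite /K2 mul0r addr0 addr_ge0// mulr_ge0.
exists (1 + K1 + K2); split.
- by rewrite -addrA lerDl addr_ge0.
- apply: (@le_trans _ _ K1%:E); last by rewrite lee_fin; move: K1 K2 K10 K20 => ? ?; lra.
  rewrite /K1 EFinM.
  apply: (@le_trans _ _ (((2 * l) ^+ 8)%:E * 'E_P[fun w => (L (xi w) ^+ 8)%R])%E); last first.
    by rewrite lee_wpmul2l// lee_fin.
  rewrite -ge0_expectationZ//; apply: expectation_le_all => //.
  + exact: measurable_funM.
  + by move=> w; rewrite exprn_ge0// (le_trans _ (growth_slope_ge1 _)).
  move=> w; rewrite -exprMn ler_pXn2r ?nnegrE//; last 2 first.
  + by rewrite (le_trans _ (growth_slope_ge1 _)).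
  + by rewrite !mulr_ge0.
  rewrite /growth_slope.
  have h1 := ler_peMr (L_ge0 (xi w)) l_ge1; have h2 := ler_peMr l0 (L_ge1 (xi w)).
  by move: h1 h2; lra.
- apply: (@le_trans _ _ K2%:E); last by rewrite lee_fin; move: K1 K2 K10 K20 => ? ?; lra.
  apply: le_trans (expectation_affine_le (mTx4 xs) mL8 T0 L8_ge0 _ (lexx 0) c2 TF LG) => //.
  apply: expectation_le_all => //.
  + by apply: measurable_funD => //; apply: measurable_funD; exact: measurable_funM.
  + by move=> w; rewrite exprn_ge0// growth_const_ge0.
  by move=> w; rewrite mul0r addr0 expr4D_le.
Qed.

End Growth.
End MeanOperator.
(** * Randomly selected variables *)

Section RandomSelection.
Context {d : measure_display} {Omega : measurableType d} {R : realType}.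
Variable P : probability Omega R.

Lemma geometric_sum_le (q : R) (N : nat) : 0 <= q < 1 ->
  \sum_(0 <= m < N) q ^+ m <= (1 - q)^-1.
Proof.
move=> /andP[q0 q1]; have q1' : 0 < 1 - q by rewrite subr_gt0.
have -> : \sum_(0 <= m < N) q ^+ m = (1 - q ^+ N) / (1 - q).
  apply: (canRL (mulfK _)); first by rewrite gt_eqF.
  elim: N => [|N IH]; first by rewrite big_geq// mul0r expr0 subrr.
  by rewrite big_nat_recr//= mulrDl IH exprS; ring.
by rewrite -[leRHS]mul1r ler_wpM2r ?invr_ge0 ?(ltW q1')// gerBl exprn_ge0.
Qed.

(** A random choice among countably many variables is dominated by their sum. *)
Lemma expectation_select_le (f : nat -> Omega -> R) (k : Omega -> nat) (g : Omega -> R)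
    (c q : R) : 0 <= c -> 0 <= q < 1 ->
  (forall m, measurable_fun setT (f m)) -> (forall m w, 0 <= f m w) ->
  (forall m, ('E_P[f m] <= (q ^+ m * c)%:E)%E) ->
  measurable_fun setT g -> (forall w, 0 <= g w) -> (forall w, g w <= f (k w) w) ->
  ('E_P[g] <= (c / (1 - q))%:E)%E.
Proof.
move=> c0 q01 mf f0 fq mg g0 gf.
have fE0 m w : (0 <= (f m w)%:E)%E by rewrite lee_fin.
have mfE m : measurable_fun setT (EFin \o f m) by exact/measurable_EFinP.
apply: (@le_trans _ _ (\int[P]_w (\sum_(m <oo) (f m w)%:E))%E).
  rewrite unlock; apply: ge0_le_integral => //.
  - by move=> w _; rewrite lee_fin.
  - exact/measurable_EFinP.
  - by apply: ge0_emeasurable_sum => [m w _ _|m _] //; exact: mfE.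
  move=> w _; apply: (@le_trans _ _ (\sum_(0 <= m < (k w).+1) (f m w)%:E)%E).
    rewrite big_nat_recr//=; apply: (@le_trans _ _ (f (k w) w)%:E).
      by rewrite lee_fin.
    by rewrite leeDr// sume_ge0.
  exact: nneseries_lim_ge.
rewrite integral_nneseries//.
apply: lime_le; first by apply: is_cvg_nneseries => m _ _; exact: integral_ge0.
apply: nearW => N.
apply: (@le_trans _ _ (\sum_(0 <= m < N) (q ^+ m * c)%:E)%E).
  apply: lee_sum => m _; have := fq m; by rewrite unlock.
rewrite sumEFin lee_fin -mulr_suml mulrC ler_wpM2l//.
exact: geometric_sum_le.
Qed.

Lemma expectation_sum4_le (f1 f2 f3 f4 : Omega -> R) (a b F1 F2 F3 F4 : R) :
  measurable_fun setT f1 -> measurable_fun setT f2 ->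
  measurable_fun setT f3 -> measurable_fun setT f4 ->
  (forall w, 0 <= f1 w) -> (forall w, 0 <= f2 w) ->
  (forall w, 0 <= f3 w) -> (forall w, 0 <= f4 w) -> 0 <= a -> 0 <= b ->
  ('E_P[f1] <= F1%:E)%E -> ('E_P[f2] <= F2%:E)%E ->
  ('E_P[f3] <= F3%:E)%E -> ('E_P[f4] <= F4%:E)%E ->
  ('E_P[fun w => ((f1 w + f2 w) + (a * f3 w + b * f4 w))%R]
     <= ((F1 + F2) + (a * F3 + b * F4))%:E)%E.
Proof.
move=> m1 m2 m3 m4 p1 p2 p3 p4 a0 b0 e1 e2 e3 e4.
have ma : measurable_fun setT (fun w => a * f3 w) by exact: measurable_funM.
have mb : measurable_fun setT (fun w => b * f4 w) by exact: measurable_funM.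
have pa w : 0 <= a * f3 w by exact: mulr_ge0.
have pb w : 0 <= b * f4 w by exact: mulr_ge0.
rewrite (ge0_expectationD P (measurable_funD m1 m2) (measurable_funD ma mb));
  [|by move=> w; rewrite addr_ge0..].
rewrite !ge0_expectationD// !ge0_expectationZ// !EFinD !EFinM.
by rewrite !leeD// lee_wpmul2l.
Qed.

End RandomSelection.

Section Convergence.
Context {d d' : measure_display} {Omega : measurableType d} {Xi : measurableType d'}
  {R : realType} {n : nat}.
Variables (P : probability Omega R) (xi : {mfun Omega >-> Xi}).
Variables (X : set 'rV[R]_n) (T : Xi -> 'rV[R]_n -> 'rV[R]_n) (H : 'rV[R]_n -> 'rV[R]_n).
Hypotheses (X_closed : closed X) (X_convex : convex_set X).
Hypothesis T_meas : measurable_fun [set: Xi * borel_rV R n]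
  (fun z : Xi * borel_rV R n => T z.1 z.2 : borel_rV R n).
Variables (L : Xi -> R) (l : R) (xsol : 'rV[R]_n) (K : R).
Hypotheses (L_meas : measurable_fun setT L) (L_ge1 : forall v, 1 <= L v)
  (T_lip : {ae distribution P xi, forall v, forall x y,
     enorm (T v x - T v y) <= L v * enorm (x - y)})
  (l_ge1 : 1 <= l) (L_mean : ('E_P[fun w => L (xi w)] <= l%:E)%E)
  (H_lip : forall u v, enorm (H u - H v) <= l * enorm (u - v))
  (T_mean : forall x i, ('E_P[fun w => ((T (xi w) x - H x) 0 i)%R] = 0)%E)
  (K_ge1 : 1 <= K)
  (U_moment : ('E_P[fun w => (growth_slope L l (xi w) ^+ 8)%R] <= K%:E)%E)
  (V_moment : ('E_P[fun w => (growth_const T H xsol (xi w) ^+ 4)%R] <= K%:E)%E)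
  (xsol_sol : SOL X H xsol) (H_pm : pseudomonotone X H).
Variables (S : nat -> nat) (smp es : sample_array S {mfun Omega >-> Xi}).
Local Arguments smp : clear implicits.
Local Arguments es : clear implicits.
Hypotheses (S_gt0 : forall k, (0 < S k)%N) (samples : sampling_scheme P xi smp es).
Variable par : aseg_params R.
Local Notation nu := (as_nu par).
Local Notation gamma := (as_gamma par).
Local Notation rho := (as_rho par).
Local Notation mu := (as_mu par).
Local Notation tau := (as_tau par).
Local Notation M := (as_M par).
Hypotheses (nu_ge0 : 0 <= nu) (gamma_range : 0 < gamma <= 1)
  (rho_range : 0 < rho < 1) (mu_range : 0 < mu < Num.sqrt 3 / 3) (M_gt0 : 0 < M).
Variable B : nat -> R.
Hypotheses (B_ge0 : forall th, 0 <= B th) (B_step : forall th, (0 < th)%N ->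
  B th.+1 + (th%:R `^ (- tau)) ^+ 2 <= B th).
Variable x0 : 'rV[R]_n.

Let X_ne : X !=set0. Proof. by case: xsol_sol => Xx _; exists xsol. Qed.
Let gamma_gt0 : 0 < gamma. Proof. by case/andP: gamma_range. Qed.
Let l_gt0 : 0 < l. Proof. exact: lt_le_trans l_ge1. Qed.
Let K_gt0 : 0 < K. Proof. exact: lt_le_trans K_ge1. Qed.
Let L_ge0 v : 0 <= L v. Proof. exact: le_trans (L_ge1 v). Qed.
Let H_cont : continuous H. Proof. exact: lipschitz_continuous (ltW l_gt0) H_lip. Qed.

Definition state k w := aseg_state X T par (fun i j => smp i j w) (fun i j => es i j w) x0 k.
Local Notation x k w := (state k w).1.
Local Notation Gxi k w := (sampled_map T (fun j => smp k j w)).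
Local Notation Geta k w := (sampled_map T (fun j => es k j w)).
Definition step_size k w := gamma * rho ^+ aseg_backtracks X par (Gxi k w) (x k w).
Definition half_point k w := aseg_half X (Gxi k w) (x k w) (step_size k w).
Local Notation t := step_size.
Local Notation z := half_point.
Definition mean_half s (u : 'rV[R]_n) := proj X (u - s *: H u).
Local Notation Lk k w := (batch_mean (fun j => L (smp k j w))).
Local Notation eps k := (Num.sqrt ((S k)%:R : R))^-1.
Local Notation r2 u := (residual X H gamma u ^+ 2).

(** * Measurability and independence of the iterates *)

Definition history_events (p q : nat) : set_system Omega :=
  \bigcup_(k in `I_p) batch_events (smp k) `|` \bigcup_(k in `I_q) batch_events (es k).

Let D p q := g_sigma_algebraType (history_events p q).

Let smp_hist p q i j : (i < p)%N -> measurable_fun setT (smp i j : D p q -> Xi).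
Proof.
move=> ip _ C mC; apply: sub_sigma_algebra; left; exists i => //; exists j => //.
by exists C.
Qed.

Let es_hist p q i j : (i < q)%N -> measurable_fun setT (es i j : D p q -> Xi).
Proof.
move=> iq _ C mC; apply: sub_sigma_algebra; right; exists i => //; exists j => //.
by exists C.
Qed.

Let x_hist k : measurable_rV (fun w : D k k => x k w).
Proof.
have [|| //] := @measurable_aseg_state _ _ _ _ X par X_closed X_convex X_ne T T_meas
  _ (D k k) S (fun i j => smp i j) (fun i j => es i j) x0 k.
- by move=> i j ik; exact: smp_hist.
- by move=> i j ik; exact: es_hist.
Qed.

Let z_hist k : measurable_rV (fun w : D k.+1 k => z k w).
Proof.
have mx : measurable_rV (fun w : D k.+1 k => x k w).
  have [|| //] := @measurable_aseg_state _ _ _ _ X par X_closed X_convex X_ne T T_meas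
    _ (D k.+1 k) S (fun i j => smp i j) (fun i j => es i j) x0 k.
  - by move=> i j ik; apply: smp_hist; rewrite ltnS ltnW.
  - by move=> i j ik; exact: es_hist.
have my j : measurable_fun setT (smp k j : D k.+1 k -> Xi) by exact: smp_hist.
have mt := measurable_step_size par X_closed X_convex X_ne T_meas my mx.
exact: (measurable_aseg_half X_closed X_convex X_ne T_meas my mx mt).
Qed.

Lemma measurable_state k : measurable_rV (fun w => x k w) /\
  measurable_fun setT (fun w => (state k w).2).
Proof.
apply: (@measurable_aseg_state _ _ _ _ X par X_closed X_convex X_ne T T_meas
  _ Omega S (fun i j => smp i j) (fun i j => es i j) x0 k) => i j _;
  exact: measurable_funPT.
Qed.

Let mx k : measurable_rV (fun w => x k w). Proof. by have [] := measurable_state k. Qed.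

Let msmp k j : measurable_fun setT (smp k j : Omega -> Xi).
Proof. exact: measurable_funPT. Qed.

Let mt k : measurable_fun setT (t k).
Proof. by have := measurable_step_size par X_closed X_convex X_ne T_meas (@msmp k) (mx k). Qed.

Let mz k : measurable_rV (z k).
Proof.
exact: (measurable_aseg_half X_closed X_convex X_ne T_meas (@msmp k) (mx k) (mt k)).
Qed.

Let indep_hist_xi k (g : 'rV[R]_n -> 'rV[R]_n) : continuous g ->
  forall (A : set (borel_rV R n)) C, measurable A -> batch_sigma (smp k) C ->
  P ((fun w => g (x k w)) @^-1` A `&` C) = (P ((fun w => g (x k w)) @^-1` A) * P C)%E.
Proof.
move=> g_cont A C mA hC; have [_ _ _ ind _] := samples k.
rewrite setIC muleC; apply: ind => //.
have /measurable_rVP mg := measurable_rV_comp g_cont (x_hist (k := k)).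
by have := mg measurableT A mA; rewrite setTI.
Qed.

Let indep_hist_eta k (A : set (borel_rV R n)) C : measurable A -> batch_sigma (es k) C ->
  P (z k @^-1` A `&` C) = (P (z k @^-1` A) * P C)%E.
Proof.
move=> mA hC; have [_ _ _ _ ind] := samples k.
rewrite setIC muleC; apply: ind => //.
have /measurable_rVP mg := z_hist (k := k).
by have := mg measurableT A mA; rewrite setTI.
Qed.

(** * Expected size of the error terms *)

Let growth := sampling_error_growth T_lip xsol H_lip.
Let mU := growth_slope_meas L_meas l.
Let mV := growth_const_meas H T_meas xsol.
Let U1 := growth_slope_ge1 L_ge1 l_ge1.
Let V0 := growth_const_ge0 T H xsol.
Let smp_iid k : iid_as P xi (smp k). Proof. by have [] := samples k. Qed.
Let es_iid k : iid_as P xi (es k). Proof. by have [] := samples k. Qed.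

Lemma eps_range k : 0 < eps k <= 1.
Proof.
have s1 : 1 <= Num.sqrt ((S k)%:R : R).
  by rewrite -[leLHS](sqrtr1 R) ler_wsqrtr// ler1n.
by rewrite eps_gt0//= invf_le1// (lt_le_trans _ s1).
Qed.

Let eps_pos k : 0 < eps k. Proof. by case/andP: (eps_range k). Qed.
Let eps_le1 k : eps k <= 1. Proof. by case/andP: (eps_range k). Qed.

Let mdist2 (u : Omega -> 'rV[R]_n) : measurable_rV u ->
  measurable_fun setT (fun w => enorm (u w - xsol) ^+ 2).
Proof.
move=> mu; apply: measurable_funX; apply: measurable_enorm.
by apply: measurable_rVB => //; exact: measurable_rV_cst.
Qed.

Let expectation_dist_le (u : Omega -> 'rV[R]_n) (a b v : R) : measurable_rV u ->
  0 <= a -> 0 <= b -> ('E_P[fun w => (enorm (u w - xsol) ^+ 2)%R] <= v%:E)%E ->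
  ('E_P[fun w => (a * (b * (1 + enorm (u w - xsol) ^+ 2)))%R] <= (a * (b * (1 + v)))%:E)%E.
Proof.
move=> mu a0 b0 uv.
have := expectation_affine_le (mdist2 mu) (mdist2 mu) (fun w => sqr_ge0 _)
  (fun w => sqr_ge0 _) (mulr_ge0 a0 b0) (lexx 0) (mulr_ge0 a0 b0) uv uv.
congr (_ <= _)%E; last by congr (_%:E); ring.
by congr expectation; apply/funext => w; ring.
Qed.

Let mG k (Y : 'I_(S k) -> {mfun Omega >-> Xi}) (u : Omega -> 'rV[R]_n) :
  measurable_rV u ->
  measurable_rV (fun w => sampled_map T (fun j => Y j w) (u w) - H (u w)).
Proof.
move=> mu; apply: measurable_rVB; last exact: measurable_rV_comp.
by apply: (measurable_sampled_map T_meas (Y := fun j => Y j : Omega -> Xi)).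
Qed.

Lemma measurable_residual_sqr :
  measurable_fun [set: borel_rV R n] (fun u : borel_rV R n => r2 (u : 'rV[R]_n)).
Proof.
apply: measurable_funX; apply: measurable_enorm.
have mid := @measurable_rV_id R n.
apply: measurable_rVB => //.
apply: (measurable_proj X_closed X_convex X_ne); apply: measurable_rVB => //.
by apply: measurable_rVZ => //; exact: measurable_rV_comp.
Qed.

Let mr2 k : measurable_fun setT (fun w => r2 (x k w)).
Proof. by apply: (measurableT_comp measurable_residual_sqr); exact/measurable_rVP. Qed.

Section Iteration.
Variables (k : nat) (v : R).
Hypotheses (v_ge0 : 0 <= v)
  (xv : ('E_P[fun w => (enorm (x k w - xsol) ^+ 2)%R] <= v%:E)%E).

Definition error_xi w := ((Lk k w + l) * enorm (Gxi k w (x k w) - H (x k w))) ^+ 2.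
Definition error_half w := (t k w * enorm (Gxi k w (mean_half (t k w) (x k w))
  - H (mean_half (t k w) (x k w)))) ^+ 2.
Definition error_eta w := enorm (Geta k w (z k w) - H (z k w)) ^+ 2.
Definition dist_half w := enorm (z k w - xsol) ^+ 2.

(** [growth_slope] was chosen so that its batch mean is the weight [Lk + l]. *)
Lemma expectation_error_xi : ('E_P[error_xi] <= (eps k * (3 * K * (1 + v)))%:E)%E.
Proof.
apply: le_trans (expectation_dist_le (mx k) (ltW (eps_pos k)) _ xv); last first.
  by rewrite mulr_ge0// ltW.
have := expectation_weighted_error T_meas H_cont T_mean mU mV U1 V0 K_ge1 U_moment
  V_moment growth (S_gt0 k) (smp_iid k) (mx k)
  (indep_hist_xi (g := idfun) (fun u => @cvg_id _ (nbhs u))).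
congr (_ <= _)%E; congr expectation; apply/funext => w.
by rewrite /error_xi batch_meanD batch_mean_cst.
Qed.

Lemma mean_half_continuous s : continuous (mean_half s).
Proof.
have s0 : 0 <= 1 + `|s| * l by rewrite addr_ge0// mulr_ge0// ltW.
apply: (lipschitz_continuous s0) => u y.
apply: (le_trans (proj_nonexpansive X_closed X_convex X_ne _ _)).
have -> : u - s *: H u - (y - s *: H y) = (u - y) - s *: (H u - H y).
  by apply/rowP => i; rewrite !mxE; ring.
apply: (le_trans (ler_enormB _ _)); rewrite enormZ.
by have := ler_wpM2l (normr_ge0 s) (H_lip u y); lra.
Qed.

Definition half_bound (v : R) := 2 * ((1 + l) ^+ 2 * v + enorm (H xsol) ^+ 2).

(** The step size is correlated with the batch, but it takes only the values
    [gamma * rho ^+ m]. For each [m] the point is independent of the batch, and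
    the squared step size makes the series over [m] geometric. *)
Lemma expectation_error_half :
  ('E_P[error_half] <= (eps k * (4 * K * (1 + half_bound v)) / (1 - rho ^+ 2))%:E)%E.
Proof.
have /andP[rho0 rho1] := rho_range.
have hb0 : 0 <= half_bound v by rewrite /half_bound mulr_ge0// addr_ge0// ?sqr_ge0// mulr_ge0// sqr_ge0.
pose f m w := (gamma * rho ^+ m) ^+ 2 *
  enorm (Gxi k w (mean_half (gamma * rho ^+ m) (x k w))
         - H (mean_half (gamma * rho ^+ m) (x k w))) ^+ 2.
have mh m : measurable_rV (fun w => mean_half (gamma * rho ^+ m) (x k w)).
  exact: measurable_rV_comp (@mean_half_continuous _) (mx k).
apply: (@expectation_select_le _ _ _ P f
  (fun w => aseg_backtracks X par (Gxi k w) (x k w))).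
- by rewrite mulr_ge0 ?(ltW (eps_pos k))// !mulr_ge0 ?(ltW K_gt0)// addr_ge0.
- by rewrite sqr_ge0/= expr_lt1// ltW.
- move=> m; apply: measurable_funM => //; apply: measurable_funX.
  by apply: measurable_enorm; exact: mG.
- by move=> m w; rewrite mulr_ge0 ?sqr_ge0.
- move=> m; rewrite ge0_expectationZ ?sqr_ge0//; last 2 first.
  + by apply: measurable_funX; apply: measurable_enorm; exact: mG.
  + by move=> w; exact: sqr_ge0.
  have hv : ('E_P[fun w => (enorm (mean_half (gamma * rho ^+ m) (x k w) - xsol) ^+ 2)%R]
      <= (half_bound v)%:E)%E.
    have a0 : 0 <= 2 * (1 + l) ^+ 2 by rewrite mulr_ge0 ?sqr_ge0.
    have b0 : 0 <= 2 * enorm (H xsol) ^+ 2 by rewrite mulr_ge0 ?sqr_ge0.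
    have := expectation_affine_le (mdist2 (mx k)) (mdist2 (mx k)) (fun w => sqr_ge0 _)
      (fun w => sqr_ge0 _) a0 (lexx 0) b0 xv xv.
    have -> : 2 * (1 + l) ^+ 2 * v + 0 * v + 2 * enorm (H xsol) ^+ 2 = half_bound v.
      by rewrite /half_bound; ring.
    apply: le_trans; apply: expectation_le_all => //.
    + exact: mdist2.
    + apply: measurable_funD => //; apply: measurable_funD; apply: measurable_funM => //;
        exact: mdist2 (mx k).
    + by move=> w; exact: sqr_ge0.
    move=> w; have := mean_half_step_dist X_closed X_convex gamma_range rho_range H_lip
      xsol_sol m (x k w).
    by rewrite /mean_half; lra.
  have step2 : (gamma * rho ^+ m) ^+ 2 <= (rho ^+ 2) ^+ m.
    rewrite exprMn -!exprM mulnC ler_piMl ?exprn_ge0 ?(ltW rho0)//.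
    by rewrite expr_le1 ?(ltW gamma_gt0)//; case/andP: gamma_range.
  have err := expectation_sampling_error T_meas H_cont T_mean mU mV U1 V0 K_ge1 U_moment
    V_moment growth (S_gt0 k) (smp_iid k) (mh m) (indep_hist_xi (@mean_half_continuous _)).
  have K4 : 0 <= 4 * K by rewrite mulr_ge0// ltW.
  have {err} := le_trans err (expectation_dist_le (mh m) (sqr_ge0 _) K4 hv).
  set E := expectation _ _ => Ele.
  have E0 : (0 <= E)%E by apply: expectation_ge0 => w; exact: sqr_ge0.
  have Ele' : (E <= (eps k * (4 * K * (1 + half_bound v)))%:E)%E.
    apply: (le_trans Ele); rewrite lee_fin ler_wpM2r ?(mulr_ge0 K4)// ?addr_ge0//.
    by rewrite expr2 ler_piMl ?(ltW (eps_pos k)).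
  apply: (@le_trans _ _ (((rho ^+ 2) ^+ m)%:E * E)%E).
    by rewrite lee_wpmul2r// lee_fin.
  by rewrite EFinM lee_wpmul2l// lee_fin exprn_ge0// sqr_ge0.
- apply: measurable_funX; apply: measurable_funM => //; apply: measurable_enorm.
  have mht : measurable_rV (fun w => mean_half (t k w) (x k w)).
    apply: (measurable_proj X_closed X_convex X_ne); apply: measurable_rVB => //.
    by apply: measurable_rVZ => //; exact: measurable_rV_comp.
  exact: mG.
- by move=> w; exact: sqr_ge0.
- by move=> w; rewrite /error_half exprMn.
Qed.

Lemma expectation_dist_half : ('E_P[dist_half] <=
  (3 * ((1 + l) ^+ 2 * v + enorm (H xsol) ^+ 2 + 3 * K * (1 + v)))%:E)%E.
Proof.
have mE : measurable_fun setT error_xi.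
  apply: measurable_funX; apply: measurable_funM; last first.
    by apply: measurable_enorm; exact: mG.
  apply: measurable_funD => //; apply: measurable_funM => //.
  by apply: measurable_sum => j; exact: measurableT_comp.
have E1 : ('E_P[error_xi] <= (3 * K * (1 + v))%:E)%E.
  apply: (le_trans expectation_error_xi); rewrite lee_fin ler_piMl//.
  by rewrite !mulr_ge0 ?addr_ge0// ltW.
have a0 : 0 <= 3 * (1 + l) ^+ 2 by rewrite mulr_ge0 ?sqr_ge0.
have c0 : 0 <= 3 * enorm (H xsol) ^+ 2 by rewrite mulr_ge0 ?sqr_ge0.
have := expectation_affine_le (mdist2 (mx k)) mE (fun w => sqr_ge0 _)
  (fun w => sqr_ge0 _) a0 (ler0n _ 3) c0 xv E1.
have -> : 3 * (1 + l) ^+ 2 * v + 3 * (3 * K * (1 + v)) + 3 * enorm (H xsol) ^+ 2 =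
  3 * ((1 + l) ^+ 2 * v + enorm (H xsol) ^+ 2 + 3 * K * (1 + v)) by ring.
apply: le_trans; apply: expectation_le_all => //.
- exact: mdist2.
- apply: measurable_funD => //; apply: measurable_funD; apply: measurable_funM => //.
  exact: mdist2.
- by move=> w; exact: sqr_ge0.
move=> w; have := half_step_dist X_closed X_convex gamma_range rho_range H_lip
  xsol_sol (Gxi := Gxi k w) (x := x k w) (t := t k w) (z := z k w) erefl erefl.
have : enorm (Gxi k w (x k w) - H (x k w)) ^+ 2 <= error_xi w.
  rewrite /error_xi exprMn ler_peMl ?sqr_ge0// exprn_ege1//.
  by rewrite (le_trans l_ge1)// lerDr batch_mean_ge0.
by rewrite /dist_half; lra.
Qed.

Lemma expectation_error_eta (s : R) : ('E_P[dist_half] <= s%:E)%E ->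
  ('E_P[error_eta] <= (eps k ^+ 2 * (4 * K * (1 + s)))%:E)%E.
Proof.
move=> hs; have K4 : 0 <= 4 * K by rewrite mulr_ge0// ltW.
apply: le_trans (expectation_dist_le (mz k) (sqr_ge0 _) K4 hs).
exact: (expectation_sampling_error T_meas H_cont T_mean mU mV U1 V0 K_ge1 U_moment
    V_moment growth (S_gt0 k) (es_iid k) (mz k) (indep_hist_eta (k := k))).
Qed.

Lemma expectation_residual_finite : ('E_P[fun w => r2 (x k w)] <=
  (2 * ((2 + l) ^+ 2 * v + enorm (H xsol) ^+ 2))%:E)%E.
Proof.
have a0 : 0 <= 2 * (2 + l) ^+ 2 by rewrite mulr_ge0 ?sqr_ge0.
have c0 : 0 <= 2 * enorm (H xsol) ^+ 2 by rewrite mulr_ge0 ?sqr_ge0.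
have := expectation_affine_le (mdist2 (mx k)) (mdist2 (mx k)) (fun w => sqr_ge0 _)
  (fun w => sqr_ge0 _) a0 (lexx 0) c0 xv xv.
have -> : 2 * (2 + l) ^+ 2 * v + 0 * v + 2 * enorm (H xsol) ^+ 2 =
  2 * ((2 + l) ^+ 2 * v + enorm (H xsol) ^+ 2) by ring.
apply: le_trans; apply: expectation_le_all => //.
- apply: measurable_funD => //; apply: measurable_funD; apply: measurable_funM => //;
    exact: mdist2 (mx k).
- by move=> w; exact: sqr_ge0.
move=> w; have := residual_sqr_le X_closed X_convex gamma_range H_lip xsol_sol (x k w).
lra.
Qed.

(** Independence of the iterate from the batch separates the two factors. *)
Lemma expectation_weighted_residual :
  ('E_P[fun w => (Lk k w / l * r2 (x k w))%R] <= 'E_P[fun w => r2 (x k w)])%E.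
Proof.
have mL' : measurable_fun setT (fun v => L v / l) by exact: measurable_funM.
have L'0 u : 0 <= L u / l by rewrite divr_ge0// ltW.
have L'1 : ('E_P[fun w => (L (xi w) / l)%R] <= 1%:E)%E.
  under eq_fun do rewrite mulrC.
  rewrite ge0_expectationZ ?invr_ge0 ?(ltW l_gt0)//; last exact: measurableT_comp.
  apply: (@le_trans _ _ ((l^-1)%:E * l%:E)%E).
    by rewrite lee_wpmul2l// lee_fin invr_ge0 ltW.
  by rewrite -EFinM mulVf// gt_eqF.
have := expectation_batch_mean_mul (S_gt0 k) (smp_iid k) (mx k)
  (indep_hist_xi (g := idfun) (fun u => @cvg_id _ (nbhs u))) mL' L'0 L'1 ler01
  measurable_residual_sqr (fun u => sqr_ge0 _).
congr (_ <= _)%E; congr expectation; apply/funext => w; last by rewrite mul1r.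
by rewrite batch_meanZ.
Qed.

End Iteration.

(** * Summability of the expected squared residuals *)

Local Notation lyap := (lyapunov par xsol B).
Local Notation rate := (residual_rate par l).
Local Notation cost := (noise_cost par).

Let rate_gt0 : 0 < rate.
Proof. exact: (residual_rate_gt0 gamma_range rho_range mu_range l_ge1). Qed.

Let cost_ge0 : 0 <= cost.
Proof. exact/ltW/(noise_cost_gt0 gamma_range rho_range mu_range M_gt0). Qed.

Let acost_ge0 : 0 <= averaging_cost par.
Proof. by rewrite /averaging_cost !mulr_ge0 ?sqr_ge0 ?(ltW M_gt0)// addr_ge0// ltW. Qed.

Definition step_noise k w := (error_xi k w + error_half k w)
  + ((eps k)^-1 * error_eta k w + eps k * dist_half k w).

Let dist_bound := 3 * ((1 + l) ^+ 2 + enorm (H xsol) ^+ 2 + 3 * K).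
Definition noise_bound := 3 * K
  + 4 * K * (1 + 2 * ((1 + l) ^+ 2 + enorm (H xsol) ^+ 2)) / (1 - rho ^+ 2)
  + (4 * K * (1 + dist_bound) + dist_bound).

Let mLk k : measurable_fun setT (fun w => Lk k w).
Proof.
by apply: measurable_funM => //; apply: measurable_sum => j; exact: measurableT_comp.
Qed.

Let Lk_ge1 k w : 1 <= Lk k w.
Proof. by rewrite -[leLHS](batch_mean_cst (S_gt0 k) 1) batch_mean_le. Qed.

Let merror_xi k : measurable_fun setT (error_xi k).
Proof.
apply: measurable_funX; apply: measurable_funM.
  exact: measurable_funD.
by apply: measurable_enorm; exact: mG.
Qed.

Let merror_half k : measurable_fun setT (error_half k).
Proof.
apply: measurable_funX; apply: measurable_funM => //; apply: measurable_enorm.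
apply: mG; apply: (measurable_proj X_closed X_convex X_ne); apply: measurable_rVB => //.
by apply: measurable_rVZ => //; exact: measurable_rV_comp.
Qed.

Let merror_eta k : measurable_fun setT (error_eta k).
Proof. by apply: measurable_funX; apply: measurable_enorm; exact: mG. Qed.

Let mdist_half k : measurable_fun setT (dist_half k).
Proof. exact: mdist2. Qed.

Lemma measurable_step_noise k : measurable_fun setT (step_noise k).
Proof.
apply: measurable_funD; first exact: measurable_funD.
by apply: measurable_funD; exact: measurable_funM.
Qed.

Lemma step_noise_ge0 k w : 0 <= step_noise k w.
Proof.
by rewrite !addr_ge0// ?sqr_ge0// mulr_ge0// ?sqr_ge0// ?invr_ge0 ltW.
Qed.

Lemma expectation_step_noise k v : 0 <= v ->
  ('E_P[fun w => (enorm (x k w - xsol) ^+ 2)%R] <= v%:E)%E ->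
  ('E_P[step_noise k] <= (noise_bound * eps k * (1 + v))%:E)%E.
Proof.
move=> v0 xv; have e0 := eps_pos k; have e1 := eps_le1 k.
have /andP[rho0 rho1] := rho_range.
have ei0 : 0 <= (eps k)^-1 by rewrite invr_ge0 ltW.
have h1 := expectation_error_xi xv.
have h2 := expectation_error_half v0 xv.
have h4 := expectation_dist_half v0 xv.
have h3 := expectation_error_eta h4.
apply: (le_trans (expectation_sum4_le _ _ _ _ _ _ _ _ ei0 (ltW e0) h1 h2 h3 h4)) => //;
  try by move=> w; exact: sqr_ge0.
rewrite lee_fin.
set h := enorm (H xsol) ^+ 2; have hh0 : 0 <= h by exact: sqr_ge0.
set q := (1 + l) ^+ 2; have q0 : 0 <= q by exact: sqr_ge0.
have K0 := ltW K_gt0.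
have d_le : 3 * (q * v + h + 3 * K * (1 + v)) <= dist_bound * (1 + v).
  rewrite /dist_bound -/q -/h; have := mulr_ge0 hh0 v0; lra.
have half_le : 1 + half_bound v <= (1 + 2 * (q + h)) * (1 + v).
  rewrite /half_bound -/q -/h; have := mulr_ge0 hh0 v0; have := mulr_ge0 q0 v0; lra.
have dist0 : 0 <= dist_bound by rewrite /dist_bound mulr_ge0// !addr_ge0 ?sqr_ge0// mulr_ge0.
have d1_le : 1 + 3 * (q * v + h + 3 * K * (1 + v)) <= (1 + dist_bound) * (1 + v).
  by move: d_le; have := v0; clearbody dist_bound; lra.
have K40 : 0 <= 4 * K by rewrite mulr_ge0.
have r0 : 0 <= (1 - rho ^+ 2)^-1 by rewrite invr_ge0 subr_ge0 expr_le1// ltW.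
have p1 := ler_wpM2l (ltW e0) (ler_wpM2r r0 (ler_wpM2l K40 half_le)).
have p2 := ler_wpM2l (ltW e0) (ler_wpM2l K40 d1_le).
have p3 := ler_wpM2l (ltW e0) d_le.
have -> : (eps k)^-1 * (eps k ^+ 2 * (4 * K * (1 + 3 * (q * v + h + 3 * K * (1 + v))))) =
  eps k * (4 * K * (1 + 3 * (q * v + h + 3 * K * (1 + v)))).
  by rewrite mulrA expr2 mulrA mulVf ?mul1r// gt_eqF.
rewrite /noise_bound -/q -/h; move: p1 p2 p3; clearbody dist_bound.
move: (eps k) (_^-1) (half_bound v) (3 * (q * v + h + 3 * K * (1 + v))) => e rr hb s.
lra.
Qed.

Lemma state_counter_gt0 k w : (0 < (state k w).2)%N.
Proof.
elim: k => [//|k IH]; rewrite /state /= -/(state k w) [state k w]surjective_pairing.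
exact: aseg_step_counter_gt0.
Qed.

Lemma sampled_map_lipschitz : {ae P, forall w, forall k u y,
  enorm (Gxi k w u - Gxi k w y) <= Lk k w * enorm (u - y)}.
Proof.
have : {ae P, forall w, forall k j u y,
    enorm (T (smp k j w) u - T (smp k j w) y) <= L (smp k j w) * enorm (u - y)}.
  apply: ae_foralln => k; exact: (ae_batch (smp_iid k) T_lip).
apply: filterS => w lip k u y.
rewrite /sampled_map -scalerBr -sumrB enormZ ger0_norm ?invr_ge0// -batch_meanZ.
rewrite ler_wpM2l ?invr_ge0//.
apply: (le_trans (_ : _ <= \sum_(j < S k) enorm (T (smp k j w) u - T (smp k j w) y))).
  elim/big_rec2 : _ => [|j p q _ IH]; first by rewrite enorm0.
  by rewrite (le_trans (ler_enormD _ _))// lerD2l.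
by apply: ler_sum => j _; exact: lip.
Qed.

Lemma lyapunov_step : {ae P, forall w, forall k,
  lyap (state k.+1 w) + 3 * rate * r2 (x k w) <=
  lyap (state k w) + cost * step_noise k w + 2 * rate * (Lk k w / l * r2 (x k w))}.
Proof.
apply: filterS sampled_map_lipschitz => w lip k.
have := aseg_step_residual X_closed X_convex nu_ge0 gamma_range rho_range mu_range M_gt0
  l_ge1 H_lip xsol_sol H_pm B_step (Geta k w) (Lk_ge1 k w) (lip k)
  (state_counter_gt0 k w) (t := t k w) (z := z k w) erefl erefl (eps_range k) erefl.
rewrite -surjective_pairing; congr (_ <= _ + cost * _ + _).
by rewrite /step_noise [(eps k)^-1 * _]mulrC !addrA.
Qed.

Let mlyap k : measurable_fun setT (fun w => lyap (state k w)).
Proof.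
have [m1 m2] := measurable_state k.
apply: measurable_funD; first exact: mdist2.
exact: (measurable_fun_nat_index (f := fun j _ => averaging_cost par * B j) m2).
Qed.

Let lyap_ge0 k w : 0 <= lyap (state k w).
Proof. by rewrite addr_ge0 ?sqr_ge0// mulr_ge0. Qed.

Lemma dist_le_lyapunov k a : ('E_P[fun w => lyap (state k w)] <= a%:E)%E ->
  ('E_P[fun w => (enorm (x k w - xsol) ^+ 2)%R] <= a%:E)%E.
Proof.
apply: le_trans; apply: expectation_le_all => //.
- exact: mdist2.
- by move=> w; exact: sqr_ge0.
- by move=> w; rewrite lerDl mulr_ge0.
Qed.

Lemma residual_expectation_finite k a : 0 <= a ->
  ('E_P[fun w => lyap (state k w)] <= a%:E)%E ->
  ('E_P[fun w => r2 (x k w)])%E \is a fin_num.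
Proof.
move=> a0 /dist_le_lyapunov la.
have E0 : (0 <= 'E_P[fun w => r2 (x k w)])%E by apply: expectation_ge0 => w; exact: sqr_ge0.
rewrite ge0_fin_numE//; apply: le_lt_trans (ltry _).
exact: expectation_residual_finite la.
Qed.

(** The batch mean of [L] is independent of the current iterate and has mean at
    most [l], so two of the three copies of the residual on the left of
    [lyapunov_step] absorb the residual on the right. *)
Lemma lyapunov_recursion k (a : R) : 0 <= a ->
  ('E_P[fun w => lyap (state k w)] <= a%:E)%E ->
  ('E_P[fun w => lyap (state k.+1 w)] + rate%:E * 'E_P[fun w => r2 (x k w)]
     <= (a + cost * noise_bound * eps k * (1 + a))%:E)%E.
Proof.
move=> a0 la; have rfin := residual_expectation_finite a0 la.
have mW : measurable_fun setT (fun w => Lk k w / l * r2 (x k w)).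
  by apply: measurable_funM => //; exact: measurable_funM.
have W0 w : 0 <= Lk k w / l * r2 (x k w).
  by rewrite mulr_ge0 ?sqr_ge0// divr_ge0 ?(ltW l_gt0)// (le_trans _ (Lk_ge1 k w)).
have c3 : 0 <= 3 * rate by rewrite mulr_ge0// ltW.
have c2 : 0 <= 2 * rate by rewrite mulr_ge0// ltW.
have mN := measurable_step_noise k; have N0 := step_noise_ge0 k.
have mcN : measurable_fun setT (fun w => cost * step_noise k w) by exact: measurable_funM.
have mcW : measurable_fun setT (fun w => 2 * rate * (Lk k w / l * r2 (x k w))).
  exact: measurable_funM.
have mcr : measurable_fun setT (fun w => 3 * rate * r2 (x k w)) by exact: measurable_funM.
have r20 w : 0 <= r2 (x k w) by exact: sqr_ge0.
have main : ('E_P[fun w => (lyap (state k.+1 w) + 3 * rate * r2 (x k w))%R] <=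
    'E_P[fun w => (lyap (state k w) + cost * step_noise k w
       + 2 * rate * (Lk k w / l * r2 (x k w)))%R])%E.
  apply: ae_expectation_le.
  - exact: measurable_funD.
  - by apply: measurable_funD => //; exact: measurable_funD.
  - by move=> w; rewrite addr_ge0// mulr_ge0.
  - move=> w.
    exact: (addr_ge0 (addr_ge0 (lyap_ge0 k w) (mulr_ge0 cost_ge0 (N0 w))) (mulr_ge0 c2 (W0 w))).
  - by apply: filterS lyapunov_step => w; exact.
move: main; rewrite ge0_expectationD//; last by move=> w; rewrite mulr_ge0.
rewrite ge0_expectationZ// ge0_expectationD//; first last.
- by move=> w; rewrite mulr_ge0.
- by move=> w; rewrite addr_ge0// mulr_ge0.
- exact: measurable_funD.
rewrite ge0_expectationZ// ge0_expectationD//; last by move=> w; rewrite mulr_ge0.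
rewrite ge0_expectationZ//.
have costE : (0 <= cost%:E)%E by rewrite lee_fin.
have c2E : (0 <= (2 * rate)%:E)%E by rewrite lee_fin.
have hN := lee_wpmul2l costE (expectation_step_noise a0 (dist_le_lyapunov la)).
have hW := lee_wpmul2l c2E (expectation_weighted_residual k).
move=> /le_trans/(_ (leeD (leeD la hN) hW)).
move: rfin; case: ('E_P[fun w => r2 (x k w)])%E => [r| |]// _.
rewrite -!EFinM -!EFinD.
have : (0 <= 'E_P[fun w => lyap (state k.+1 w)])%E by exact: expectation_ge0.
case: ('E_P[fun w => lyap (state k.+1 w)])%E => [y| |]// _.
by rewrite -!EFinD !lee_fin; lra.
Qed.

Lemma residual_summable (E : R) : (forall N, \sum_(k < N) eps k <= E) ->
  exists2 C : R, 0 < C & exists r : nat -> R, [/\ forall k, 0 <= r k,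
    forall k, ('E_P[fun w => r2 (x k w)] <= (r k)%:E)%E &
    forall N, \sum_(k < N) r k <= C].
Proof.
move=> eE.
pose a k := fine 'E_P[fun w => lyap (state k w)]%E.
have E0 k : (0 <= 'E_P[fun w => lyap (state k w)])%E by exact: expectation_ge0.
have a0 k : 0 <= a k by exact: fine_ge0.
have aE k : 'E_P[fun w => lyap (state k w)]%E = (a k)%:E.
  rewrite /a fineK//; elim: k => [|k IH].
    have -> : (fun w => lyap (state 0 w)) = fun=> lyap (x0, 1%N) by [].
    by rewrite expectation_const.
  have lek : ('E_P[fun w => lyap (state k w)] <= (a k)%:E)%E by rewrite /a fineK.
  rewrite ge0_fin_numE//.
  have := lyapunov_recursion (a0 k) lek.
  set Er := ('E_P[fun w => r2 (x k w)])%E => rec.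
  have Er0 : (0 <= rate%:E * Er)%E.
    rewrite mule_ge0// ?lee_fin ?(ltW rate_gt0)//.
    by apply: expectation_ge0 => w; exact: sqr_ge0.
  by apply: le_lt_trans (ltry _); apply: le_trans rec; rewrite leeDl.
pose r k := fine 'E_P[fun w => r2 (x k w)]%E.
have rE0 k : (0 <= 'E_P[fun w => r2 (x k w)])%E.
  by apply: expectation_ge0 => w; exact: sqr_ge0.
have rE k : 'E_P[fun w => r2 (x k w)]%E = (r k)%:E.
  by rewrite /r fineK// (residual_expectation_finite (a0 k))// aE.
have r0 k : 0 <= r k by exact: fine_ge0.
have K0 := ltW K_gt0; have /andP[rho0 rho1] := rho_range.
have db0 : 0 <= dist_bound by rewrite /dist_bound mulr_ge0// !addr_ge0 ?sqr_ge0// mulr_ge0.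
have C0 : 0 <= cost * noise_bound.
  rewrite mulr_ge0// /noise_bound; clearbody dist_bound; rewrite !addr_ge0 ?mulr_ge0//.
  - by rewrite addr_ge0// mulr_ge0// addr_ge0 ?sqr_ge0.
  - by rewrite invr_ge0 subr_ge0 expr_le1// ltW.
  - by rewrite addr_ge0.
have rr0 k : 0 <= rate * r k by rewrite mulr_ge0// ltW.
have rec k : a k.+1 + rate * r k <= a k + cost * noise_bound * eps k * (1 + a k).
  have lek : ('E_P[fun w => lyap (state k w)] <= (a k)%:E)%E by rewrite aE.
  by have := lyapunov_recursion (a0 k) lek; rewrite !aE rE -EFinM -EFinD lee_fin.
have [C C_gt0 bound] := summable_perturbation a0 rr0 (fun k => ltW (eps_pos k)) C0 eE rec.
exists (C / rate); first by rewrite divr_gt0.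
exists r; split => // [k|N]; first by rewrite rE.
by rewrite ler_pdivlMr// mulrC mulr_sumr.
Qed.

End Convergence.
(** * Iteration and oracle complexity *)

(** Logarithm of the lower bound [line_search_lower] on the accepted step. *)
Lemma line_search_log_bound (R : realType) (n : nat) (X : set 'rV[R]_n)
    (par : aseg_params R) (G : 'rV[R]_n -> 'rV[R]_n) (Lk : R) (x : 'rV[R]_n) :
  0 < as_gamma par <= 1 -> 0 < as_rho par < 1 -> 0 < as_mu par -> 1 <= Lk ->
  (forall u v, enorm (G u - G v) <= Lk * enorm (u - v)) ->
  (aseg_backtracks X par G x)%:R <= log_base (as_rho par)^-1
    (as_gamma par * Lk / Num.min (as_rho par * as_mu par) (as_gamma par)).
Proof.
move=> gamma_range rho_range mu_gt0 Lk1 G_lip.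
have /andP[gamma0 gamma1] := gamma_range; have /andP[rho0 rho1] := rho_range.
have Lk0 : 0 < Lk by exact: lt_le_trans Lk1.
have := line_search_lower X gamma_range rho_range mu_gt0 Lk1 G_lip x.
set m := aseg_backtracks _ _ _ _; set a := Num.min _ _ => lower.
have a0 : 0 < a by rewrite lt_min gamma0 andbT mulr_gt0.
have rhom : 0 < as_rho par ^+ m by rewrite exprn_gt0.
have lnr : 0 < ln (as_rho par)^-1 by rewrite ln_gt0// invf_gt1.
rewrite /log_base ler_pdivlMr// mulr_natl -lnXn ?invr_gt0//.
rewrite ler_ln ?posrE ?exprn_gt0 ?invr_gt0 ?divr_gt0 ?mulr_gt0//.
rewrite exprVn ler_pdivlMr// mulrC ler_pdivrMr//.
by move: lower; rewrite ler_pdivrMr// mulrAC.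
Qed.

Lemma exists_le_average (R : realType) (r : nat -> R) (N : nat) (C v : R) :
  \sum_(k < N.+1) r k <= C -> C < N.+1%:R * v -> exists2 k, (k < N.+1)%N & r k <= v.
Proof.
move=> sumC Cv; apply: contrapT => no_small.
have : \sum_(k < N.+1) v <= \sum_(k < N.+1) r k.
  apply: ler_sum => k _; rewrite leNgt; apply/negP => rv.
  by apply: no_small; exists k => //; exact: ltW.
rewrite sumr_const card_ord -(mulr_natl v) => h.
by have := lt_le_trans Cv (le_trans h sumC); rewrite ltxx.
Qed.

Theorem theorem3p4
  (R : realType) (n : nat)
  (d d' : measure_display)
  (Omega : measurableType d) (Xi : measurableType d')
  (P : probability Omega R)
  (X : set 'rV[R]_n) (X_closed : closed X) (X_convex : convex_set X)
  (T : Xi -> 'rV[R]_n -> 'rV[R]_n)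
  (T_meas : measurable_fun [set: Xi * borel_rV R n]
     (fun z : Xi * borel_rV R n => T z.1 z.2 : borel_rV R n))
  (xi : {mfun Omega >-> Xi})
  (H : 'rV[R]_n -> 'rV[R]_n)
  (H_def : forall x, H x =
     \row_(i < n) fine 'E_P[(fun w => T (xi w) x 0%R i)]%E)
  (SOL_nonempty : SOL X H !=set0)
  (* Assumption 1 *)
  (H_pseudomonotone : pseudomonotone X H)
  (* Assumption 2 (i) *)
  (L : Xi -> R) (L_meas : measurable_fun [set: Xi] L)
  (L_ge1 : {ae P, forall w, 1 <= L (xi w)})
  (T_lipschitz : {ae distribution P xi, forall v, forall x y,
     enorm (T v x - T v y) <= L v * enorm (x - y)})
  (L_moments : forall p : R, 2 <= p ->
     ('E_P[(fun w => (L (xi w) `^ (2 * p))%R)] < +oo)%E)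
  (* Assumption 2 (ii) *)
  (T_moment : exists (xc : 'rV[R]_n) (q : R), 2 <= q /\
     ('E_P[(fun w => (enorm (T (xi w) xc) `^ (2 * q))%R)] < +oo)%E)
  (* Sample rate *)
  (NN : nat) (NN_gt0 : (0 < NN)%N)
  (cN : R) (cN_gt0 : 0 < cN) (NN_bigO : NN%:R <= cN * n%:R ^+ 2)
  (b lambda : R) (b_gt0 : 0 < b) (lambda_gt2 : 2 < lambda)
  (Sk : nat -> nat) (Sk_def : Sk = sample_rate NN lambda b)
  (* Assumption 3 *)
  (xs es : sample_array Sk {mfun Omega >-> Xi})
  (samples : sampling_scheme P xi xs es)
  (Sk_summable : cvgn (series (fun k => (Num.sqrt (Sk k)%:R)^-1 : R)))
  (* Parameters of the algorithm *)
  (par : aseg_params R)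
  (nu_ge0 : 0 <= as_nu par)
  (gamma_range : 0 < as_gamma par <= 1)
  (rho_range : 0 < as_rho par < 1)
  (mu_range : 0 < as_mu par < Num.sqrt 3 / 3)
  (tau_gt : 2^-1 < as_tau par)
  (M_gt0 : 0 < as_M par)
  (x0 : 'rV[R]_n) (x0_in : X x0)
  (x : nat -> Omega -> 'rV[R]_n)
  (x_def : forall k w, x k w =
     aseg_iterate X T par (fun i j => xs i j w) (fun i j => es i j w) x0 k)
  (m : nat -> Omega -> nat)
  (m_def : forall k w, m k w =
     aseg_calls X T par (fun i j => xs i j w) (fun i j => es i j w) x0 k)
  (Lt : nat -> Omega -> R)
  (Lt_def : forall k w, Lt k w =
     (Sk k)%:R^-1 * \sum_(j < Sk k) L (xs k j w)) :
  exists N : R -> nat,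
    [/\ forall vs : R, 0 < vs ->
          (\big[mine/+oo]_(0 <= k < (N vs).+1)
             'E_P[(fun w => (residual X H (as_gamma par) (x k w) ^+ 2)%R)]
           <= vs%:E)%E,
        exists2 c : R, 0 < c & forall vs : R, 0 < vs ->
          (N vs)%:R <= c * (b^-1 * vs^-1) &
        (* l0 keeps the logarithmic factor away from 0: that factor vanishes
           if L = 1 and gamma <= rho * mu *)
        forall l0 : R, 0 < l0 ->
        exists2 C : R, 0 < C &
        \forall vs \near (0 : R)^'+, {ae P, forall w,
          \sum_(0 <= k < (N vs).+1) ((1 + m k w) * Sk k)%:R
          <= b^-1 ^+ 3
             * \big[Num.max/l0]_(0 <= k < (N vs).+1)
                 log_base (as_rho par)^-1
                   (as_gamma par * Lt k w
                    / Num.min (as_rho par * as_mu par) (as_gamma par))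
             * ln (b^-1 * vs^-1) `^ (2 + 2 * b)
             * (C * (n%:R ^+ 2 * vs^-1 ^+ 3))}].
Proof.
have [xsol xsol_sol] := SOL_nonempty.
have /andP[gamma0 gamma1] := gamma_range; have /andP[rho0 rho1] := rho_range.
have /andP[mu0 _] := mu_range.
(* Replacing L by max 1 L changes it on a null set only. *)
have L1_law : {ae distribution P xi, forall v, 1 <= L v}.
  have [A [mA A0 subA]] := L_ge1.
  have mB : measurable [set v | L v < 1].
    rewrite -[X in measurable X]setTI.
    have -> : [set v | L v < 1] = L @^-1` `]-oo, 1[%classic.
      by apply/seteqP; split=> v /=; rewrite in_itv.
    exact: L_meas.
  exists [set v | L v < 1]; split => //; last first.
    by move=> v /= /negP; rewrite -ltNge.
  apply: (@subset_measure0 _ _ _ P (xi @^-1` [set v | L v < 1]) A) => //.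
    by rewrite -[X in measurable X]setTI; exact: measurable_funPT.
  by move=> w /= Lw; apply: subA => /=; apply/negP; rewrite -ltNge.
pose L1 v := Num.max 1 (L v).
have L1_meas : measurable_fun setT L1 by exact: measurable_maxr.
have L1_ge1 v : 1 <= L1 v by rewrite le_max lexx.
have L1E : {ae distribution P xi, forall v, L1 v = L v}.
  by apply: filterS L1_law => v Lv; rewrite /L1 max_r.
have L1_lip : {ae distribution P xi, forall v, forall u y,
    enorm (T v u - T v y) <= L1 v * enorm (u - y)}.
  apply: filterS T_lipschitz => v lip u y; apply: (le_trans (lip u y)).
  by rewrite ler_wpM2r ?enorm_ge0// le_max lexx orbT.
have L1_moment : ('E_P[fun w => (L1 (xi w) ^+ 8)%R] < +oo)%E.
  apply: le_lt_trans (L_moments 4 _); last by rewrite ler_nat.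
  have mLxi : measurable_fun setT (fun w => L (xi w)) by exact: measurableT_comp.
  apply: ae_expectation_le.
  - by apply: measurable_funX; exact: measurableT_comp.
  - exact: (measurableT_comp (measurable_powR _) mLxi).
  - by move=> w; rewrite exprn_ge0// (le_trans _ (L1_ge1 _)).
  - by move=> w; exact: powR_ge0.
  apply: filterS L_ge1 => w Lw; rewrite /L1 max_r//.
  by rewrite -natrM powR_mulrn// (le_trans _ Lw).
have T_moment4 : exists xc, ('E_P[fun w => (enorm (T (xi w) xc) ^+ 4)%R] < +oo)%E.
  have [xc [q [q2 Tq]]] := T_moment; exists xc.
  have mTx : measurable_fun setT (fun w => enorm (T (xi w) xc)).
    by apply: measurable_enorm; apply: (measurable_T T_meas) => //; exact: measurable_rV_cst.
  have mTq : measurable_fun setT (fun w => enorm (T (xi w) xc) `^ (2 * q)).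
    exact: (measurableT_comp (measurable_powR _) mTx).
  have : ('E_P[fun w => (1 + enorm (T (xi w) xc) `^ (2 * q))%R] < +oo)%E.
    rewrite ge0_expectationD ?expectation_const ?lte_add_pinfty ?ltry//.
    by move=> w; exact: powR_ge0.
  apply: le_lt_trans; apply: expectation_le_all.
  - exact: measurable_funX.
  - exact: measurable_funD.
  - by move=> w; rewrite exprn_ge0// enorm_ge0.
  move=> w; have := enorm_ge0 (T (xi w) xc); move: (enorm _) => s s0.
  have [s1|/ltW s1] := leP s 1.
    by rewrite (le_trans (exprn_ile1 _ s0 s1))// lerDl powR_ge0.
  rewrite (le_trans (_ : _ <= s `^ (2 * q)))// ?lerDr//.
  rewrite -powR_mulrn// ler_powR//.
  by rewrite (_ : 4%:R = 2 * 2 :> R) ?ler_pM2l// -natrM.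
have [l [l1 L1_mean H_lip]] := mean_operator_lipschitz T_meas H_def L1_meas L1_ge1
  L1_lip L1_moment T_moment4.
have T_mean := T_centered T_meas H_def L1_meas L1_ge1 L1_lip L1_moment T_moment4.
have [K [K1 U_moment V_moment]] := growth_moments H T_meas L1_meas L1_ge1 L1_lip
  L1_moment T_moment4 xsol l1.
have S_gt0 k : (0 < Sk k)%N by rewrite Sk_def sample_rate_gt0.
have [B [B_ge0 B_step]] := power_tail_bound tau_gt.
have eps_ge0 k : 0 <= (Num.sqrt ((Sk k)%:R : R))^-1 by rewrite invr_ge0 sqrtr_ge0.
have [E sum_eps] := cvg_series_bounded eps_ge0 Sk_summable.
have [C C_gt0 [r [r_ge0 r_bound r_sum]]] := residual_summable X_closed X_convex T_meas
  L1_meas L1_ge1 L1_lip l1 L1_mean H_lip T_mean K1 U_moment V_moment xsol_sol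
  H_pseudomonotone S_gt0 samples nu_ge0 gamma_range rho_range mu_range M_gt0 B_ge0
  B_step x0 sum_eps.
have inv_gt0 (vs : R) : 0 < vs -> 0 < b^-1 * vs^-1.
  by move=> vs0; rewrite mulr_gt0// invr_gt0.
(* The largest count allowed by the bound; then (N + 1) * vs exceeds C. *)
pose N (vs : R) := Num.truncn (C * b * (b^-1 * vs^-1)).
have c_gt0 : 0 < C * b by rewrite mulr_gt0.
have N_itv (vs : R) : 0 < vs ->
    (N vs)%:R <= C * b * (b^-1 * vs^-1) < (N vs).+1%:R.
  by move=> vs0; apply: truncn_itv; rewrite mulr_ge0// ltW// inv_gt0.
exists N; split.
- move=> vs vs0; have /andP[_ ltN] := N_itv vs vs0.
  have CN : C < (N vs).+1%:R * vs.
    rewrite -ltr_pdivrMr//; move: ltN; congr (_ < _).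
    by field; rewrite !gt_eqF.
  have [k kN rk] := exists_le_average (r_sum _) CN.
  apply: (bigmin_inf_seq _ k) => //; first by rewrite mem_index_iota.
  apply: le_trans (_ : ((r k)%:E <= vs%:E)%E); last by rewrite lee_fin.
  have := r_bound k; congr (_ <= _)%E; congr expectation; apply/funext => w.
  by rewrite x_def.
- by exists (C * b) => // vs vs0; have /andP[] := N_itv vs vs0.
move=> l0 l0_gt0.
have [C1 C1_gt0 [u0 [u0_gt1 sumS]]] := sum_sample_rate NN b_gt0 lambda_gt2 c_gt0.
exists ((l0^-1 + 1) * C1 * cN).
  by rewrite !mulr_gt0// addr_gt0// invr_gt0.
have u0_gt0 : 0 < u0 by exact: lt_trans u0_gt1.
near=> vs.
have vs0 : 0 < vs by near: vs; exact: nbhs_right_gt.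
have vs_small : vs <= (b * u0)^-1.
  by near: vs; apply: nbhs_right_le; rewrite invr_gt0 mulr_gt0.
set u := b^-1 * vs^-1.
have u0u : u0 <= u.
  rewrite /u -invfM -[leLHS]invrK lef_pV2 ?posrE ?invr_gt0 ?mulr_gt0//.
  move: vs_small; rewrite invfM => h; rewrite -ler_pdivlMl//.
have L_samples : {ae P, forall w, forall k j, L1 (xs k j w) = L (xs k j w)}.
  apply: ae_foralln => k; have [k_iid _ _ _ _] := samples k.
  exact: (ae_batch k_iid L1E).
have lip := sampled_map_lipschitz L1_lip samples.
apply: filterS2 L_samples lip => w Lw lipw.
have LtE k : Lt k w = batch_mean (fun j => L1 (xs k j w)).
  by rewrite Lt_def /batch_mean; under [in RHS]eq_bigr do rewrite Lw.
set ell := \big[Num.max/l0]_(_ <= _ < _) _.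
have ell_l0 : l0 <= ell by exact: bigmax_ge_id.
have ell_gt0 : 0 < ell by exact: lt_le_trans ell_l0.
have m_le k : (k < (N vs).+1)%N -> (m k w)%:R <= ell.
  move=> kN; rewrite m_def /aseg_calls.
  apply: (le_trans (line_search_log_bound X _ gamma_range rho_range mu0 _ (lipw k))).
    by rewrite -[leLHS](batch_mean_cst (S_gt0 k) 1) batch_mean_le.
  rewrite -LtE /ell; apply: (le_bigmax_seq _ k) => //.
  by rewrite mem_index_iota.
have /andP[N_le _] := N_itv vs vs0.
have := sumS u u0u (N vs) N_le; rewrite -Sk_def => sum_le.
(* The lower cut-off l0 turns the additive 1 into a constant factor. *)
have one_ell : 1 + ell <= (l0^-1 + 1) * ell.
  by rewrite mulrDl mul1r lerD2r mulrC ler_pdivlMr// mul1r.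
apply: (@le_trans _ _ ((l0^-1 + 1) * ell * \sum_(0 <= k < (N vs).+1) (Sk k)%:R)).
  rewrite mulr_sumr big_nat [leRHS]big_nat; apply: ler_sum => k kN.
  rewrite natrM ler_wpM2r// natrD (le_trans _ one_ell)// lerD2l.
  exact: m_le.
have coef0 : 0 <= (l0^-1 + 1) * ell.
  by rewrite mulr_ge0 ?(ltW ell_gt0)// addr_ge0// invr_ge0 ltW.
apply: (le_trans (ler_wpM2l coef0 sum_le)).
set be := 2 + 2 * b.
have pow0 : 0 <= ln u `^ be by exact: powR_ge0.
have u3 : u ^+ 3 = b^-1 ^+ 3 * vs^-1 ^+ 3 by rewrite exprMn.
have u30 : 0 <= u ^+ 3 by rewrite exprn_ge0// ltW// (lt_le_trans u0_gt0).
have rest0 : 0 <= (l0^-1 + 1) * ell * C1 * u ^+ 3 * ln u `^ be.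
  by rewrite !(mulr_ge0 _ pow0)// !(mulr_ge0 _ u30)// mulr_ge0// ltW.
have := ler_wpM2r rest0 NN_bigO.
rewrite u3; move: (ln u `^ be) => p.
by congr (_ <= _); ring.
Unshelve. all: by end_near. Qed.
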